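(* Let $Y(\mathbb{R})$ be a translation-invariant Banach function space and let $w$ be either $w_1(x)=e^{cx}$, or $w_2(x)=e^{c\varphi(x)}$, where $c>0$ and $\varphi:\mathbb{R}\to\mathbb{R}$ satisfies $\varphi(x)=x$ for $x\le0$ and $\frac{\varphi(z)-\varphi(x)}{z-x}\ge1$ for all $z>x\ge0$. (a) The normed space $\mathcal{M}_{Y(\mathbb{R},w)}$ is not complete with respect to $\|\cdot\|_{\mathcal{M}_{Y(\mathbb{R},w)}}$. (b) The normed algebra $\mathcal{M}^0_{Y(\mathbb{R},w)}$ is not complete with respect to $\|\cdot\|_{\mathcal{M}^0_{Y(\mathbb{R},w)}}$.
   Context: Banach function spaces on $\mathbb{R}$: let $\mathfrak{M}^+$ be the set of measurable functions with values in $[0,\infty]$. A Banach function norm $\rho:\mathfrak{M}^+\to[0,\infty]$ satisfies, for all $f,g,f_j\in\mathfrak{M}^+$, $a\ge0$, measurable $E$: (A1) $\rho(f)=0\iff f=0$ a.e., $\rho(af)=a\rho(f)$, $\rho(f+g)\le\rho(f)+\rho(g)$; (A2) $0\le g\le f$ a.e. implies $\rho(g)\le\rho(f)$; (A3) $0\le f_j\uparrow f$ a.e. implies $\rho(f_j)\uparrow\rho(f)$; (A4) $|E|<\infty$ implies $\rho(\chi_E)<\infty$; (A5) $|E|<\infty$ implies $\int_Ef\le C_E\rho(f)$ with $C_E$ independent of $f$. $Y(\mathbb{R})$ is the set of measurable complex $f$ with $\rho(|f|)<\infty$, $\|f\|_Y=\rho(|f|)$; translation-invariant means $\|u(\cdot-y)\|_Y=\|u\|_Y$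 for all $y$, $u\in Y$. $Y(\mathbb{R},w)=\{f: fw\in Y\}$ with norm $\|fw\|_Y$. Fourier transform: $(Fu)(\xi)=\int u(x)e^{-ix\xi}dx$. For a normed function space $Z$: $\mathcal{M}_{Z}$ is the set of $a\in S'(\mathbb{R})$ with $\|a\|_{\mathcal{M}_Z}:=\sup\{\|F^{-1}aFu\|_{Z}/\|u\|_{Z}: u\in (S(\mathbb{R})\cap Z)\setminus\{0\}\}<\infty$ (Fourier transforms on $S$, $S'$); $\mathcal{M}^0_{Z}$ is the set of $a\in L^\infty(\mathbb{R})$ with $\|a\|_{\mathcal{M}^0_Z}:=\sup\{\|F^{-1}aFu\|_{Z}/\|u\|_{Z}: u\in (L^2(\mathbb{R})\cap Z)\setminus\{0\}\}<\infty$, with $F^{\pm1}$ on $L^2(\mathbb{R})$. $\mathcal{M}^0_Z$ is a normed algebra under pointwise multiplication. *)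

(* Defs.v *)
From HB Require Import structures.
From mathcomp Require Import all_boot all_order all_algebra.
From mathcomp Require Import all_classical all_reals all_analysis.
From mathcomp Require Import measurable_realfun lebesgue_integral ereal.
From mathcomp Require Import complex.
Set Implicit Arguments. Unset Strict Implicit. Unset Printing Implicit Defensive.
Import Order.TTheory GRing.Theory Num.Theory.
Import numFieldNormedType.Exports.
Local Open Scope classical_set_scope.
Local Open Scope ring_scope.

Section Defs.
Variable R : realType.
Local Notation C := (R[i]).
Local Notation mu := (@lebesgue_measure R).
Definition cabs (z : C) : R := @ComplexField.Normc.normc R z.
Definition rc (x : R) : C := Complex x 0.

Definition cmeas (f : R -> C) : Prop :=
  measurable_fun setT (fun x => complex.Re (f x)) /\ measurable_fun setT (fun x => complex.Im (f x)).

Definition cabsE (f : R -> C) : R -> \bar R := fun x => (cabs (f x))%:E.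

Definition cint (D : set R) (f : R -> C) : C :=
  Complex (Rintegral mu D (fun x => complex.Re (f x))) (Rintegral mu D (fun x => complex.Im (f x))).

Definition expi (t : R) : C := Complex (cos t) (sin t).

Definition Mplus (f : R -> \bar R) : Prop :=
  measurable_fun setT f /\ (forall x, (0 <= f x)%E).

Definition banach_function_norm (rho : (R -> \bar R) -> \bar R) : Prop :=
  [/\
      (forall f, Mplus f -> (rho f = 0%E <-> {ae mu, forall x, f x = 0%E}))
   /\ (forall f (a : R), Mplus f -> 0 <= a ->
         rho (fun x => a%:E * f x)%E = (a%:E * rho f)%E)
   /\ (forall f g, Mplus f -> Mplus g ->
         (rho (fun x => f x + g x)%E <= rho f + rho g)%E),
      (forall f g, Mplus f -> Mplus g ->
         {ae mu, forall x, (g x <= f x)%E} -> (rho g <= rho f)%E),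
      (forall (fs : nat -> R -> \bar R) f, (forall j, Mplus (fs j)) -> Mplus f ->
         {ae mu, forall x, (forall j, (fs j x <= fs j.+1 x)%E) /\
                           ((fun j => fs j x) @ \oo --> f x)} ->
         (fun j => rho (fs j)) @ \oo --> rho f),
      (forall E, measurable E -> (mu E < +oo)%E ->
         (rho (fun x => (\1_E x : R)%:E) < +oo)%E) &
      (forall E, measurable E -> (mu E < +oo)%E ->
         exists CE : R, forall f, Mplus f ->
           (\int[mu]_(x in E) f x <= CE%:E * rho f)%E) ].

Definition translation_invariant (rho : (R -> \bar R) -> \bar R) : Prop :=
  forall (u : R -> C) (y : R), cmeas u -> (rho (cabsE u) < +oo)%E ->
    rho (cabsE (fun x => u (x - y))) = rho (cabsE u).

Definition wnorm (rho : (R -> \bar R) -> \bar R) (w : R -> R) (f : R -> C) : \bar R :=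
  rho (cabsE (fun x => f x * rc (w x))).

Definition memZ (rho : (R -> \bar R) -> \bar R) (w : R -> R) (f : R -> C) : Prop :=
  cmeas (fun x => f x * rc (w x)) /\ (wnorm rho w f < +oo)%E.

(* x / y for y a positive finite extended real *)
Definition eratio (x y : \bar R) : \bar R := (x * ((fine y)^-1)%:E)%E.

Definition cderiv (n : nat) (f : R -> C) : R -> C :=
  fun x => Complex (derive1n n (fun t => complex.Re (f t)) x) (derive1n n (fun t => complex.Im (f t)) x).

Definition smoothC (f : R -> C) : Prop :=
  forall (k : nat) (x : R),
    derivable (derive1n k (fun t => complex.Re (f t))) x 1 /\
    derivable (derive1n k (fun t => complex.Im (f t))) x 1.

Definition schwartz (f : R -> C) : Prop :=
  smoothC f /\
  forall n m : nat, exists B : R, forall x, `|x| ^+ m * cabs (cderiv n f x) <= B.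

Definition test_fun (f : R -> C) : Prop :=
  smoothC f /\ exists K : R, forall x, K < `|x| -> f x = 0.

Definition distr := (R -> C) -> C.

Definition tempered (T : distr) : Prop :=
  (forall f g, schwartz f -> schwartz g -> T (fun x => f x + g x) = T f + T g) /\
  (forall (l : C) f, schwartz f -> T (fun x => l * f x) = l * T f) /\
  (exists (N : nat) (K : R), forall f (B : R), schwartz f ->
     (forall m n x, (m <= N)%N -> (n <= N)%N -> `|x| ^+ m * cabs (cderiv n f x) <= B) ->
     cabs (T f) <= K * B).

Definition FS (f : R -> C) : R -> C :=
  fun xi => cint setT (fun x => f x * expi (- (x * xi))).
Definition FSinv (f : R -> C) : R -> C :=
  fun x => rc ((2 * pi)^-1) * cint setT (fun xi => f xi * expi (x * xi)).

(* F^{-1} a F u for a in S'(R), u in S(R):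
   <F^{-1}(a . Fu), psi> = <a, Fu . F^{-1} psi> *)
Definition mult_op (a : distr) (u : R -> C) : distr :=
  fun psi => a (fun xi => FS u xi * FSinv psi xi).

Definition distr_sub (a b : distr) : distr := fun f => a f - b f.

Definition represents (T : distr) (v : R -> C) : Prop :=
  cmeas v /\
  (forall r : R, mu.-integrable `[-r, r]%classic (fun x => (cabs (v x))%:E)) /\
  (forall psi, test_fun psi -> T psi = cint setT (fun x => v x * psi x)).

(* ||T||_Z, = +oo if T is not given by a function of Z *)
Definition distr_Znorm rho w (T : distr) : \bar R :=
  ereal_inf [set wnorm rho w v | v in [set v | represents T v]].

Definition MZ_norm rho w (a : distr) : \bar R :=
  ereal_sup [set eratio (distr_Znorm rho w (mult_op a u)) (wnorm rho w u)
            | u in [set u | schwartz u /\ memZ rho w u /\ wnorm rho w u <> 0%E]].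

Definition in_MZ rho w (a : distr) : Prop :=
  tempered a /\ (MZ_norm rho w a < +oo)%E.

Definition MZ_complete rho w : Prop :=
  forall a : nat -> distr, (forall n, in_MZ rho w (a n)) ->
    (forall e : R, 0 < e -> exists N, forall n m, (N <= n)%N -> (N <= m)%N ->
       (MZ_norm rho w (distr_sub (a n) (a m)) < e%:E)%E) ->
    exists b, in_MZ rho w b /\
      (fun n => MZ_norm rho w (distr_sub (a n) b)) @ \oo --> 0%E.

Definition L2 (f : R -> C) : Prop :=
  cmeas f /\ (\int[mu]_x ((cabs (f x)) ^+ 2)%:E < +oo)%E.

Definition Linf (f : R -> C) : Prop :=
  cmeas f /\ exists M : R, {ae mu, forall x, cabs (f x) <= M}.

(* g = F u in L^2 (Plancherel: L^2-limit of truncated integrals) *)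
Definition FL2 (u g : R -> C) : Prop :=
  L2 u /\ L2 g /\
  (fun N : nat => (\int[mu]_xi
      ((cabs (g xi - cint `[- (N%:R), N%:R]%classic
                         (fun x => u x * expi (- (x * xi))))) ^+ 2)%:E)%E) @ \oo --> 0%E.

Definition FL2inv (g v : R -> C) : Prop :=
  L2 g /\ L2 v /\
  (fun N : nat => (\int[mu]_x
      ((cabs (v x - rc ((2 * pi)^-1) * cint `[- (N%:R), N%:R]%classic
                         (fun xi => g xi * expi (x * xi)))) ^+ 2)%:E)%E) @ \oo --> 0%E.

Definition M0Z_norm rho w (a : R -> C) : \bar R :=
  ereal_sup [set eratio
      (ereal_inf [set wnorm rho w v |
                  v in [set v | exists g, FL2 u g /\ FL2inv (fun x => a x * g x) v]])
      (wnorm rho w u)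
    | u in [set u | L2 u /\ memZ rho w u /\ wnorm rho w u <> 0%E]].

Definition in_M0Z rho w (a : R -> C) : Prop :=
  Linf a /\ (M0Z_norm rho w a < +oo)%E.

Definition M0Z_complete rho w : Prop :=
  forall a : nat -> R -> C, (forall n, in_M0Z rho w (a n)) ->
    (forall e : R, 0 < e -> exists N, forall n m, (N <= n)%N -> (N <= m)%N ->
       (M0Z_norm rho w (fun x => (a n x - a m x)%R) < e%:E)%E) ->
    exists b, in_M0Z rho w b /\
      (fun n => M0Z_norm rho w (fun x => (a n x - b x)%R)) @ \oo --> 0%E.

End Defs.

(* Main.v *)
Require Import Defs.
From HB Require Import structures.
From mathcomp Require Import all_boot all_order all_algebra.
From mathcomp Require Import all_classical all_reals all_analysis.
From mathcomp Require Import measurable_realfun lebesgue_integral ereal.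
From mathcomp Require Import complex.
From mathcomp Require Import ring lra.
Set Implicit Arguments. Unset Strict Implicit. Unset Printing Implicit Defensive.
Import Order.TTheory GRing.Theory Num.Theory.
Import numFieldNormedType.Exports.
Local Open Scope classical_set_scope.
Local Open Scope ring_scope.

(* Put a_n(x) = sum_{k<n} exp(ck/2) exp(ikx). The multiplier a_n acts as u |-> sum_{k<n} exp(ck/2) u(. + k), and for
   both weights w(x) <= exp(-ct) w(x + t) for t >= 0, so that translation by k has norm at most exp(-ck) on Y(w) and
   (a_n) is a Cauchy sequence in both multiplier norms. A limit b would have to act as the infinite sum.
   For (b), apply it to the indicator u of [0,1): on [-k,-k+1) the result has modulus exp(ck/2), while its L^2 norm is
   at most ||b||_oo ||u||_2 by Plancherel.
   For (a), take a bump u supported in [0,1] and test b(Fu . F^-1 psi) with psi = u(. + j). The value is at least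
   exp(cj/2) ||u||_2^2 - 1, but Fu . F^-1 psi = exp(-ij.) |Fu|^2 / (2 pi) has Schwartz seminorms of polynomial growth
   in j, contradicting temperedness of b. *)

(** The rate [exp(ck/2)] sits between two others: against the shift bound [exp(-ck)] it stays
    summable, yet it outgrows the constant bound that (b) gets from [b] and the polynomial bound
    that (a) gets. The obstacle is that a small norm in Y(w) says nothing pointwise. Axiom (A5) only
    makes the integral over a set of finite measure small, with a constant that depends on the set.
    Hence the order of choices: the window near [-k] is fixed first, far enough out to contradict
    the bound on [b]; only then is [n > k] taken so large that [a_n - b], applied to [u],
    contributes a bounded amount there. No limit of operators is formed, because on that window all
    [a_n] with [n > k] already give the same function. The Fourier analysis rests on one integral,
    that of [(1 - cos(tx))/x^2]. It produces a triangular kernel which is also the overlap of two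
    intervals, and comparing the two origins of this kernel yields Plancherel's identity. *)

(** * Lebesgue integrals under translation and reflection *)

Section LebesgueInvariance.
Variable R : realType.
Local Notation mu := (@lebesgue_measure R).

Lemma lebesgue_measure_shift (a : R) (A : set R) : measurable A ->
  pushforward mu ((fun x => x + a) : _ -> measurableTypeR R) A = mu A.
Proof.
move=> mA; apply/esym/lebesgue_measure_unique => //=.
  exact: measurable_funD.
move=> mf _ [[u v]] _ <-.
rewrite /pushforward.
have -> : (fun x : R => x + a) @^-1` `]u, v]%classic = `]u - a, v - a]%classic.
  by apply/seteqP; split => x /=; rewrite !in_itv/= ltrBlDr lerBrDr.
by rewrite !lebesgue_measure_itv/= !lte_fin ltrD2r -!EFinB; case: ifP => // _; congr (_%:E); ring.
Qed.

Lemma ge0_integral_shift (a : R) (f : R -> \bar R) : measurable_fun setT f ->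
  (forall x, (0 <= f x)%E) -> (\int[mu]_x f (x + a)%R = \int[mu]_x f x)%E.
Proof.
move=> mf f0; transitivity (\int[pushforward mu ((fun x => x + a)%R : _ -> measurableTypeR R)]_x f x)%E.
  by rewrite ge0_integral_pushforward//; exact: measurable_funD.
apply: eq_measure_integral => /=; first exact: measurable_funD.
by move=> mf' A mA _; exact: lebesgue_measure_shift.
Qed.

Lemma ge0_integral_opp (f : R -> \bar R) : measurable_fun setT f ->
  (forall x, (0 <= f x)%E) -> (\int[mu]_x f (- x)%R = \int[mu]_x f x)%E.
Proof.
move=> mf f0; transitivity (\int[pushforward mu (-%R : _ -> measurableTypeR R)]_x f x)%E.
  by rewrite ge0_integral_pushforward.
by apply: eq_measure_integral => //= A mA _; exact: lebesgue_measureN.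
Qed.

Lemma integral_shift (a : R) (f : R -> \bar R) : measurable_fun setT f ->
  (\int[mu]_x f (x + a)%R = \int[mu]_x f x)%E.
Proof.
move=> mf; rewrite integralE [RHS]integralE; congr (_ - _)%E.
- by rewrite -[X in _ = X](ge0_integral_shift a (measurable_funepos mf))//; congr integral; exact: (funepos_comp f (fun x : R => x + a)).
- by rewrite -[X in _ = X](ge0_integral_shift a (measurable_funeneg mf))//; congr integral; exact: (funeneg_comp f (fun x : R => x + a)).
Qed.

Lemma integral_opp (f : R -> \bar R) : measurable_fun setT f ->
  (\int[mu]_x f (- x)%R = \int[mu]_x f x)%E.
Proof.
move=> mf; rewrite integralE [RHS]integralE; congr (_ - _)%E.
- by rewrite -[X in _ = X](ge0_integral_opp (measurable_funepos mf))//; congr integral; exact: (funepos_comp f (@GRing.opp R)).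
- by rewrite -[X in _ = X](ge0_integral_opp (measurable_funeneg mf))//; congr integral; exact: (funeneg_comp f (@GRing.opp R)).
Qed.

Lemma integrable_shift (a : R) (f : R -> \bar R) :
  mu.-integrable setT f -> mu.-integrable setT (fun x => f (x + a)).
Proof.
move=> /integrableP[mf foo]; apply/integrableP; split.
  apply: measurableT_comp => //; exact: measurable_funD.
rewrite (ge0_integral_shift a (f := fun x => `|f x|%E))//.
exact: measurableT_comp.
Qed.

Lemma integrable_opp (f : R -> \bar R) :
  mu.-integrable setT f -> mu.-integrable setT (fun x => f (- x)).
Proof.
move=> /integrableP[mf foo]; apply/integrableP; split.
  by apply: measurableT_comp.
rewrite (ge0_integral_opp (f := fun x => `|f x|%E))//.
exact: measurableT_comp.
Qed.

Lemma Rintegral_shift (a : R) (f : R -> R) : measurable_fun setT f ->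
  \int[mu]_x f (x + a) = \int[mu]_x f x.
Proof.
by move=> mf; rewrite /Rintegral (integral_shift a (f := EFin \o f))//; exact/measurable_EFinP.
Qed.

Lemma Rintegral_opp (f : R -> R) : measurable_fun setT f ->
  \int[mu]_x f (- x) = \int[mu]_x f x.
Proof.
by move=> mf; rewrite /Rintegral (integral_opp (f := EFin \o f))//; exact/measurable_EFinP.
Qed.

End LebesgueInvariance.

(** * Real-valued integrals, domination and Fubini's theorem *)

Section RealIntegral.
Variable R : realType.
Local Notation mu := (@lebesgue_measure R).

Lemma integrable_measurable (f : R -> R) :
  mu.-integrable setT (EFin \o f) -> measurable_fun setT f.
Proof. by move=> /measurable_int/measurable_EFinP. Qed.

Lemma integrable_le (f g : R -> R) : measurable_fun setT f ->
  (forall x, `|f x| <= g x) -> mu.-integrable setT (EFin \o g) ->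
  mu.-integrable setT (EFin \o f).
Proof.
move=> mf fg ig; apply: le_integrable ig => //; first exact/measurable_EFinP.
by move=> x _ /=; rewrite lee_fin (le_trans (fg x))// ler_norm.
Qed.

Lemma EFin_Rintegral (f : R -> R) : mu.-integrable setT (EFin \o f) ->
  (\int[mu]_x (f x)%:E = (\int[mu]_x f x)%:E)%E.
Proof. by move=> fi; rewrite /Rintegral fineK//; exact: integrable_fin_num. Qed.

Local Notation intg f := (mu.-integrable setT (EFin \o f)).

Lemma intgZl (k : R) (f : R -> R) : intg f -> intg (fun x => k * f x).
Proof. exact: (integrableZl measurableT k). Qed.

Lemma intgZr (k : R) (f : R -> R) : intg f -> intg (fun x => f x * k).
Proof. exact: (integrableZr measurableT k). Qed.

Lemma intgD (f g : R -> R) : intg f -> intg g -> intg (fun x => f x + g x).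
Proof. exact: (integrableD measurableT). Qed.

Lemma intgB (f g : R -> R) : intg f -> intg g -> intg (fun x => f x - g x).
Proof. exact: (integrableB measurableT). Qed.

(** Tonelli applies to the positive and the negative part separately, so measurability of the
    partial integral is available before any integrability is known. *)
Lemma measurable_Rintegral2 (f : R -> R -> R) :
  measurable_fun setT (fun z : R * R => f z.1 z.2) ->
  measurable_fun setT (fun x => \int[mu]_y f x y).
Proof.
move=> mf; apply: measurableT_comp => //.
have -> : (fun x => \int[mu]_y (f x y)%:E)%E =
  (fun x => (\int[mu]_y ((fun z : R * R => (f z.1 z.2)%:E)^\+ (x, y)))%E -
            (\int[mu]_y ((fun z : R * R => (f z.1 z.2)%:E)^\- (x, y)))%E)%E.
  apply/funext => x; rewrite integralE; congr (_ - _)%E; congr integral.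
  - exact: (funepos_comp (fun z : R * R => (f z.1 z.2)%:E) (fun y : R => (x, y))).
  - exact: (funeneg_comp (fun z : R * R => (f z.1 z.2)%:E) (fun y : R => (x, y))).
have mE : measurable_fun setT (fun z : R * R => (f z.1 z.2)%:E) by exact/measurable_EFinP.
apply: emeasurable_funB.
- apply: (@measurable_fun_fubini_tonelli_F _ _ _ _ _ mu _ (measurable_funepos mE)) => z.
  exact: funepos_ge0.
- apply: (@measurable_fun_fubini_tonelli_F _ _ _ _ _ mu _ (measurable_funeneg mE)) => z.
  exact: funeneg_ge0.
Qed.

Lemma measurable_swap2 (f : R -> R -> R) :
  measurable_fun setT (fun z : R * R => f z.1 z.2) ->
  measurable_fun setT (fun z : R * R => f z.2 z.1).
Proof.
move=> mf; apply: (@measurableT_comp _ _ _ _ _ _ (fun z : R * R => f z.1 z.2) _ (fun z : R * R => (z.2, z.1))) => //.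
apply: measurable_fun_pair => //=.
Qed.

Lemma measurable_section (f : R -> R -> R) x :
  measurable_fun setT (fun z : R * R => f z.1 z.2) -> measurable_fun setT (f x).
Proof.
move=> mf; apply: (@measurableT_comp _ _ _ _ _ _ (fun z : R * R => f z.1 z.2) _ (fun y : R => (x, y))) => //.
apply: measurable_fun_pair => //=.
Qed.

Section Dominated.
Variables (f : R -> R -> R) (A B : R -> R).
Hypothesis mf : measurable_fun setT (fun z : R * R => f z.1 z.2).
Hypothesis fAB : forall x y, `|f x y| <= A x * B y.
Hypothesis iA : mu.-integrable setT (EFin \o A).
Hypothesis iB : mu.-integrable setT (EFin \o B).

Lemma dominated_section x : mu.-integrable setT (EFin \o f x).
Proof.
apply: (integrable_le (g := fun y => A x * B y)) => //.
- exact: (measurable_section x mf).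
- exact: intgZl.
Qed.

Lemma dominated_Rintegral_le x : `|\int[mu]_y f x y| <= A x * \int[mu]_y B y.
Proof.
have ifx := dominated_section x.
apply: le_trans (le_normr_Rintegral _ _) _ => //.
rewrite -RintegralZl//; apply: le_Rintegral => //.
- exact: integrable_norm.
- exact: intgZl.
Qed.

Lemma dominated_integrable : mu.-integrable setT (EFin \o (fun x => \int[mu]_y f x y)).
Proof.
apply: (integrable_le (g := fun x => A x * \int[mu]_y B y)).
- exact: measurable_Rintegral2.
- exact: dominated_Rintegral_le.
- exact: intgZr.
Qed.

Lemma dominated_prod_integrable :
  (mu \x mu)%E.-integrable setT (fun z : R * R => (f z.1 z.2)%:E).
Proof.
apply/integrable12ltyP => /=; first exact/measurable_EFinP.
have -> : (\int[mu]_x \int[mu]_y `|(f x y)%:E| = \int[mu]_x (\int[mu]_y `|f x y|)%:E)%E.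
  apply: eq_integral => x _; rewrite -EFin_Rintegral//.
  exact: integrable_norm (dominated_section x).
apply: (@le_lt_trans _ _ (\int[mu]_x (A x * \int[mu]_y B y)%:E)%E); last first.
  by rewrite EFin_Rintegral ?ltry//; exact: intgZr.
apply: ge0_le_integral => //.
- by move=> x _; rewrite lee_fin; apply: Rintegral_ge0.
- apply/measurable_EFinP; apply: (measurable_Rintegral2 (f := fun x y => `|f x y|)).
  exact: measurableT_comp.
- exact: (measurable_int _ (intgZr _ iA)).
- move=> x _; rewrite lee_fin -RintegralZl//; apply: le_Rintegral => //.
  + exact: integrable_norm (dominated_section x).
  + exact: intgZl.
Qed.
End Dominated.

(** A product majorant makes every section integrable, not just almost every one, so the real-valued
    inner integrals agree everywhere with the extended ones in Fubini's theorem. *)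
Lemma Rintegral_Fubini (f : R -> R -> R) (A B : R -> R) :
  measurable_fun setT (fun z : R * R => f z.1 z.2) ->
  (forall x y, `|f x y| <= A x * B y) ->
  mu.-integrable setT (EFin \o A) -> mu.-integrable setT (EFin \o B) ->
  \int[mu]_x \int[mu]_y f x y = \int[mu]_y \int[mu]_x f x y.
Proof.
move=> mf fAB iA iB.
have fBA y x : `|f x y| <= B y * A x by rewrite mulrC.
have := Fubini (dominated_prod_integrable mf fAB iA iB) => /= H.
rewrite /Rintegral; congr fine.
transitivity (\int[mu]_x \int[mu]_y (f x y)%:E)%E.
  by apply: eq_integral => x _; rewrite [RHS]EFin_Rintegral//; exact: (dominated_section mf fAB iB).
rewrite H; apply: eq_integral => y _; rewrite EFin_Rintegral//.
exact: (dominated_section (f := fun y x => f x y) (measurable_swap2 mf) fBA).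
Qed.

End RealIntegral.

(** * Elementary integrals over the half line, and the square of a parameter integral *)

Section LaplaceIntegrals.
Variable R : realType.
Local Notation mu := (@lebesgue_measure R).
Local Notation intg f := (mu.-integrable setT (EFin \o f)).

Lemma derivable_continuous (f : R -> R) : (forall x : R, derivable f x 1) -> continuous f.
Proof.
by move=> df x; apply: differentiable_continuous; exact/derivable1_diffP.
Qed.

Lemma ge0_FTC0y (f F : R -> R) (l : R) :
  (forall x, 0 <= x -> 0 <= f x) -> continuous f ->
  (forall x : R, is_derive x 1 F (f x)) -> F x @[x --> +oo] --> l ->
  (\int[mu]_(x in `[0%R, +oo[) (f x)%:E = (l - F 0)%:E)%E.
Proof.
move=> f0 cf dF Fl; rewrite EFinB; apply: ge0_continuous_FTC2y => //.
- exact: continuous_subspaceT.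
- apply: cvg_at_right_filter; apply: differentiable_continuous.
  by apply/derivable1_diffP; exact: ex_derive.
- by move=> x _; rewrite derive1E; exact: derive_val.
Qed.

(** Half of the exponential pays for the factor [s], by [y <= exp y] at [y = s * xi / 2]. *)
Lemma mul_expR_le (xi s : R) : 0 < xi -> 0 <= s -> s * expR (- (s * xi)) <= 2 / xi * expR (- (s * xi / 2)).
Proof.
move=> xi0 s0.
have -> : expR (- (s * xi)) = expR (- (s * xi / 2)) * expR (- (s * xi / 2)).
  by rewrite -expRD; congr expR; field.
rewrite mulrA ler_wpM2r ?expR_ge0// expRN ler_pdivrMr ?expR_gt0//.
apply: (@le_trans _ _ (2 / xi * (s * xi / 2))).
  rewrite le_eqVlt; apply/orP; left; apply/eqP; field; exact: lt0r_neq0.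
apply: ler_wpM2l; first by rewrite divr_ge0// ltW.
by rewrite (le_trans _ (expR_ge1Dx _))// lerDr.
Qed.

Lemma cvgy_expRM (xi : R) : 0 < xi -> expR (- (s * xi)) @[s --> +oo] --> 0.
Proof.
move=> xi0; apply: (cvg_comp (fun s => s * xi) (fun x : R => expR (- x))); last exact: cvgr_expR.
by apply: gt0_cvgMly => //; exact: cvg_id.
Qed.

Lemma cvgy_mul_expRM (xi : R) : 0 < xi -> s * expR (- (s * xi)) @[s --> +oo] --> 0.
Proof.
move=> xi0; apply: (@squeeze_cvgr _ _ _ _ (fun=> 0) (fun s => 2 / xi * expR (- (s * (xi / 2))))).
- near=> s; rewrite mulr_ge0 ?expR_ge0//=.
  have s0 : 0 <= s by near: s; exact: nbhs_pinfty_ge.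
  by rewrite (mulrA s xi) mul_expR_le.
- exact: cvg_cst.
- rewrite -[X in _ --> X](mulr0 (2 / xi)); apply: cvgM; first exact: cvg_cst.
  by apply: cvgy_expRM; rewrite divr_gt0.
Unshelve. all: by end_near. Qed.

Lemma integral_mul_expR (xi : R) : 0 < xi ->
  (\int[mu]_(s in `[0%R, +oo[) (s * expR (- (s * xi)))%:E = (xi ^- 2)%:E)%E.
Proof.
move=> xi0; have xin0 := lt0r_neq0 xi0.
pose F s := - (xi^-1 * (s * expR (- (s * xi)))) - xi ^- 2 * expR (- (s * xi)).
transitivity ((0 - F 0)%:E); last first.
  by rewrite /F !mul0r oppr0 expR0 mulr0 oppr0 !sub0r opprK mulr1.
apply: ge0_FTC0y.
- by move=> x x0; rewrite mulr_ge0// expR_ge0.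
- by apply: derivable_continuous => x; exact: ex_derive.
- move=> x; apply: is_derive_eq; rewrite /GRing.scale/=.
  field; exact: xin0.
- rewrite -[X in _ --> X](_ : - (xi^-1 * 0) - xi ^- 2 * 0 = 0); last by ring.
  apply: cvgB; first apply: cvgN.
    by apply: cvgM; [exact: cvg_cst|exact: cvgy_mul_expRM].
  by apply: cvgM; [exact: cvg_cst|exact: cvgy_expRM].
Qed.

Lemma integral_expR_cos (s t : R) : 0 < s ->
  (\int[mu]_(xi in `[0%R, +oo[) (s * expR (- (s * xi)) * (1 - cos (t * xi)))%:E
   = (t ^+ 2 / (s ^+ 2 + t ^+ 2))%:E)%E.
Proof.
move=> s0; have st : s ^+ 2 + t ^+ 2 != 0.
  by rewrite gt_eqF// ltr_pwDl ?exprn_gt0 ?sqr_ge0.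
(* Sum of the antiderivatives of [s exp(-s xi)] and of [- s exp(-s xi) cos(t xi)]; [K] bounds the
   factor beside the exponential, so [F] vanishes at infinity. *)
pose F xi := expR (- (s * xi)) * (s / (s ^+ 2 + t ^+ 2) * (s * cos (t * xi) - t * sin (t * xi)) - 1).
pose K := `|s / (s ^+ 2 + t ^+ 2)| * (`|s| + `|t|) + 1.
have FK x : `|s / (s ^+ 2 + t ^+ 2) * (s * cos (t * x) - t * sin (t * x)) - 1| <= K.
  rewrite (le_trans (ler_normB _ _))// normr1 lerD2r normrM ler_wpM2l//.
  rewrite (le_trans (ler_normB _ _))// !normrM; apply: lerD; rewrite ler_piMr//.
    exact: cos_max.
  exact: sin_max.
transitivity ((0 - F 0)%:E); last first.
  by congr (_%:E); rewrite /F !mulr0 oppr0 expR0 cos0 sin0; field; exact: st.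
apply: ge0_FTC0y.
- by move=> x x0; rewrite !mulr_ge0// ?expR_ge0// ?ltW// subr_ge0 cos_le1.
- by apply: derivable_continuous => x; exact: ex_derive.
- move=> x; apply: is_derive_eq; rewrite /GRing.scale/=.
  field; exact: st.
- apply: (@squeeze_cvgr _ _ _ _ (fun x => - (K * expR (- (x * s)))) (fun x => K * expR (- (x * s)))).
  + near=> x; rewrite -ler_norml normrM mulrC (ger0_norm (expR_ge0 _)) (mulrC s x).
    by rewrite ler_wpM2r ?expR_ge0//; exact: FK.
  + rewrite -oppr0; apply: cvgN; rewrite -[X in _ --> X](mulr0 K); apply: cvgM; first exact: cvg_cst.
    exact: cvgy_expRM.
  + rewrite -[X in _ --> X](mulr0 K); apply: cvgM; first exact: cvg_cst.
    exact: cvgy_expRM.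
Unshelve. all: by end_near. Qed.

Lemma integral_atan (t : R) : 0 < t ->
  (\int[mu]_(s in `[0%R, +oo[) (t ^+ 2 / (s ^+ 2 + t ^+ 2))%:E = (t * (pi / 2))%:E)%E.
Proof.
move=> t0; have tn0 := lt0r_neq0 t0.
transitivity ((t * (pi / 2) - t * atan (0 / t))%:E); last first.
  by rewrite mul0r atan0 mulr0 subr0.
apply: (@ge0_FTC0y _ (fun s => t * atan (s / t))).
- by move=> x x0; rewrite divr_ge0 ?addr_ge0 ?sqr_ge0.
- apply: derivable_continuous => x; apply: derivableM => //; apply: derivableV.
    by rewrite gt_eqF// ltr_wpDl ?exprn_gt0 ?sqr_ge0.
  exact: ex_derive.
- move=> x; apply: is_derive_eq; rewrite /GRing.scale/=.
  have st : x ^+ 2 + t ^+ 2 != 0 by rewrite gt_eqF// ltr_wpDl ?exprn_gt0 ?sqr_ge0.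
  have st2 : t ^+ 2 + x ^+ 2 != 0 by rewrite addrC.
  by field; rewrite st tn0.
- apply: cvgM; first exact: cvg_cst; apply: (cvg_comp (fun s => s / t) (@atan R)); last exact: cvgy_atan.
  by apply: gt0_cvgMly; rewrite ?invr_gt0//; exact: cvg_id.
Qed.
(** The square is expanded into a double integral over [x] and [y], and the parameter [s] is
    integrated first. It serves twice, for trigonometric kernels and for indicators of balls. The
    bound on [Phi] is asked only where [p] is nonzero, so that in the second case a compact support
    of [p] supplies an integrable [kappa]. *)
Lemma square_Rintegral (p : R -> R) (Phi : R -> R -> R) (kappa : R -> R) :
  intg p -> measurable_fun setT (fun z : R * R => Phi z.1 z.2) ->
  measurable_fun setT kappa -> (forall s, 0 <= kappa s) ->
  (forall x s, p x != 0 -> `|Phi x s| <= kappa s) ->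
  intg (fun s => kappa s ^+ 2) ->
  [/\ intg (fun s => (\int[mu]_x (p x * Phi x s)) ^+ 2),
  (forall x, intg (fun y => p x * p y * \int[mu]_s (Phi x s * Phi y s))),
  intg (fun x => \int[mu]_y (p x * p y * \int[mu]_s (Phi x s * Phi y s))) &
  \int[mu]_s ((\int[mu]_x (p x * Phi x s)) ^+ 2) =
  \int[mu]_x \int[mu]_y (p x * p y * \int[mu]_s (Phi x s * Phi y s))].
Proof.
move=> ip mPhi mk k0 pk ik.
have mp := integrable_measurable ip.
have ipn : intg (fun x => `|p x|) by exact: integrable_norm ip.
pose P := \int[mu]_x `|p x|.
pose G s := \int[mu]_x (p x * Phi x s).
have P0 : 0 <= P by apply: Rintegral_ge0.
have pPhi x s : `|p x * Phi x s| <= kappa s * `|p x|.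
  rewrite normrM mulrC; have [->|px] := eqVneq (p x) 0; first by rewrite normr0 !mulr0.
  by apply: ler_wpM2r => //; exact: pk.
have mpPhi : measurable_fun setT (fun z : R * R => p z.1 * Phi z.1 z.2).
  apply: measurable_funM => //; exact: measurableT_comp.
have mf : measurable_fun setT (fun z : R * R => p z.2 * Phi z.2 z.1).
  exact: (measurable_swap2 (f := fun x s => p x * Phi x s) mpPhi).
have isec s : intg (fun x => p x * Phi x s).
  exact: (dominated_section (f := fun s x => p x * Phi x s) mf (fun s x => pPhi x s) ipn).
have mG : measurable_fun setT G by exact: (measurable_Rintegral2 (f := fun s x => p x * Phi x s) mf).
have GP s : `|G s| <= kappa s * P.
  exact: (dominated_Rintegral_le (f := fun s x => p x * Phi x s) mf (fun s x => pPhi x s) ipn).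
have iG : intg (fun s => G s ^+ 2).
  apply: (integrable_le (g := fun s => kappa s ^+ 2 * P ^+ 2)).
  - exact: measurable_funX.
  - by move=> s; rewrite normrX -exprMn lerXn2r ?nnegrE// mulr_ge0.
  - exact: intgZr.
have mpG : measurable_fun setT (fun z : R * R => p z.2 * Phi z.2 z.1 * G z.1).
  by apply: measurable_funM => //; exact: measurableT_comp.
have pG s x : `|p x * Phi x s * G s| <= (kappa s ^+ 2 * P) * `|p x|.
  rewrite normrM expr2.
  apply: (@le_trans _ _ (kappa s * `|p x| * (kappa s * P))).
    by apply: ler_pM => //; exact: normr_ge0.
  by rewrite le_eqVlt; apply/orP; left; apply/eqP; ring.
have ikP : intg (fun s => kappa s ^+ 2 * P) by exact: intgZr.
have Ex x : (\int[mu]_s (p x * Phi x s * G s) =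
    \int[mu]_y (p x * p y * \int[mu]_s (Phi x s * Phi y s))) /\
    intg (fun y => p x * p y * \int[mu]_s (Phi x s * Phi y s)).
  have ikp : intg (fun s => kappa s ^+ 2 * `|p x|) by exact: intgZr.
  have mpp : measurable_fun setT (fun z : R * R => p x * Phi x z.1 * (p z.2 * Phi z.2 z.1)).
    apply: measurable_funM => //; apply: measurable_funM => //.
    exact: (measurableT_comp (measurable_section x mPhi)).
  have bpp s y : `|p x * Phi x s * (p y * Phi y s)| <= (kappa s ^+ 2 * `|p x|) * `|p y|.
    rewrite normrM expr2.
    apply: (@le_trans _ _ (kappa s * `|p x| * (kappa s * `|p y|))).
      by apply: ler_pM => //; exact: normr_ge0.
    by rewrite le_eqVlt; apply/orP; left; apply/eqP; ring.
  have Ey y : \int[mu]_s (p x * Phi x s * (p y * Phi y s)) = p x * p y * \int[mu]_s (Phi x s * Phi y s).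
    under eq_Rintegral do rewrite mulrACA.
    have [->|px] := eqVneq (p x) 0.
      by rewrite !mul0r; under eq_Rintegral do rewrite !mul0r; rewrite Rintegral_cst// mul0r.
    have [->|py] := eqVneq (p y) 0.
      by rewrite !mulr0 !mul0r; under eq_Rintegral do rewrite !mul0r; rewrite Rintegral_cst// mul0r.
    rewrite RintegralZl//; apply: (integrable_le (g := fun s => kappa s ^+ 2)) => //.
    - apply: measurable_funM; exact: (measurable_section _ mPhi).
    - by move=> s; rewrite normrM expr2; apply: ler_pM => //; exact: pk.
  split.
    transitivity (\int[mu]_s \int[mu]_y (p x * Phi x s * (p y * Phi y s))).
      by apply: eq_Rintegral => s _; rewrite RintegralZl.
    rewrite (Rintegral_Fubini (f := fun s y => p x * Phi x s * (p y * Phi y s)) mpp bpp ikp ipn).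
    by apply: eq_Rintegral => y _; rewrite Ey.
  under [fun y => p x * p y * _]eq_fun do rewrite -Ey.
  apply: (dominated_integrable (f := fun y s => p x * Phi x s * (p y * Phi y s)) (A := fun y => `|p y|) _ _ ipn ikp).
    exact: (measurable_swap2 (f := fun s y => p x * Phi x s * (p y * Phi y s)) mpp).
  by move=> y s; rewrite [leRHS]mulrC; exact: bpp.
split => //.
- by move=> x; exact: (Ex x).2.
- under [fun x => \int[mu]_y _]eq_fun do rewrite -(Ex _).1.
  apply: (dominated_integrable (f := fun x s => p x * Phi x s * G s) (A := fun y => `|p y|) _ _ ipn ikP).
    exact: (measurable_swap2 (f := fun s x => p x * Phi x s * G s) mpG).
  by move=> x s; rewrite [leRHS]mulrC; exact: pG.
transitivity (\int[mu]_s \int[mu]_x (p x * Phi x s * G s)).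
  by apply: eq_Rintegral => s _; rewrite RintegralZr// -expr2.
rewrite (Rintegral_Fubini (f := fun s x => p x * Phi x s * G s) mpG pG ikP ipn).
by apply: eq_Rintegral => x _; rewrite (Ex x).1.
Qed.
End LaplaceIntegrals.

(** * The integral of [(1 - cos(tx))/x^2] and the Fejer kernel *)

Section FejerKernel.
Variable R : realType.
Local Notation mu := (@lebesgue_measure R).
Local Notation intg f := (mu.-integrable setT (EFin \o f)).

Lemma integral_oy_indic (f : R -> R) : measurable_fun setT f ->
  (\int[mu]_x (f x * \1_(`]0%R, +oo[%classic) x)%:E = \int[mu]_(x in `[0%R, +oo[) (f x)%:E)%E.
Proof.
move=> mf; rewrite -integral_itv_obnd_cbnd; last first.
  by apply/measurable_EFinP; exact: measurable_funTS.
by rewrite [RHS]integral_mkcond epatch_indic.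
Qed.

Lemma measurable_indic_oy : measurable_fun setT (\1_(`]0%R, +oo[%classic) : R -> R).
Proof. by apply: measurable_indic. Qed.

(* Tonelli, after writing [x^-2] as the integral of [s exp(-s x)] over [s > 0] *)
Lemma integral_sub_cos_oy (t : R) : 0 < t ->
  (\int[mu]_x ((1 - cos (t * x)) / x ^+ 2 * \1_(`]0%R, +oo[%classic) x)%:E = (t * (pi / 2))%:E)%E.
Proof.
move=> t0.
pose I : R -> R := \1_(`]0%R, +oo[%classic).
have mI : measurable_fun setT I by exact: measurable_indic_oy.
have I0 x : 0 <= I x by [].
have IP x : I x = if 0 < x then 1 else 0.
  by rewrite /I indicE mem_setE in_itv/= andbT; case: ifP.
pose f (s x : R) := s * expR (- (s * x)) * (1 - cos (t * x)) * I s * I x.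
have f0 s x : 0 <= f s x.
  rewrite /f (IP s); case: ltP => s0; rewrite ?mulr0 ?mul0r//.
  by rewrite !mulr_ge0 ?expR_ge0 ?(ltW s0) ?subr_ge0 ?cos_le1.
have mfst : measurable_fun setT (fun z : R * R => z.1) by exact: measurable_fst.
have msnd : measurable_fun setT (fun z : R * R => z.2) by exact: measurable_snd.
have mcos : measurable_fun setT (@cos R) by apply: continuous_measurable_fun; exact: continuous_cos.
have mf : measurable_fun setT (fun z : R * R => (f z.1 z.2)%:E).
  apply/measurable_EFinP; rewrite /f.
  apply: measurable_funM; last exact: measurableT_comp.
  apply: measurable_funM; last exact: measurableT_comp.
  apply: measurable_funM.
    apply: measurable_funM => //; do 2 apply: measurableT_comp => //.
    exact: measurable_funM.
  apply: measurable_funB => //; apply: measurableT_comp => //.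
  by apply: measurable_funM.
have me (a : R) : measurable_fun setT (fun s : R => s * expR (- (s * a))).
  by apply: measurable_funM => //; do 2 apply: measurableT_comp => //; exact: measurable_funM.
transitivity (\int[mu]_y \int[mu]_x (f x y)%:E)%E; [clear mf|].
  apply: eq_integral => x _.
  have [x0|x0] := ltP 0 x; last first.
    rewrite -/I IP ltNge x0/= mulr0 integral0_eq// => s _.
    by rewrite /f [I x]IP ltNge x0/= mulr0.
  transitivity (((1 - cos (t * x)) * I x)%:E * \int[mu]_s (s * expR (- (s * x)) * I s)%:E)%E.
    by rewrite integral_oy_indic// integral_mul_expR// -EFinM -/I; congr (_%:E); ring.
  rewrite -ge0_integralZl//.
  - by apply: eq_integral => s _; rewrite -EFinM /f; congr (_%:E); ring.
  - apply/measurable_EFinP; apply: measurable_funM; [exact: me|exact: mI].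
  - move=> s _; rewrite lee_fin [I s]IP; case: ltP => s0; rewrite ?mulr0// mulr1.
    by rewrite mulr_ge0 ?expR_ge0 ?(ltW s0).
  - by rewrite lee_fin mulr_ge0// subr_ge0 cos_le1.
rewrite -(@fubini_tonelli _ _ _ _ R mu mu (fun z : R * R => (f z.1 z.2)%:E) mf (fun z => f0 z.1 z.2)) /=.
clear mf; transitivity (\int[mu]_s (t ^+ 2 / (s ^+ 2 + t ^+ 2) * I s)%:E)%E.
  apply: eq_integral => s _.
  have [s0|s0] := ltP 0 s; last first.
    rewrite IP ltNge s0/= mulr0 integral0_eq// => x _.
    by rewrite /f [I s]IP ltNge s0/= mulr0 mul0r.
  rewrite [I s]IP s0 mulr1 -(integral_expR_cos t s0) -integral_oy_indic.
    by apply: eq_integral => x _; rewrite /f [I s]IP s0 mulr1.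
  apply: measurable_funM; last first.
    by apply: measurable_funB => //; apply: measurableT_comp => //; exact: measurable_funM.
  by apply: measurable_funM => //; do 2 apply: measurableT_comp => //; exact: measurable_funM.
rewrite integral_oy_indic ?integral_atan//.
apply: continuous_measurable_fun; apply: derivable_continuous => x; apply: derivableM => //; apply: derivableV.
    by rewrite gt_eqF// ltr_wpDl ?exprn_gt0 ?sqr_ge0.
exact: ex_derive.
Qed.

(* [x / (x^2 + 1/n)] tends to [x^-1] everywhere since [0^-1 = 0] *)
Lemma measurable_invr : measurable_fun setT (@GRing.inv R).
Proof.
apply: (@measurable_fun_cvg _ _ _ _ (fun n (x : R) => x / (x ^+ 2 + n.+1%:R^-1))).
  move=> n; apply: continuous_measurable_fun; apply: derivable_continuous => x.
  apply: derivableM => //; apply: derivableV; last exact: ex_derive.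
  by rewrite gt_eqF// ltr_wpDl ?sqr_ge0.
move=> x _; have [->|x0] := eqVneq x 0.
  by under eq_fun do rewrite mul0r; rewrite invr0; exact: cvg_cst.
rewrite -[X in _ --> X](_ : x / (x ^+ 2 + 0) = _); last by rewrite addr0; field.
apply: cvgM; first exact: cvg_cst.
apply: cvgV; first by rewrite addr0 expf_neq0.
by apply: cvgD; [exact: cvg_cst|exact: cvg_harmonic].
Qed.

Lemma measurable_sub_cos (t : R) : measurable_fun setT (fun x : R => (1 - cos (t * x)) / x ^+ 2).
Proof.
have mcos : measurable_fun setT (@cos R) by apply: continuous_measurable_fun; exact: continuous_cos.
apply: measurable_funM.
  by apply: measurable_funB => //; apply: measurableT_comp => //; exact: measurable_funM.
apply: measurableT_comp; [exact: measurable_invr|exact: measurable_funX].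
Qed.

(** The splitting [f x = f x * I x + f (- x) * I (- x)] holds at every point; both terms miss the
    origin, which is where [f 0 = 0] enters. *)
Lemma ge0_integral_even (f : R -> R) : measurable_fun setT f -> (forall x, 0 <= f x) ->
  (forall x, f (- x) = f x) -> f 0 = 0 ->
  (\int[mu]_x (f x)%:E = 2%:E * \int[mu]_x (f x * \1_(`]0%R, +oo[%classic) x)%:E)%E.
Proof.
move=> mf f0 fN fz.
pose I : R -> R := \1_(`]0%R, +oo[%classic).
have IP x : I x = if 0 < x then 1 else 0.
  by rewrite /I indicE mem_setE in_itv/= andbT; case: ifP.
have mI : measurable_fun setT I by exact: measurable_indic_oy.
have mfI : measurable_fun setT (fun x => f x * I x) by exact: measurable_funM.
have fI0 x : 0 <= f x * I x by rewrite mulr_ge0.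
have E : (\int[mu]_x (f (- x) * I (- x))%:E = \int[mu]_x (f x * I x)%:E)%E.
  by apply: (ge0_integral_opp (f := fun x => (f x * I x)%:E)) => //; exact/measurable_EFinP.
transitivity (\int[mu]_x (f x * I x)%:E + \int[mu]_x (f (- x) * I (- x))%:E)%E; last first.
  by rewrite E (_ : 2%:E = 1%:E + 1%:E)%E -?EFinD// EFinD ge0_muleDl ?lee_fin// !mul1e.
rewrite -ge0_integralD//.
- apply: eq_integral => x _; rewrite -EFinD; congr (_%:E).
  rewrite fN -mulrDr !IP oppr_gt0; case: ltgtP => //; rewrite ?addr0 ?add0r ?mulr1// => <-.
  by rewrite fz mul0r.
- by move=> x _; rewrite lee_fin.
- exact/measurable_EFinP.
- by move=> x _; rewrite lee_fin.
- apply/measurable_EFinP; exact: (measurableT_comp mfI).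
Qed.

Lemma integral_sub_cos (t : R) :
  (\int[mu]_x ((1 - cos (t * x)) / x ^+ 2)%:E = (pi * `|t|)%:E)%E.
Proof.
wlog t0 : t / 0 <= t => [H|].
  have [/H//|/ltW t0] := leP 0 t.
  rewrite -normrN -H ?oppr_ge0//; apply: eq_integral => x _.
  by rewrite mulNr cosN.
rewrite ger0_norm//.
move: t0; rewrite le_eqVlt => /predU1P[<-|t0].
  by rewrite mulr0 integral0_eq// => x _; rewrite mul0r cos0 subrr mul0r.
rewrite ge0_integral_even.
- rewrite integral_sub_cos_oy// -EFinM; congr (_%:E); by field.
- exact: measurable_sub_cos.
- by move=> x; rewrite mulr_ge0 ?invr_ge0 ?sqr_ge0// subr_ge0 cos_le1.
- by move=> x; rewrite mulrN cosN sqrrN.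
- by rewrite mulr0 cos0 subrr mul0r.
Qed.

Lemma integrable_sub_cos (t : R) : intg (fun x => (1 - cos (t * x)) / x ^+ 2).
Proof.
apply/integrableP; split; first by apply/measurable_EFinP; exact: measurable_sub_cos.
under eq_integral => x _.
  rewrite gee0_abs; last first.
    by rewrite lee_fin mulr_ge0 ?invr_ge0 ?sqr_ge0// subr_ge0 cos_le1.
  over.
by rewrite integral_sub_cos ltry.
Qed.

(** For [h >= 0] this is the triangle [2 max(0, 2h - |t|)], written as a second difference of [|t|]
    because that is how it comes out of [integral_sub_cos]. *)
Definition fejer_kernel (h t : R) := `|t + 2 * h| + `|t - 2 * h| - 2 * `|t|.

(** Product-to-sum formulas turn the integrand into a second difference, in [t] with step [2h], of
    [(1 - cos(tx))/x^2]. *)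
Lemma Rintegral_sinsq_cos (h t : R) :
  \int[mu]_x ((sin (h * x)) ^+ 2 / x ^+ 2 * cos (t * x)) = pi / 4 * fejer_kernel h t.
Proof.
have E x : (sin (h * x)) ^+ 2 / x ^+ 2 * cos (t * x) =
   4^-1 * ((1 - cos ((t + 2 * h) * x)) / x ^+ 2) + 4^-1 * ((1 - cos ((t - 2 * h) * x)) / x ^+ 2)
   - 2^-1 * ((1 - cos (t * x)) / x ^+ 2).
  have -> : (t + 2 * h) * x = t * x + (h * x) *+ 2 by ring.
  have -> : (t - 2 * h) * x = t * x - (h * x) *+ 2 by ring.
  rewrite cosD cosB cos_mulr2n cos2sin2.
  by move: ((x ^+ 2)^-1) => v; field.
have S (u : R) : \int[mu]_x ((1 - cos (u * x)) / x ^+ 2) = pi * `|u|.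
  by rewrite /Rintegral integral_sub_cos.
have I (a u : R) := intgZl a (integrable_sub_cos u).
under eq_Rintegral do rewrite E.
rewrite RintegralB//; last by apply: intgD.
rewrite RintegralD// !RintegralZl ?S//; try exact: integrable_sub_cos.
by rewrite /fejer_kernel; field.
Qed.

Lemma integrable_sinsq (h : R) : intg (fun x => (sin (h * x)) ^+ 2 / x ^+ 2).
Proof.
apply: (integrable_le (g := fun x => 2^-1 * ((1 - cos (2 * h * x)) / x ^+ 2))).
- apply: measurable_funM => //; last first.
    by apply: measurableT_comp; [exact: measurable_invr|exact: measurable_funX].
  apply: measurable_funX; apply: measurableT_comp => //.
    by apply: continuous_measurable_fun; exact: continuous_sin.
- move=> x; rewrite ger0_norm; last by rewrite divr_ge0 ?sqr_ge0.
  have -> : 2 * h * x = (h * x) *+ 2 by ring.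
  rewrite cos_mulr2n cos2sin2 le_eqVlt; apply/orP; left; apply/eqP.
  by move: ((x ^+ 2)^-1) => v; field.
- exact: intgZl (integrable_sub_cos _).
Qed.
End FejerKernel.

(** * Plancherel's identity for real functions of compact support *)

Section Plancherel.
Variable R : realType.
Local Notation mu := (@lebesgue_measure R).
Local Notation intg f := (mu.-integrable setT (EFin \o f)).

(** Fatou's lemma for limits known off a null set and bounds known from some index on. *)
Lemma fatou_ae (f_ : nat -> R -> R) (f : R -> R) (M : \bar R) :
  (forall n, measurable_fun setT (f_ n)) -> measurable_fun setT f ->
  (forall n x, 0 <= f_ n x) -> (forall x, 0 <= f x) ->
  {ae mu, forall x, f_ n x @[n --> \oo] --> f x} ->
  (\forall n \near \oo, (\int[mu]_x (f_ n x)%:E <= M)%E) ->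
  (\int[mu]_x (f x)%:E <= M)%E.
Proof.
move=> mf_ mf f_0 f0 [N [mN N0 NP]] fM.
have mD : measurable (~` N) by exact: measurableC.
have NE : setT `\` N = ~` N by rewrite setTD.
rewrite (ge0_negligible_integral (N := N))//; last 2 first.
- exact/measurable_EFinP.
- by move=> x _; rewrite lee_fin.
rewrite NE.
have -> : (\int[mu]_(x in ~` N) (f x)%:E = \int[mu]_(x in ~` N) limn_einf (fun n => (f_ n x)%:E))%E.
  apply: eq_integral => x; rewrite inE => Nx.
  have H := NP x; have cx : f_ n x @[n --> \oo] --> f x by apply: contrapT => /H.
  have /cvg_limn_einf_sup[-> _]// : (f_ n x)%:E @[n --> \oo] --> (f x)%:E.
  by apply: cvg_EFin => //; exact: nearW.
apply: le_trans (fatou _ _ _ _) _ => //.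
- move=> n; apply/measurable_EFinP; exact: (measurable_funTS (mf_ n)).
- by move=> n x _; rewrite lee_fin.
rewrite limn_einf_lim (cvg_lim _ (@cvg_einfs_sup _ _))//.
apply: ge_ereal_sup => _ [n _ <-].
case: fM => k _ kM.
(* The infimum over the indices from [n] on is tested at one that also lies beyond [k], where the
   bound [M] is valid. *)
apply: (@le_trans _ _ (\int[mu]_(x in ~` N) (f_ (maxn n k) x)%:E)%E).
  by apply: ereal_inf_lbound; exists (maxn n k) => //=; rewrite leq_maxl.
apply: le_trans (kM (maxn n k) _); last by rewrite /= leq_maxr.
apply: ge0_subset_integral => //; first by apply/measurable_EFinP; exact: mf_.
by move=> x _; rewrite lee_fin.
Qed.

Lemma sin_le_id (x : R) : 0 <= x -> sin x <= x.
Proof.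
move=> x0; pose g (y : R) := y - sin y.
have dg (y : R) : is_derive y 1 g (1 - cos y) by apply: is_derive_eq.
have : g 0 <= g x.
  have := @ger0_derive1_le_cc _ g 0 x; apply.
  - by move=> y _; exact: ex_derive.
  - by move=> y _; rewrite derive1E derive_val subr_ge0 cos_le1.
  - by apply: continuous_subspaceT; apply: derivable_continuous => y; exact: ex_derive.
  - by rewrite in_itv/= lexx.
  - by rewrite in_itv/= lexx x0.
  - by [].
by rewrite /g sin0 subr0 subr_ge0.
Qed.

Lemma norm_sin_le (x : R) : `|sin x| <= `|x|.
Proof.
wlog x0 : x / 0 <= x => [H|].
  have [/H//|/ltW x0] := leP 0 x.
  by rewrite -normrN -sinN -[leRHS]normrN H// oppr_ge0.
rewrite (ger0_norm x0) ler_norml sin_le_id// andbT.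
have [x1|x1] := leP x 1; last by rewrite (le_trans _ (sin_geN1 _))// lerN2 ltW.
rewrite (@le_trans _ _ 0)// ?oppr_le0//; apply: sin_ge0_pi.
by rewrite x0 (le_trans x1)// (le_trans _ (pi_ge2 _))// ler1n.
Qed.

(** This is the derivative of the sine at 0, taken along the null sequence [x / (n + 1)]. *)
Lemma cvg_sinc (x : R) : x != 0 ->
  sin (n.+1%:R^-1 * x) / (n.+1%:R^-1 * x) @[n --> \oo] --> (1 : R).
Proof.
move=> x0.
have H : h^-1 *: (sin (h *: 1 + 0) - sin 0) @[h --> (0 : R)^'] --> (1 : R).
  have [dsin Esin] := is_derive_sin (0 : R).
  by rewrite -[X in _ --> X](@cos0 R) -Esin; exact: dsin.
have /cvgr_dnbhsP/(_ (fun n => n.+1%:R^-1 * x)) := H.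
rewrite sin0 => /=.
have -> : (fun n => (n.+1%:R^-1 * x)^-1 *: (sin ((n.+1%:R^-1 * x) *: 1 + 0) - 0)) =
  (fun n => sin (n.+1%:R^-1 * x) / (n.+1%:R^-1 * x)).
  by apply/funext => n; rewrite /GRing.scale/= mulr1 addr0 subr0 mulrC.
apply; split; first by move=> n; rewrite mulf_neq0// invr_neq0.
rewrite -[X in _ --> X](mul0r x); apply: cvgM; [exact: cvg_harmonic|exact: cvg_cst].
Qed.

Lemma ball_nicely_shrinking (x : R) :
  nicely_shrinking x (fun n => ball x n.+1%:R^-1).
Proof.
split; first by move=> n; exact: measurable_ball.
exists (1, fun n => (n.+1%:R^-1)%:pos); split => //=; first exact: cvg_harmonic.
- by move=> n.
- by move=> n; rewrite mul1e.
Qed.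

Lemma lebesgue_differentiation_ball (p : R -> R) : intg p ->
  {ae mu, forall x, n.+1%:R / 2 * \int[mu]_y (p y * \1_(ball x n.+1%:R^-1) y) @[n --> \oo] --> p x}.
Proof.
move=> ip.
have lp : locally_integrable setT p by apply: open_integrable_locally => //; exact: openT.
have := lebesgue_differentiation lp; apply: filterS => [|x px]; first exact: (ae_filter_ringOfSetsType mu).
have := nice_lebesgue_differentiation ball_nicely_shrinking lp px.
have E n : ((mu (ball x n.+1%:R^-1))^-1 * \int[mu]_(y in ball x n.+1%:R^-1) (p y)%:E)%E =
   (n.+1%:R / 2 * \int[mu]_y (p y * \1_(ball x n.+1%:R^-1) y))%:E.
  rewrite lebesgue_measure_ball// inver mulrn_eq0/= invr_eq0 pnatr_eq0/=.
  have -> : (\int[mu]_(y in ball x n.+1%:R^-1) (p y)%:E)%E = (\int[mu]_y (p y * \1_(ball x n.+1%:R^-1) y)%:E)%E.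
    by rewrite integral_mkcond epatch_indic.
  rewrite EFin_Rintegral; last first.
    apply: (integrable_le (g := fun y => `|p y|)).
    - apply: measurable_funM; [exact: integrable_measurable|].
      apply: measurable_indic; exact: measurable_ball.
    - by move=> y; rewrite normrM indicE; case: (_ \in _); rewrite ?normr1 ?mulr1 ?normr0 ?mulr0.
    - exact: integrable_norm.
  rewrite -EFinM; congr (_%:E); congr (_ * _).
  by rewrite -[X in X^-1]mulr_natr invfM invrK.
by rewrite (funext E) => /fine_cvgP[_].
Qed.

Lemma indic_ballE (x h y : R) : \1_(ball x h) y = ((`|x - y| < h)%R : nat)%:R :> R.
Proof. by rewrite indicE; congr (nat_of_bool _)%:R; apply/idP/idP; rewrite inE. Qed.

Section CompactSupport.
Variables (p : R -> R) (N : R).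
Hypotheses (mp : measurable_fun setT p) (pN : forall x, N < `|x| -> p x = 0).
Hypothesis ip2 : intg (fun x => p x ^+ 2).

Lemma compact_sqr_integrable : intg p.
Proof.
apply: (integrable_le (g := fun x => \1_(`[- N, N]%classic) x + p x ^+ 2)) => //.
  move=> x; have [Nx|xN] := ltP N `|x|; first by rewrite pN// normr0 addr_ge0// sqr_ge0.
  have -> : \1_(`[- N, N]%classic) x = 1 :> R.
    by rewrite indicE mem_setE in_itv/= -ler_norml xN.
  rewrite -(real_normK (num_real _)); move: (`|p x|) (normr_ge0 (p x)) => a a0; nra.
by apply: intgD => //; exact: (integrable_indic_itv (- N) N true false).
Qed.

(** For real [p] the Fourier transform is [cosT p - i sinT p]. *)
Definition cosT (x : R) := \int[mu]_y (p y * cos (y * x)).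
Definition sinT (x : R) := \int[mu]_y (p y * sin (y * x)).

Lemma measurable_mul_snd_fst : measurable_fun setT (fun z : R * R => z.1 * z.2).
Proof. by apply: measurable_funM. Qed.

Lemma measurable_sinc (h : R) : measurable_fun setT (fun x : R => sin (h * x) / x).
Proof.
apply: measurable_funM; last exact: measurable_invr.
apply: measurableT_comp; last exact: measurable_funM.
by apply: continuous_measurable_fun; exact: continuous_sin.
Qed.

(** The factor [sin(hx)/x] is square integrable, so [square_Rintegral] applies to the cosine and to
    the sine part. In the sum of the two, [cos(xs)cos(ys) + sin(xs)sin(ys) = cos((x - y)s)], and its
    integral against [sin(hs)^2/s^2] is the Fejer kernel. *)
Lemma fejer_cos_sin (h : R) :
  intg (fun x => sin (h * x) ^+ 2 / x ^+ 2 * (cosT x ^+ 2 + sinT x ^+ 2)) /\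
  \int[mu]_x (sin (h * x) ^+ 2 / x ^+ 2 * (cosT x ^+ 2 + sinT x ^+ 2)) =
  \int[mu]_x \int[mu]_y (p x * p y * (pi / 4 * fejer_kernel h (x - y))).
Proof.
have ip := compact_sqr_integrable.
have H (g : R -> R) : continuous g -> (forall x, `|g x| <= 1) ->
    [/\ intg (fun s => (\int[mu]_x (p x * (sin (h * s) / s * g (x * s)))) ^+ 2),
    (forall x, intg (fun y => p x * p y * \int[mu]_s ((sin (h * s) / s * g (x * s)) * (sin (h * s) / s * g (y * s))))),
    intg (fun x => \int[mu]_y (p x * p y * \int[mu]_s ((sin (h * s) / s * g (x * s)) * (sin (h * s) / s * g (y * s))))) &
    \int[mu]_s ((\int[mu]_x (p x * (sin (h * s) / s * g (x * s)))) ^+ 2) =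
    \int[mu]_x \int[mu]_y (p x * p y * \int[mu]_s ((sin (h * s) / s * g (x * s)) * (sin (h * s) / s * g (y * s))))].
  move=> cg g1.
  have mg := continuous_measurable_fun cg.
  apply: (square_Rintegral (p := p) (Phi := fun x s => sin (h * s) / s * g (x * s))
    (kappa := fun s => `|sin (h * s) / s|)) => //.
  - apply: measurable_funM; first exact: (measurableT_comp (measurable_sinc h)).
    exact: (measurableT_comp mg measurable_mul_snd_fst).
  - by apply: measurableT_comp => //; exact: measurable_sinc.
  - by move=> x s _; rewrite normrM ler_piMr.
  - rewrite [X in intg X](_ : _ = fun s => sin (h * s) ^+ 2 / s ^+ 2); first exact: integrable_sinsq.
    by apply/funext => s; rewrite real_normK ?num_real// exprMn exprVn.
have ipg (g : R -> R) s : continuous g -> (forall x, `|g x| <= 1) -> intg (fun x => p x * g (x * s)).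
  move=> cg g1; apply: (integrable_le (g := fun x => `|p x|)).
  - apply: measurable_funM => //; apply: measurableT_comp.
      exact: continuous_measurable_fun.
    exact: measurable_funM.
  - by move=> x; rewrite normrM ler_piMr.
  - exact: integrable_norm.
have E (g : R -> R) s : continuous g -> (forall x, `|g x| <= 1) ->
    (\int[mu]_x (p x * (sin (h * s) / s * g (x * s)))) ^+ 2 =
    sin (h * s) ^+ 2 / s ^+ 2 * (\int[mu]_x (p x * g (x * s))) ^+ 2.
  move=> cg g1; under eq_Rintegral do rewrite mulrCA.
  rewrite RintegralZl//; last exact: ipg.
  by rewrite !exprMn exprVn.
have [i1 j1 k1 e1] := H _ (@continuous_cos R) (@cos_max R).
have [i2 j2 k2 e2] := H _ (@continuous_sin R) (@sin_max R).
have ES x : sin (h * x) ^+ 2 / x ^+ 2 * (cosT x ^+ 2 + sinT x ^+ 2) =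
  (\int[mu]_y (p y * (sin (h * x) / x * cos (y * x)))) ^+ 2 +
  (\int[mu]_y (p y * (sin (h * x) / x * sin (y * x)))) ^+ 2.
  rewrite (E _ _ (@continuous_cos R) (@cos_max R)) (E _ _ (@continuous_sin R) (@sin_max R)).
  by rewrite mulrDr.
split.
  rewrite [X in EFin \o X](_ : _ = fun x => (\int[mu]_y (p y * (sin (h * x) / x * cos (y * x)))) ^+ 2 +
    (\int[mu]_y (p y * (sin (h * x) / x * sin (y * x)))) ^+ 2); first exact: (intgD i1 i2).
  exact/funext.
under eq_Rintegral do rewrite ES.
rewrite (RintegralD measurableT i1 i2) e1 e2 -(RintegralD measurableT k1 k2).
clear e1 e2 H E ES.
apply: eq_Rintegral => x _; rewrite -(RintegralD measurableT (j1 x) (j2 x)); clear j1 j2 k1 k2; apply: eq_Rintegral => y _.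
rewrite -mulrDr; congr (_ * _); rewrite -Rintegral_sinsq_cos.
have iq (g : R -> R) : continuous g -> (forall x, `|g x| <= 1) ->
   intg (fun s => sin (h * s) / s * g (x * s) * (sin (h * s) / s * g (y * s))).
  move=> cg g1; have mg (u : R) : measurable_fun setT (fun s : R => g (u * s)).
    by apply: measurableT_comp; [exact: continuous_measurable_fun|exact: measurable_funM].
  apply: (integrable_le _ _ (integrable_sinsq h)).
    by apply: measurable_funM; apply: measurable_funM => //; exact: measurable_sinc.
  move=> s; rewrite mulrACA normrM ger0_norm -?expr2 ?sqr_ge0// exprMn exprVn.
  by rewrite ler_piMr ?divr_ge0 ?sqr_ge0// normrM mulr_ile1.
rewrite -RintegralD//; [|apply: iq..]; first last.
- exact: sin_max.
- exact: continuous_sin.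
- exact: cos_max.
- exact: continuous_cos.
by apply: eq_Rintegral => s _; rewrite mulrBl cosB; rewrite -exprVn; move: (s^-1) => v; ring.
Qed.

Lemma measurable_ball_indic (h : R) :
  measurable_fun setT (fun z : R * R => \1_(ball z.2 h) z.1 : R).
Proof.
rewrite [X in measurable_fun _ X](_ : _ = fun z : R * R => \1_(ball (0 : R) h) (z.2 - z.1)).
  by apply: measurableT_comp; [apply: measurable_indic; exact: measurable_ball|exact: measurable_funB].
by apply/funext => z; rewrite !indic_ballE sub0r normrN.
Qed.

(** The centres of the balls of radius [h] that contain both points form an interval of length
    [2h - |x - y|], empty from distance [2h] on: the same triangle as on the Fourier side. *)
Lemma Rintegral_ball_overlap (h x y : R) : 0 < h ->
  \int[mu]_s (\1_(ball s h) x * \1_(ball s h) y) = 2^-1 * fejer_kernel h (x - y).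
Proof.
move=> h0; wlog xy : x y / x <= y => [H|].
  have [/H//|/ltW yx] := leP x y.
  have -> : fejer_kernel h (x - y) = fejer_kernel h (y - x).
    rewrite /fejer_kernel -(normrN (x - y)) -[in LHS](normrN (x - y + _)) -[in LHS](normrN (x - y - _)).
    have -> : - (x - y + 2 * h) = y - x - 2 * h by ring.
    have -> : - (x - y - 2 * h) = y - x + 2 * h by ring.
    by rewrite opprB; ring.
  by rewrite -H//; apply: eq_Rintegral => s _; rewrite mulrC.
have E s : \1_(ball s h) x * \1_(ball s h) y = \1_(`]y - h, x + h[%classic) s :> R.
  rewrite !indic_ballE indicE mem_setE in_itv/= -natrM mulnb; congr (nat_of_bool _)%:R.
  rewrite !ltr_norml; apply/idP/idP => [/andP[/andP[? ?] /andP[? ?]]|/andP[? ?]].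
    by apply/andP; split; lra.
  by apply/andP; split; apply/andP; split; lra.
under eq_Rintegral do rewrite E.
have M : mu `]y - h, x + h[%classic = (if y - h < x + h then (x + h - (y - h))%:E else 0%E).
  by rewrite lebesgue_measure_itv/= lte_fin -EFinB; case: ifP.
rewrite /Rintegral integral_indic// setIT.
transitivity (fine (if y - h < x + h then (x + h - (y - h))%:E else 0%E)); first by congr fine; exact: M.
rewrite /fejer_kernel (ler0_norm (_ : x - y <= 0)) ?subr_le0//.
rewrite (ler0_norm (_ : x - y - 2 * h <= 0)); last by lra.
case: ltP => H /=.
  rewrite ger0_norm; last by lra.
  by field.
rewrite ler0_norm; last by lra.
by field.
Qed.

Lemma Rintegral_ball (h s : R) : 0 < h -> \int[mu]_x (\1_(ball s h) x) = 2 * h.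
Proof.
move=> h0; rewrite /Rintegral integral_indic//; last exact: measurable_ball.
transitivity (fine (h *+ 2)%:E); last by rewrite /= mulr_natl.
by congr fine; rewrite setIT; exact: lebesgue_measure_ball (ltW h0).
Qed.

Lemma integrable_ball (h s : R) : intg (\1_(ball s h)).
Proof. by rewrite ball_itv; exact: (integrable_indic_itv (s - h) (s + h) false true). Qed.

Lemma intg_mul_ball (q : R -> R) (h s : R) : intg q -> intg (fun x => q x * \1_(ball s h) x).
Proof.
move=> iq; apply: (integrable_le (g := fun x => `|q x|)).
- by apply: measurable_funM; [exact: integrable_measurable|apply: measurable_indic; exact: measurable_ball].
- by move=> x; rewrite normrM ler_piMr// indic_ballE; case: (_ < _); rewrite ?normr1 ?normr0.
- exact: integrable_norm.
Qed.

Lemma ball_sums (h : R) : 0 < h ->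
  [/\ intg (fun s => (\int[mu]_x (p x * \1_(ball s h) x)) ^+ 2),
  (forall x, intg (fun y => p x * p y * (2^-1 * fejer_kernel h (x - y)))),
  intg (fun x => \int[mu]_y (p x * p y * (2^-1 * fejer_kernel h (x - y)))) &
  \int[mu]_s ((\int[mu]_x (p x * \1_(ball s h) x)) ^+ 2) =
  \int[mu]_x \int[mu]_y (p x * p y * (2^-1 * fejer_kernel h (x - y)))].
Proof.
move=> h0; have mk : measurable_fun setT (\1_(ball (0 : R) (N + h)) : R -> R).
  by apply: measurable_indic; exact: measurable_ball.
have b x s : p x != 0 -> `|\1_(ball s h) x : R| <= \1_(ball (0 : R) (N + h)) s.
  move=> px; have xN : `|x| <= N.
    by rewrite leNgt; apply: contra px => /pN ->.
  rewrite !indic_ballE sub0r normrN; case: ltP => [sx|_]; last by rewrite normr0.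
  rewrite (_ : `|s| < N + h) ?normr1//.
  by rewrite -[s](subrK x) addrC (le_lt_trans (ler_normD _ _))// ler_ltD.
have ik : intg (fun s => (\1_(ball (0 : R) (N + h)) s : R) ^+ 2).
  rewrite [X in EFin \o X](_ : _ = \1_(ball (0 : R) (N + h))); last first.
    by apply/funext => s; rewrite indic_ballE; case: (_ < _); rewrite ?expr1n ?expr0n.
  exact: integrable_ball.
have [i1 i2 i3 e1] := square_Rintegral compact_sqr_integrable (measurable_ball_indic h) mk
  (fun _ => ler0n _ _) b ik.
have E x y := Rintegral_ball_overlap x y h0.
have E2 x : (fun y => p x * p y * \int[mu]_s (\1_(ball s h) x * \1_(ball s h) y)) =
  (fun y => p x * p y * (2^-1 * fejer_kernel h (x - y))) by apply/funext => y; rewrite E.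
split.
- exact: i1.
- by move=> x; have := i2 x; rewrite E2.
- rewrite [X in EFin \o X](_ : _ = fun x => \int[mu]_y (p x * p y * \int[mu]_s (\1_(ball s h) x * \1_(ball s h) y)))//.
  by apply/funext => x; rewrite E2.
- by rewrite e1; apply: eq_Rintegral => x _; rewrite E2.
Qed.

Lemma fejer_ball_sums (h : R) : 0 < h ->
  \int[mu]_x (sin (h * x) ^+ 2 / x ^+ 2 * (cosT x ^+ 2 + sinT x ^+ 2)) =
  pi / 2 * \int[mu]_s ((\int[mu]_x (p x * \1_(ball s h) x)) ^+ 2).
Proof.
move=> h0; have [i1 i2 i3 e1] := ball_sums h0.
rewrite (fejer_cos_sin h).2 e1 -(RintegralZl _ measurableT i3); clear i1 e1 i3.
apply: eq_Rintegral => x _; rewrite -(RintegralZl _ measurableT (i2 x)); apply: eq_Rintegral => y _.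
by field.
Qed.

(** Jensen's inequality, from the nonnegative integral of [(p - m)^2] over the ball with [m] the
    mean of [p] there. *)
Lemma jensen_ball (h s : R) : 0 < h ->
  (\int[mu]_x (p x * \1_(ball s h) x)) ^+ 2 <= 2 * h * \int[mu]_x (p x ^+ 2 * \1_(ball s h) x).
Proof.
move=> h0; set A := \int[mu]_x _; pose m := A / (2 * h).
have ip := compact_sqr_integrable.
have : 0 <= \int[mu]_x (p x ^+ 2 * \1_(ball s h) x - (2 * m) * (p x * \1_(ball s h) x) + m ^+ 2 * \1_(ball s h) x).
  apply: Rintegral_ge0 => x _.
  rewrite (_ : _ + _ = (p x - m) ^+ 2 * \1_(ball s h) x); last by ring.
  by rewrite mulr_ge0 ?sqr_ge0.
have I1 : intg (fun x => p x ^+ 2 * \1_(ball s h) x) by exact: intg_mul_ball.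
have I2 : intg (fun x => p x * \1_(ball s h) x) by exact: intg_mul_ball.
have I3 := integrable_ball h s.
rewrite RintegralD//; [|by apply: intgB => //; exact: intgZl|exact: intgZl].
rewrite RintegralB//; [|exact: intgZl].
rewrite !RintegralZl// Rintegral_ball// -/A.
rewrite (_ : _ + _ = \int[mu]_x (p x ^+ 2 * \1_(ball s h) x) - A ^+ 2 / (2 * h)); last first.
  by rewrite /m; field; exact: lt0r_neq0.
by rewrite subr_ge0 ler_pdivrMr ?mulr_gt0// mulrC.
Qed.

(** Jensen's inequality is integrated over the centre [s]. After Fubini each [x] is counted once for
    every ball containing it, that is with weight [2h], which together with the factor [2h] of
    [jensen_ball] gives [4 h^2]. *)
Lemma ball_sums_le (h : R) : 0 < h ->
  \int[mu]_s ((\int[mu]_x (p x * \1_(ball s h) x)) ^+ 2) <= 4 * h ^+ 2 * \int[mu]_x (p x ^+ 2).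
Proof.
move=> h0.
have b x s : `|p x ^+ 2 * \1_(ball s h) x| <= p x ^+ 2 * \1_(ball (0 : R) (`|N| + h)) s.
  have [->|px] := eqVneq (p x) 0; first by rewrite expr0n !mul0r normr0.
  have xN : `|x| <= `|N|.
    by rewrite (le_trans _ (ler_norm _))// leNgt; apply: contra px => /pN ->.
  rewrite normrM ger0_norm ?sqr_ge0// ler_wpM2l ?sqr_ge0//.
  rewrite !indic_ballE sub0r normrN; case: ltP => [sx|_]; last by rewrite normr0.
  rewrite (_ : `|s| < `|N| + h) ?normr1//.
  by rewrite -[s](subrK x) addrC (le_lt_trans (ler_normD _ _))// ler_ltD.
have mf : measurable_fun setT (fun z : R * R => p z.1 ^+ 2 * \1_(ball z.2 h) z.1).
  apply: measurable_funM; last exact: measurable_ball_indic.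
  by apply: measurable_funX; exact: measurableT_comp.
have iN : intg (\1_(ball (0 : R) (`|N| + h))) by exact: integrable_ball.
apply: (@le_trans _ _ (\int[mu]_s (2 * h * \int[mu]_x (p x ^+ 2 * \1_(ball s h) x)))).
  apply: le_Rintegral => //; first by have [] := ball_sums h0.
    apply: intgZl.
    apply: (dominated_integrable (f := fun s x => p x ^+ 2 * \1_(ball s h) x)
      (measurable_swap2 (f := fun x s => p x ^+ 2 * \1_(ball s h) x) mf) _ iN ip2).
    by move=> s x; rewrite [leRHS]mulrC; exact: b.
  by move=> s _; exact: jensen_ball.
rewrite RintegralZl//; last first.
  apply: (dominated_integrable (f := fun s x => p x ^+ 2 * \1_(ball s h) x)
      (measurable_swap2 (f := fun x s => p x ^+ 2 * \1_(ball s h) x) mf) _ iN ip2).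
  by move=> s x; rewrite [leRHS]mulrC; exact: b.
rewrite -(Rintegral_Fubini (f := fun x s => p x ^+ 2 * \1_(ball s h) x) mf b ip2 iN).
rewrite (_ : 4 * h ^+ 2 * _ = 2 * h * (\int[mu]_x (p x ^+ 2) * (2 * h))); last by ring.
rewrite le_eqVlt; apply/orP; left; apply/eqP; congr (_ * _).
transitivity (\int[mu]_x (p x ^+ 2 * (2 * h))); last by rewrite RintegralZr.
apply: eq_Rintegral => x _; rewrite RintegralZl//; last first.
  by under [X in EFin \o X]eq_fun do rewrite indic_ballE distrC -indic_ballE; exact: integrable_ball.
congr (_ * _); under eq_Rintegral do rewrite indic_ballE distrC -indic_ballE.
exact: Rintegral_ball.
Qed.

Lemma measurable_cosT : measurable_fun setT cosT.
Proof.
apply: (measurable_Rintegral2 (f := fun x y => p y * cos (y * x))).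
apply: measurable_funM; first exact: measurableT_comp.
apply: measurableT_comp; first by apply: continuous_measurable_fun; exact: continuous_cos.
by apply: measurable_funM.
Qed.

Lemma measurable_sinT : measurable_fun setT sinT.
Proof.
apply: (measurable_Rintegral2 (f := fun x y => p y * sin (y * x))).
apply: measurable_funM; first exact: measurableT_comp.
apply: measurableT_comp; first by apply: continuous_measurable_fun; exact: continuous_sin.
by apply: measurable_funM.
Qed.

Let Q x := cosT x ^+ 2 + sinT x ^+ 2.
Let h_ n : R := n.+1%:R^-1.
(** [F n] is [Q] times the square of [sin(hx)/(hx)] with [h = 1/(n+1)]: it is at most [Q] and tends
    to [Q] off the origin. [U n s] is the mean of [p] over the ball of radius [h] about [s]. *)
Let F n x := h_ n ^- 2 * (sin (h_ n * x) ^+ 2 / x ^+ 2 * Q x).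
Let U n s := n.+1%:R / 2 * \int[mu]_y (p y * \1_(ball s n.+1%:R^-1) y).

Let mQ : measurable_fun setT Q.
Proof.
by apply: measurable_funD; apply: measurable_funX; [exact: measurable_cosT|exact: measurable_sinT].
Qed.

Let Q0 x : 0 <= Q x. Proof. by rewrite addr_ge0 ?sqr_ge0. Qed.

Let h0 n : 0 < h_ n. Proof. by rewrite invr_gt0. Qed.

Let iF n : intg (F n). Proof. exact: intgZl (fejer_cos_sin (h_ n)).1. Qed.

Let iU n : intg (fun s => U n s ^+ 2).
Proof.
rewrite [X in EFin \o X](_ : _ = fun s => (n.+1%:R / 2) ^+ 2 * (\int[mu]_y (p y * \1_(ball s n.+1%:R^-1) y)) ^+ 2).
  by apply: intgZl; have [] := ball_sums (h0 n).
by apply/funext => s; rewrite -exprMn.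
Qed.

Let FU n : \int[mu]_x F n x = 2 * pi * \int[mu]_s (U n s ^+ 2).
Proof.
rewrite RintegralZl//; last exact: (fejer_cos_sin (h_ n)).1.
rewrite fejer_ball_sums//.
under [in RHS]eq_Rintegral do rewrite exprMn.
rewrite RintegralZl//; last by have [] := ball_sums (h0 n).
rewrite /h_; have := lt0r_neq0 (ltr0Sn R n); move: (n.+1%:R : R) => m m0; by field.
Qed.

Let Ule n : \int[mu]_s (U n s ^+ 2) <= \int[mu]_x (p x ^+ 2).
Proof.
under eq_Rintegral do rewrite exprMn.
rewrite RintegralZl//; last by have [] := ball_sums (h0 n).
apply: le_trans (ler_wpM2l (sqr_ge0 _) (ball_sums_le (h0 n))) _.
rewrite le_eqVlt; apply/orP; left; apply/eqP; rewrite /h_; have := lt0r_neq0 (ltr0Sn R n); move: (n.+1%:R : R) => m m0; by field.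
Qed.

Let F0 n x : 0 <= F n x.
Proof. by rewrite mulr_ge0 ?invr_ge0 ?sqr_ge0// mulr_ge0// divr_ge0 ?sqr_ge0. Qed.

Let FleQ n x : F n x <= Q x.
Proof.
have [->|x0] := eqVneq x 0.
  by rewrite /F mulr0 sin0 expr0n/= !mul0r mulr0.
have hx : 0 < (h_ n * x) ^+ 2 by rewrite exprn_even_gt0//= mulf_neq0// lt0r_neq0.
rewrite (_ : F n x = sin (h_ n * x) ^+ 2 / (h_ n * x) ^+ 2 * Q x); last first.
  by rewrite /F; field; rewrite x0 lt0r_neq0.
rewrite ler_piMl// ler_pdivrMr// mul1r -(real_normK (num_real (sin _))) -[leRHS](real_normK (num_real _)).
by rewrite lerXn2r ?nnegrE//; exact: norm_sin_le.
Qed.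

Lemma fourier_le : (\int[mu]_x (cosT x ^+ 2 + sinT x ^+ 2)%:E <= (2 * pi * \int[mu]_x (p x ^+ 2))%:E)%E.
Proof.
apply: (@fatou_ae F Q) => //.
- by move=> n; exact: (integrable_measurable (iF n)).
(* At the origin every [F n] vanishes, since [sin 0 = 0], so convergence to [Q] may fail at that one
   point. *)
- exists [set 0]; split => //; first exact: lebesgue_measure_set1.
  move=> x /=; apply: contra_notP => /eqP x0.
  have -> : F ^~ x = fun n => (sin (n.+1%:R^-1 * x) / (n.+1%:R^-1 * x)) ^+ 2 * Q x.
    apply/funext => n; rewrite /F /h_; have := lt0r_neq0 (ltr0Sn R n); move: (n.+1%:R : R) => m m0; field; by rewrite ?m0 ?x0.
  rewrite -[X in _ --> X]mul1r; apply: cvgM; last exact: cvg_cst.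
  rewrite -[X in _ --> X](expr1n _ 2%N) expr2; under eq_fun do rewrite expr2.
  by apply: cvgM; exact: cvg_sinc.
- apply: nearW => n; rewrite EFin_Rintegral// lee_fin FU.
  by rewrite ler_pM2l ?mulr_gt0 ?pi_gt0.
Qed.

Lemma integrable_fourier_sqr : intg (fun x => cosT x ^+ 2 + sinT x ^+ 2).
Proof.
apply/integrableP; split; first exact/measurable_EFinP.
under eq_integral do rewrite gee0_abs ?lee_fin ?Q0//.
exact: le_lt_trans fourier_le (ltry _).
Qed.

(* Averaging [p] over balls of radius [h] multiplies its transform by a Fejer factor, for which both sides are
   the same double integral; Fatou's lemma and Lebesgue differentiation let [h] tend to 0. *)
Lemma plancherel_real :
  \int[mu]_x (cosT x ^+ 2 + sinT x ^+ 2) = 2 * pi * \int[mu]_x (p x ^+ 2).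
Proof.
apply/eqP; rewrite eq_le; apply/andP; split.
  by rewrite -lee_fin -(EFin_Rintegral integrable_fourier_sqr); exact: fourier_le.
rewrite -ler_pdivlMl ?mulr_gt0 ?pi_gt0// -lee_fin -(EFin_Rintegral ip2).
apply: (@fatou_ae (fun n s => U n s ^+ 2) (fun x => p x ^+ 2)).
- by move=> n; exact: (integrable_measurable (iU n)).
- exact: measurable_funX.
- by move=> n x; exact: sqr_ge0.
- by move=> x; exact: sqr_ge0.
- have := lebesgue_differentiation_ball compact_sqr_integrable; apply: filterS => [|x px].
    exact: (ae_filter_ringOfSetsType mu).
  by rewrite expr2; under eq_fun do rewrite expr2; exact: cvgM.
apply: nearW => n; rewrite EFin_Rintegral// lee_fin ler_pdivlMl ?mulr_gt0 ?pi_gt0// -FU.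
by apply: (le_Rintegral measurableT (iF n) integrable_fourier_sqr) => x _; exact: FleQ.
Qed.
End CompactSupport.
End Plancherel.

(** * Square-integrable complex functions and their inner product *)

Section L2.
Variable R : realType.
Local Notation mu := (@lebesgue_measure R).
Local Notation C := (R[i]).
Local Notation intg f := (mu.-integrable setT (EFin \o f)).
Local Notation re f := (fun x => complex.Re (f x)).
Local Notation im f := (fun x => complex.Im (f x)).

Lemma cabs_sqr (z : C) : cabs z ^+ 2 = complex.Re z ^+ 2 + complex.Im z ^+ 2.
Proof. by case: z => a b; rewrite /cabs/= sqr_sqrtr// addr_ge0 ?sqr_ge0. Qed.

Lemma Re_add (z w : C) : complex.Re (z + w) = complex.Re z + complex.Re w.
Proof. by case: z; case: w. Qed.
Lemma Im_add (z w : C) : complex.Im (z + w) = complex.Im z + complex.Im w.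
Proof. by case: z; case: w. Qed.
Lemma Re_sub (z w : C) : complex.Re (z - w) = complex.Re z - complex.Re w.
Proof. by case: z; case: w. Qed.
Lemma Im_sub (z w : C) : complex.Im (z - w) = complex.Im z - complex.Im w.
Proof. by case: z; case: w. Qed.
Lemma Re_mul (z w : C) : complex.Re (z * w) = complex.Re z * complex.Re w - complex.Im z * complex.Im w.
Proof. by case: z; case: w. Qed.
Lemma Im_mul (z w : C) : complex.Im (z * w) = complex.Re z * complex.Im w + complex.Im z * complex.Re w.
Proof. by case: z => ? ?; case: w. Qed.

Lemma cmeasD (f g : R -> C) : cmeas f -> cmeas g -> cmeas (fun x => f x + g x).
Proof.
move=> [f1 f2] [g1 g2]; split.
  by under eq_fun do rewrite Re_add; exact: measurable_funD.
by under eq_fun do rewrite Im_add; exact: measurable_funD.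
Qed.

Lemma cmeasB (f g : R -> C) : cmeas f -> cmeas g -> cmeas (fun x => f x - g x).
Proof.
move=> [f1 f2] [g1 g2]; split.
  by under eq_fun do rewrite Re_sub; exact: measurable_funB.
by under eq_fun do rewrite Im_sub; exact: measurable_funB.
Qed.

Lemma cmeasM (f g : R -> C) : cmeas f -> cmeas g -> cmeas (fun x => f x * g x).
Proof.
move=> [f1 f2] [g1 g2]; split.
  under eq_fun do rewrite Re_mul; apply: measurable_funB; exact: measurable_funM.
under eq_fun do rewrite Im_mul; apply: measurable_funD; exact: measurable_funM.
Qed.

Lemma cmeas_comp (f : R -> C) (g : R -> R) : cmeas f -> measurable_fun setT g -> cmeas (fun x => f (g x)).
Proof. by move=> [f1 f2] mg; split; [exact: (measurableT_comp f1 mg)|exact: (measurableT_comp f2 mg)]. Qed.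

Lemma cabs_ge0 (z : C) : 0 <= cabs z.
Proof. by case: z => a b; rewrite /cabs/= sqrtr_ge0. Qed.

Lemma cmeas_cabs (f : R -> C) : cmeas f -> measurable_fun setT (fun x => cabs (f x)).
Proof.
move=> [f1 f2]; rewrite [X in measurable_fun _ X](_ : _ = fun x => Num.sqrt (complex.Re (f x) ^+ 2 + complex.Im (f x) ^+ 2)).
  apply: measurableT_comp; first by apply: continuous_measurable_fun; exact: sqrt_continuous.
  by apply: measurable_funD; exact: measurable_funX.
by apply/funext => x; rewrite -cabs_sqr sqrtr_sqr ger0_norm ?cabs_ge0.
Qed.

Lemma L2_intro (f : R -> C) : cmeas f -> intg (fun x => complex.Re (f x) ^+ 2) ->
  intg (fun x => complex.Im (f x) ^+ 2) -> L2 f.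
Proof.
move=> mf i1 i2; split => //; under eq_integral do rewrite cabs_sqr.
by rewrite EFin_Rintegral ?ltry//; exact: intgD.
Qed.

Lemma L2_intg (f : R -> C) : L2 f -> intg (fun x => cabs (f x) ^+ 2).
Proof.
move=> [mf foo]; apply/integrableP; split.
  by apply/measurable_EFinP; apply: measurable_funX; exact: cmeas_cabs.
by under eq_integral do rewrite gee0_abs ?lee_fin ?sqr_ge0//.
Qed.

Lemma L2_re (f : R -> C) : L2 f -> intg (fun x => complex.Re (f x) ^+ 2).
Proof.
move=> f2; apply: (integrable_le _ _ (L2_intg f2)); first by apply: measurable_funX; exact: f2.1.1.
by move=> x; rewrite ger0_norm ?sqr_ge0// cabs_sqr lerDl sqr_ge0.
Qed.

Lemma L2_im (f : R -> C) : L2 f -> intg (fun x => complex.Im (f x) ^+ 2).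
Proof.
move=> f2; apply: (integrable_le _ _ (L2_intg f2)); first by apply: measurable_funX; exact: f2.1.2.
by move=> x; rewrite ger0_norm ?sqr_ge0// cabs_sqr lerDr sqr_ge0.
Qed.

Lemma intgM_sqr (a b : R -> R) : measurable_fun setT a -> measurable_fun setT b ->
  intg (fun x => a x ^+ 2) -> intg (fun x => b x ^+ 2) -> intg (fun x => a x * b x).
Proof.
move=> ma mb ia ib; apply: (integrable_le (g := fun x => a x ^+ 2 + b x ^+ 2)).
- exact: measurable_funM.
- move=> x; rewrite normrM -(real_normK (num_real (a x))) -(real_normK (num_real (b x))).
  by move: (`|a x|) (`|b x|) (normr_ge0 (a x)) (normr_ge0 (b x)) => u v u0 v0; nra.
- exact: intgD.
Qed.

Definition sqnorm (f : R -> C) : R := \int[mu]_x (cabs (f x) ^+ 2).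
(** The real part of the Hermitian inner product. Being symmetric and bilinear over the reals, it
    suffices for Cauchy-Schwarz and polarisation; an imaginary part is recovered by multiplying one
    argument by [i]. *)
Definition rip (f g : R -> C) : R :=
  \int[mu]_x (complex.Re (f x) * complex.Re (g x) + complex.Im (f x) * complex.Im (g x)).

Lemma rip_intg (f g : R -> C) : L2 f -> L2 g ->
  intg (fun x => complex.Re (f x) * complex.Re (g x) + complex.Im (f x) * complex.Im (g x)).
Proof.
move=> f2 g2; apply: intgD; apply: intgM_sqr; try exact: L2_re; try exact: L2_im.
- exact: f2.1.1. - exact: g2.1.1. - exact: f2.1.2. - exact: g2.1.2.
Qed.

Lemma sqnorm_ge0 (f : R -> C) : 0 <= sqnorm f.
Proof. by apply: Rintegral_ge0 => x _; exact: sqr_ge0. Qed.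

Lemma integral_sqnorm (f : R -> C) : L2 f -> (\int[mu]_x (cabs (f x) ^+ 2)%:E = (sqnorm f)%:E)%E.
Proof. by move=> /L2_intg f2; rewrite EFin_Rintegral. Qed.

Lemma ripC (f g : R -> C) : rip f g = rip g f.
Proof. by apply: eq_Rintegral => x _; rewrite ![complex.Re (f x) * _]mulrC ![complex.Im (f x) * _]mulrC. Qed.

Lemma sqnorm_rip (f : R -> C) : sqnorm f = rip f f.
Proof. by apply: eq_Rintegral => x _; rewrite cabs_sqr. Qed.

Lemma L2Z (t : R) (f : R -> C) : L2 f -> L2 (fun x => rc t * f x).
Proof.
move=> f2; have E x : (complex.Re (rc t * f x) = t * complex.Re (f x)) * (complex.Im (rc t * f x) = t * complex.Im (f x)).
  by rewrite Re_mul Im_mul/= !mul0r subr0 addr0.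
apply: L2_intro.
- by split; under eq_fun do rewrite E; apply: measurable_funM => //; [exact: f2.1.1|exact: f2.1.2].
- by under eq_fun do rewrite E exprMn; apply: intgZl; exact: L2_re.
- by under eq_fun do rewrite E exprMn; apply: intgZl; exact: L2_im.
Qed.

Lemma sqrD_le (a b : R) : (a + b) ^+ 2 <= 2 * a ^+ 2 + 2 * b ^+ 2.
Proof. by rewrite -subr_ge0 (_ : _ - _ = (a - b) ^+ 2) ?sqr_ge0//; ring. Qed.

Lemma L2D (f g : R -> C) : L2 f -> L2 g -> L2 (fun x => f x + g x).
Proof.
move=> f2 g2; apply: L2_intro; first exact: cmeasD f2.1 g2.1.
- apply: (integrable_le (g := fun x => 2 * complex.Re (f x) ^+ 2 + 2 * complex.Re (g x) ^+ 2)).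
  + by apply: measurable_funX; exact: (cmeasD f2.1 g2.1).1.
  + by move=> x; rewrite ger0_norm ?sqr_ge0// Re_add sqrD_le.
  + by apply: intgD; apply: intgZl; exact: L2_re.
- apply: (integrable_le (g := fun x => 2 * complex.Im (f x) ^+ 2 + 2 * complex.Im (g x) ^+ 2)).
  + by apply: measurable_funX; exact: (cmeasD f2.1 g2.1).2.
  + by move=> x; rewrite ger0_norm ?sqr_ge0// Im_add sqrD_le.
  + by apply: intgD; apply: intgZl; exact: L2_im.
Qed.

Lemma rcN1 (z : C) : rc (-1) * z = - z.
Proof. by apply/eqP; rewrite eq_complex Re_mul Im_mul; case: z => a b /=; apply/andP; split; apply/eqP; ring. Qed.

Lemma L2B (f g : R -> C) : L2 f -> L2 g -> L2 (fun x => f x - g x).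
Proof.
move=> f2 g2; have := L2D f2 (L2Z (-1) g2).
by under eq_fun do rewrite rcN1.
Qed.

Lemma ripZl (t : R) (f h : R -> C) : L2 f -> L2 h ->
  rip (fun x => rc t * f x) h = t * rip f h.
Proof.
move=> f2 h2; rewrite /rip -RintegralZl//; try exact: rip_intg.
by apply: eq_Rintegral => x _; rewrite Re_mul Im_mul/=; ring.
Qed.

Lemma ripBl (f g h : R -> C) : L2 f -> L2 g -> L2 h ->
  rip (fun x => f x - g x) h = rip f h - rip g h.
Proof.
move=> f2 g2 h2; rewrite /rip -RintegralB//; try exact: rip_intg.
by apply: eq_Rintegral => x _; rewrite Re_sub Im_sub; ring.
Qed.

Lemma sqnormB (f g : R -> C) : L2 f -> L2 g ->
  sqnorm (fun x => f x - g x) = sqnorm f - 2 * rip f g + sqnorm g.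
Proof.
move=> f2 g2; have d2 := L2B f2 g2.
rewrite !sqnorm_rip ripBl// [rip f (fun x => _)]ripC [rip g (fun x => _)]ripC !ripBl//.
by rewrite (ripC g f); ring.
Qed.

Lemma sqnormZ (t : R) (f : R -> C) : L2 f -> sqnorm (fun x => rc t * f x) = t ^+ 2 * sqnorm f.
Proof.
move=> f2; have d2 := L2Z t f2.
by rewrite !sqnorm_rip ripZl// ripC ripZl//; ring.
Qed.

Lemma rip_cauchy_schwarz (f g : R -> C) : L2 f -> L2 g ->
  rip f g ^+ 2 <= sqnorm f * sqnorm g.
Proof.
move=> f2 g2; set a := rip f g; set F := sqnorm f; set G := sqnorm g.
have H t : 0 <= F - 2 * t * a + t ^+ 2 * G.
  have := sqnorm_ge0 (fun x => f x - rc t * g x).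
  by rewrite sqnormB//; [rewrite sqnormZ// ripC ripZl// ripC -/a -/F -/G mulrA|exact: L2Z].
have [G0|G0] := eqVneq G 0.
  (* For [G = 0] the quadratic in [t] is affine, and at this [t] it equals [-1] unless [a = 0]. *)
  rewrite G0 mulr0; have := H ((F + 1) / 2 / a); rewrite G0 mulr0 addr0.
  have [->|a0] := eqVneq a 0; first by rewrite expr0n.
  rewrite (_ : _ - _ = -1); first by rewrite ler0N1.
  by field.
have Gp : 0 < G by rewrite lt_def G0 sqnorm_ge0.
have := H (a / G); rewrite (_ : _ + _ = F - a ^+ 2 / G); last by field.
by rewrite subr_ge0 ler_pdivrMr.
Qed.

Lemma cvg_rip (f_ : nat -> R -> C) (f g : R -> C) : (forall n, L2 (f_ n)) -> L2 f -> L2 g ->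
  sqnorm (fun x => f_ n x - f x) @[n --> \oo] --> (0 : R) ->
  rip (f_ n) g @[n --> \oo] --> rip f g.
Proof.
move=> fn2 f2 g2 H.
have K : (sqnorm (fun x => f_ n x - f x) * sqnorm g) @[n --> \oo] --> (0 : R).
  by rewrite -(mul0r (sqnorm g)); apply: cvgM => //; exact: cvg_cst.
apply/cvgrPdist_lt => e e0.
have e20 : 0 < e ^+ 2 by rewrite exprn_gt0.
move/cvgrPdist_lt : K => /(_ _ e20); apply: filterS => n.
rewrite sub0r normrN ger0_norm ?mulr_ge0 ?sqnorm_ge0// => Hn.
rewrite distrC -ripBl//.
have := rip_cauchy_schwarz (L2B (fn2 n) f2) g2 => /le_lt_trans/(_ Hn).
rewrite -(real_normK (num_real _)); move: (`|_|) (normr_ge0 (rip (fun x => f_ n x - f x) g)) => v v0; nra.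
Qed.

Lemma cvg_sqnorm (f_ : nat -> R -> C) (f : R -> C) : (forall n, L2 (f_ n)) -> L2 f ->
  sqnorm (fun x => f_ n x - f x) @[n --> \oo] --> (0 : R) ->
  sqnorm (f_ n) @[n --> \oo] --> sqnorm f.
Proof.
move=> fn2 f2 H.
have E n : sqnorm (f_ n) = sqnorm (fun x => f_ n x - f x) + 2 * rip (f_ n) f - sqnorm f.
  by rewrite sqnormB//; ring.
rewrite (funext E) -[X in _ --> X](_ : 0 + 2 * rip f f - sqnorm f = _); last by rewrite -sqnorm_rip; ring.
apply: cvgB; last exact: cvg_cst.
by apply: cvgD => //; apply: cvgM; [exact: cvg_cst|exact: cvg_rip].
Qed.

End L2.

(** * Completeness of L2 *)

Section Completeness.
Variable R : realType.
Local Notation mu := (@lebesgue_measure R).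
Local Notation C := (R[i]).
Local Notation intg f := (mu.-integrable setT (EFin \o f)).

Lemma cauchy_subseq (d : nat -> nat -> R) :
  (forall e : R, 0 < e -> exists K, forall n m, (K <= n)%N -> (K <= m)%N -> d n m < e) ->
  exists s : nat -> nat, (forall j, (j <= s j)%N) /\ (forall j, d (s j) (s j.+1) < 8 ^- j).
Proof.
move=> H; have Hj j : exists K, forall n m, (K <= n)%N -> (K <= m)%N -> d n m < 8 ^- j.
  by apply: H; rewrite invr_gt0 exprn_gt0.
have [K HK] := choice Hj.
pose s := fix s j := if j is j'.+1 then maxn (s j').+1 (K j) else K 0%N.
have sK j : (K j <= s j)%N by case: j => [|j] //=; exact: leq_maxr.
have ss j : (s j < s j.+1)%N by rewrite /= leq_max leqnn.
exists s; split.
  by elim => // j IH; exact: leq_ltn_trans IH (ss j).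
by move=> j; apply: HK => //; exact: leq_trans (sK j) (ltnW (ss j)).
Qed.

Lemma cvg_geometric_increments (a : nat -> R) (B : R) :
  (forall j, `|a j - a j.+1| <= B * 2 ^- j) -> cvgn a.
Proof.
move=> aB.
have B0 : 0 <= B by have := aB 0%N; rewrite expr0 invr1 mulr1; exact: le_trans.
have cs : cvgn (series (telescope a)).
  apply: normed_cvg; apply: (@series_le_cvg _ _ (geometric B (2^-1))) => [n|n|n|].
  - exact: normr_ge0.
  - by rewrite /geometric/= mulr_ge0// exprn_ge0.
  - by rewrite /telescope/geometric/= distrC exprVn.
  - by apply: is_cvg_geometric_series; rewrite ger0_norm//; lra.
rewrite (_ : a = fun n => a 0%N + series (telescope a) n); last exact/funext/eq_sum_telescope.
by apply: is_cvgD => //; exact: is_cvg_cst.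
Qed.

(* A subsequence with summable weighted increments converges a.e.; Fatou identifies the limit. *)
Lemma L2_complete_real (f_ : nat -> R -> R) :
  (forall n, measurable_fun setT (f_ n)) ->
  (forall n m, intg (fun x => (f_ n x - f_ m x) ^+ 2)) ->
  (forall e : R, 0 < e -> exists K, forall n m, (K <= n)%N -> (K <= m)%N ->
     \int[mu]_x ((f_ n x - f_ m x) ^+ 2) < e) ->
  exists f : R -> R, measurable_fun setT f /\
    forall e : R, 0 < e -> exists K, forall n, (K <= n)%N ->
     (\int[mu]_x ((f_ n x - f x) ^+ 2)%:E <= e%:E)%E.
Proof.
move=> mf idf cf.
have [s [sj sd]] := cauchy_subseq cf.
(* The squared increments have integral below [8^-j]. The weight [4^j] leaves the summable [2^-j]
   for the integrals, and still forces increments of order [2^-j] at every point where the sum [G]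
   is finite. *)
pose d j x := 4 ^+ j * (f_ (s j) x - f_ (s j.+1) x) ^+ 2.
have d0 j x : 0 <= d j x by apply: mulr_ge0; [exact: exprn_ge0|exact: sqr_ge0].
have md j : measurable_fun setT (fun x => (d j x)%:E).
  by apply/measurable_EFinP; apply: measurable_funM => //; apply: measurable_funX; exact: measurable_funB.
pose G x := (\sum_(0 <= j <oo) (d j x)%:E)%E.
have mG : measurable_fun setT G.
  by apply: ge0_emeasurable_sum => // j x _; rewrite lee_fin.
have iG : (\int[mu]_x G x < +oo)%E.
  rewrite integral_nneseries//; last by move=> n x _; rewrite lee_fin.
  apply: le_lt_trans (_ : _ <= 2%:E)%E (ltry _).
  apply: le_trans (_ : _ <= \sum_(0 <= j <oo) (2 / (2 ^ j.+1)%:R)%:E)%E _; last first.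
    by apply: le_trans (epsilon_trick0 _ _) _.
    apply: lee_nneseries => [j _ _|j _].
      by apply: integral_ge0 => x _; rewrite lee_fin.
    rewrite EFin_Rintegral; last exact: intgZl.
    rewrite lee_fin RintegralZl//.
    apply: le_trans (ler_wpM2l (exprn_ge0 _ _) (ltW (sd j))) _ => //.
    rewrite natrX exprSr -exprVn -exprMn (_ : 2 / _ = (2^-1) ^+ j).
      by rewrite lerXn2r ?nnegrE//; lra.
    by rewrite invfM mulrCA divff// mulr1 exprVn.
have [Z [mZ Z0 ZG]] : {ae mu, forall x, G x \is a fin_num}.
  have G0 x : (0 <= G x)%E by apply: nneseries_ge0 => j _ _; rewrite lee_fin.
  have /(integrable_ae measurableT) : mu.-integrable setT G.
    by apply/integrableP; split => //; under eq_integral do rewrite gee0_abs//.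
  by apply: filterS => x; exact.
pose D := ~` Z.
have mD : measurable D by exact: measurableC.
have GD x : D x -> G x \is a fin_num.
  by move=> Dx; apply: contrapT => H; apply: Dx; exact: ZG.
have cvD x : D x -> cvg (f_ (s j) x @[j --> \oo]).
  move=> Dx; apply: (@cvg_geometric_increments _ (1 + fine (G x))) => j.
  have dG : d j x <= fine (G x).
    rewrite -lee_fin (fineK (GD x Dx)).
    have dE i : (0 <= (d i x)%:E)%E by rewrite lee_fin.
    apply: le_trans (@nneseries_lim_ge R (fun j => (d j x)%:E) xpredT 0 j.+1 (fun i _ _ => dE i)).
    by rewrite big_nat_recr//= leeDr// sume_ge0// => i _; rewrite lee_fin.
  (* With [v] the modulus of the increment and [t = 2^j], the claim is [v t <= 1 + t^2 v^2], a
     consequence of [(t v - 1)^2 >= 0]. *)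
  rewrite ler_pdivlMr ?exprn_gt0//; apply: le_trans (_ : _ <= 1 + d j x) _; last by rewrite lerD2l.
  rewrite /d (_ : 4 = 2 * 2); last by ring.
  rewrite exprMn -(real_normK (num_real (_ - _))).
  move: (`|_|) (normr_ge0 (f_ (s j) x - f_ (s j.+1) x)) (2 ^+ j) (exprn_ge0 j (ler0n R 2)) => v v0 t t0.
  by have := sqr_ge0 (t * v - 1); nra.
(* Cutting off to [D] makes the sequence converge at every point, so that its limit is
   measurable. *)
pose f x := limn (fun j => f_ (s j) x * \1_D x).
have fD x : f_ (s j) x * \1_D x @[j --> \oo] --> f x.
  rewrite /f; have [Dx|Dx] := pselect (D x).
    by apply: (is_cvgMr_tmp (cvD x Dx)).
  by under eq_fun do rewrite indicE memNset// mulr0; exact: is_cvg_cst.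
have mF : measurable_fun setT f.
  apply: (@measurable_fun_cvg _ _ _ _ (fun j x => f_ (s j) x * \1_D x)).
    by move=> j; apply: measurable_funM => //; exact: measurable_indic.
  by move=> x _; exact: fD.
exists f; split => // e e0.
have [K HK] := cf e e0; exists K => n Kn.
apply: (@fatou_ae _ (fun j x => (f_ n x - f_ (s j) x) ^+ 2)) => //.
- by move=> j; apply: measurable_funX; exact: measurable_funB.
- by apply: measurable_funX; exact: measurable_funB.
- by move=> j x; exact: sqr_ge0.
- by move=> x; exact: sqr_ge0.
- exists Z; split => // x; apply: contra_notP => Dx.
  have cx : f_ (s j) x @[j --> \oo] --> f x.
    by have := fD x; under eq_fun do rewrite indicE (mem_set (Dx : D x)) mulr1.
  rewrite /= expr2; under eq_fun do rewrite expr2.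
  by apply: cvgM; apply: cvgB => //; exact: cvg_cst.
- near=> j; rewrite EFin_Rintegral// lee_fin ltW// HK//.
  rewrite (leq_trans _ (sj j))//; near: j; exact: nbhs_infty_ge.
Unshelve. all: by end_near. Qed.

Lemma L2_complete (f_ : nat -> R -> C) : (forall n, L2 (f_ n)) ->
  (forall e : R, 0 < e -> exists K, forall n m, (K <= n)%N -> (K <= m)%N ->
     sqnorm (fun x => f_ n x - f_ m x) < e) ->
  exists f, L2 f /\ sqnorm (fun x => f_ n x - f x) @[n --> \oo] --> (0 : R).
Proof.
move=> f2 cf.
have d2 n m := L2B (f2 n) (f2 m).
have reE n m x : complex.Re (f_ n x) - complex.Re (f_ m x) = complex.Re (f_ n x - f_ m x).
  by rewrite Re_sub.
have imE n m x : complex.Im (f_ n x) - complex.Im (f_ m x) = complex.Im (f_ n x - f_ m x).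
  by rewrite Im_sub.
have [a [ma Ha]] : exists f : R -> R, measurable_fun setT f /\
    forall e : R, 0 < e -> exists K, forall n, (K <= n)%N ->
     (\int[mu]_x ((complex.Re (f_ n x) - f x) ^+ 2)%:E <= e%:E)%E.
  apply: (L2_complete_real (f_ := fun n x => complex.Re (f_ n x))).
  - by move=> n; exact: (f2 n).1.1.
  - by move=> n m; under [X in EFin \o X]eq_fun do rewrite reE; exact: L2_re (d2 n m).
  - move=> e /cf[K HK]; exists K => n m Kn Km; apply: le_lt_trans (HK n m Kn Km).
    under eq_Rintegral do rewrite reE.
    apply: le_Rintegral => //; [exact: L2_re (d2 n m)|exact: L2_intg (d2 n m)|].
    by move=> x _; rewrite cabs_sqr lerDl sqr_ge0.
have [b [mb Hb]] : exists f : R -> R, measurable_fun setT f /\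
    forall e : R, 0 < e -> exists K, forall n, (K <= n)%N ->
     (\int[mu]_x ((complex.Im (f_ n x) - f x) ^+ 2)%:E <= e%:E)%E.
  apply: (L2_complete_real (f_ := fun n x => complex.Im (f_ n x))).
  - by move=> n; exact: (f2 n).1.2.
  - by move=> n m; under [X in EFin \o X]eq_fun do rewrite imE; exact: L2_im (d2 n m).
  - move=> e /cf[K HK]; exists K => n m Kn Km; apply: le_lt_trans (HK n m Kn Km).
    under eq_Rintegral do rewrite imE.
    apply: le_Rintegral => //; [exact: L2_im (d2 n m)|exact: L2_intg (d2 n m)|].
    by move=> x _; rewrite cabs_sqr lerDr sqr_ge0.
pose f x : C := Complex (a x) (b x).
have mf : cmeas f by split.
have sE n x : cabs (f_ n x - f x) ^+ 2 = (complex.Re (f_ n x) - a x) ^+ 2 + (complex.Im (f_ n x) - b x) ^+ 2.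
  by rewrite cabs_sqr Re_sub Im_sub.
have Hab (e : R) : 0 < e -> exists K, forall n, (K <= n)%N ->
    (\int[mu]_x (cabs (f_ n x - f x) ^+ 2)%:E <= e%:E)%E.
  move=> e0; have e2 : 0 < e / 2 by rewrite divr_gt0.
  have [K1 H1] := Ha _ e2; have [K2 H2] := Hb _ e2.
  exists (maxn K1 K2) => n; rewrite geq_max => /andP[n1 n2].
  under eq_integral do rewrite sE EFinD.
  rewrite ge0_integralD//.
  - by rewrite [e]splitr EFinD; apply: leeD; [exact: H1|exact: H2].
  - by move=> x _; rewrite lee_fin sqr_ge0.
  - by apply/measurable_EFinP; apply: measurable_funX; apply: measurable_funB => //; exact: (f2 n).1.1.
  - by move=> x _; rewrite lee_fin sqr_ge0.
  - by apply/measurable_EFinP; apply: measurable_funX; apply: measurable_funB => //; exact: (f2 n).1.2.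
have L2d : exists K, forall n, (K <= n)%N -> L2 (fun x => f_ n x - f x).
  have [K HK] := Hab 1 ltr01; exists K => n Kn; split; first exact: cmeasB (f2 n).1 mf.
  exact: le_lt_trans (HK n Kn) (ltry _).
have Lf : L2 f.
  case: L2d => K /(_ K (leqnn K)) H; have := L2B (f2 K) H.
  by under eq_fun do rewrite subKr.
exists f; split => //; apply/cvgrPdist_le => e e0.
have [K HK] := Hab e e0; exists K => // n /= Kn.
rewrite sub0r normrN ger0_norm ?sqnorm_ge0// -lee_fin -integral_sqnorm; first exact: HK.
exact: L2B.
Qed.
End Completeness.

(** * The Fourier transform on L2: Plancherel's identity, existence and inversion *)

Section FourierCompact.
Variable R : realType.
Local Notation mu := (@lebesgue_measure R).
Local Notation C := (R[i]).
Local Notation intg f := (mu.-integrable setT (EFin \o f)).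

Definition compact_supp (v : R -> C) := exists K : R, forall x, K < `|x| -> v x = 0.
Definition cutoff (n : nat) (u : R -> C) : R -> C := fun x => rc (\1_(`[- n%:R, n%:R]%classic) x) * u x.

Lemma intg_trig (a g : R -> R) (xi : R) : intg a -> continuous g -> (forall x, `|g x| <= 1) -> intg (fun x => a x * g (x * xi)).
Proof.
move=> ia cg g1; apply: (integrable_le (g := fun x => `|a x|)).
- apply: measurable_funM; first exact: integrable_measurable.
  by apply: measurableT_comp; [exact: continuous_measurable_fun|exact: measurable_funM].
- by move=> x; rewrite normrM ler_piMr.
- exact: integrable_norm.
Qed.

Lemma cosT_sub (a b : R -> R) xi : intg a -> intg b ->
  cosT (fun x => a x - b x) xi = cosT a xi - cosT b xi.
Proof.
move=> ia ib; rewrite /cosT -RintegralB//; first by apply: eq_Rintegral => x _; rewrite mulrBl.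
  by apply: intg_trig => //; [exact: continuous_cos|exact: cos_max].
by apply: intg_trig => //; [exact: continuous_cos|exact: cos_max].
Qed.

Lemma sinT_sub (a b : R -> R) xi : intg a -> intg b ->
  sinT (fun x => a x - b x) xi = sinT a xi - sinT b xi.
Proof.
move=> ia ib; rewrite /sinT -RintegralB//; first by apply: eq_Rintegral => x _; rewrite mulrBl.
  by apply: intg_trig => //; [exact: continuous_sin|exact: sin_max].
by apply: intg_trig => //; [exact: continuous_sin|exact: sin_max].
Qed.

Lemma FS_cosT (v : R -> C) (xi : R) :
  intg (fun x => complex.Re (v x)) -> intg (fun x => complex.Im (v x)) ->
  FS v xi = Complex (cosT (fun x => complex.Re (v x)) xi + sinT (fun x => complex.Im (v x)) xi)
                    (cosT (fun x => complex.Im (v x)) xi - sinT (fun x => complex.Re (v x)) xi).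
Proof.
move=> ip iq; have c1 := @cos_max R; have s1 := @sin_max R.
have cc := @continuous_cos R; have cs := @continuous_sin R.
rewrite /FS /cint; congr Complex.
  rewrite /cosT /sinT -RintegralD//; try exact: intg_trig.
  by apply: eq_Rintegral => x _; rewrite Re_mul/= cosN sinN; ring.
rewrite /cosT /sinT -RintegralB//; try exact: intg_trig.
by apply: eq_Rintegral => x _; rewrite Im_mul/= cosN sinN; ring.
Qed.

Lemma eq_opp_eq0 (x : R) : x = - x -> x = 0.
Proof. by move=> ?; lra. Qed.

Section One.
Variables (v : R -> C).
Hypotheses (v2 : L2 v) (vc : compact_supp v).
Let p x := complex.Re (v x).
Let q x := complex.Im (v x).

Lemma compact_intg_re : intg p.
Proof.
case: vc => K vK; apply: (@compact_sqr_integrable _ _ K).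
- exact: v2.1.1. - by move=> x /vK; rewrite /p => ->. - exact: L2_re.
Qed.

Lemma compact_intg_im : intg q.
Proof.
case: vc => K vK; apply: (@compact_sqr_integrable _ _ K).
- exact: v2.1.2. - by move=> x /vK; rewrite /q => ->. - exact: L2_im.
Qed.

Let ip := compact_intg_re. Let iq := compact_intg_im.

Lemma FS_compact (xi : R) : FS v xi = Complex (cosT p xi + sinT q xi) (cosT q xi - sinT p xi).
Proof. exact: FS_cosT. Qed.

Let cosTN (a : R -> R) x : cosT a (- x) = cosT a x.
Proof. by apply: eq_Rintegral => y _; rewrite mulrN cosN. Qed.

Let sinTN (a : R -> R) x : intg a -> sinT a (- x) = - sinT a x.
Proof.
move=> ia; rewrite -[RHS]mulN1r /sinT -RintegralZl//; last first.
  by apply: intg_trig => //; [exact: continuous_sin|exact: sin_max].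
by apply: eq_Rintegral => y _; rewrite mulrN sinN mulN1r mulrN.
Qed.

(** The square of the modulus of the transform is the sum of the squares belonging to the real and
    the imaginary part of [v], plus the cross term [X]. Since [cosT] is even and [sinT] is odd, [X]
    is odd and integrates to zero. *)
Lemma plancherel_compact : L2 (FS v) /\ sqnorm (FS v) = 2 * pi * sqnorm v.
Proof.
case: (vc) => K vK.
have mp : measurable_fun setT p by exact: v2.1.1.
have mq : measurable_fun setT q by exact: v2.1.2.
have pK x : K < `|x| -> p x = 0 by move=> /vK; rewrite /p => ->.
have qK x : K < `|x| -> q x = 0 by move=> /vK; rewrite /q => ->.
have ip2 : intg (fun x => p x ^+ 2) by exact: L2_re.
have iq2 : intg (fun x => q x ^+ 2) by exact: L2_im.
have IP := integrable_fourier_sqr mp pK ip2.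
have IQ := integrable_fourier_sqr mq qK iq2.
have IPQ := intgD IP IQ.
have mcp := measurable_cosT mp; have mcq := measurable_cosT mq.
have msp := measurable_sinT mp; have msq := measurable_sinT mq.
pose X x := 2 * (cosT p x * sinT q x - cosT q x * sinT p x).
have iX : intg X.
  apply: (integrable_le _ _ IPQ).
    by apply: measurable_funM => //; apply: measurable_funB; exact: measurable_funM.
  move=> x; rewrite /X ler_norml.
  move: (cosT p x) (cosT q x) (sinT p x) (sinT q x) => a b c d.
  (* The bound is [2 |ad - bc| <= a^2 + b^2 + c^2 + d^2], which makes the cross term integrable. *)
  have := (sqr_ge0 (a + d), sqr_ge0 (a - d), sqr_ge0 (b + c), sqr_ge0 (b - c)).
  by move=> [[[? ?] ?] ?]; apply/andP; split; nra.
have X0 : \int[mu]_x X x = 0.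
  have E : \int[mu]_x X (- x) = \int[mu]_x X x by apply: Rintegral_opp; exact: integrable_measurable.
  apply: eq_opp_eq0; rewrite -[LHS]E; clear E.
  rewrite -[RHS]mulN1r -(RintegralZl (-1) measurableT iX); apply: eq_Rintegral => x _.
  by rewrite /X !cosTN (sinTN _ ip) (sinTN _ iq); ring.
have mF : cmeas (FS v).
  split; rewrite (funext FS_compact) /=; [exact: measurable_funD|exact: measurable_funB].
have sE x : cabs (FS v x) ^+ 2 = (cosT p x ^+ 2 + sinT p x ^+ 2) + (cosT q x ^+ 2 + sinT q x ^+ 2) + X x.
  by rewrite cabs_sqr FS_compact /X /=; ring.
split.
  split => //; under eq_integral do rewrite sE.
  by rewrite EFin_Rintegral ?ltry//; exact: intgD.
rewrite /sqnorm; under eq_Rintegral do rewrite sE.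
rewrite (RintegralD measurableT IPQ iX) X0 addr0 (RintegralD measurableT IP IQ).
rewrite (plancherel_real mp pK ip2) (plancherel_real mq qK iq2) -mulrDr.
congr (_ * _); rewrite -(RintegralD measurableT ip2 iq2).
by apply: eq_Rintegral => x _; rewrite cabs_sqr.
Qed.
End One.

Lemma compact_suppB (v w : R -> C) : compact_supp v -> compact_supp w -> compact_supp (fun x => v x - w x).
Proof.
move=> [K vK] [L wL]; exists (Num.max K L) => x; rewrite gt_max => /andP[Kx Lx].
by rewrite vK// wL// subrr.
Qed.

Lemma FS_sub (v w : R -> C) : L2 v -> compact_supp v -> L2 w -> compact_supp w ->
  FS (fun x => v x - w x) = (fun xi => FS v xi - FS w xi).
Proof.
move=> v2 vc w2 wc; apply/funext => xi.
have iv := compact_intg_re v2 vc; have iv' := compact_intg_im v2 vc.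
have iw := compact_intg_re w2 wc; have iw' := compact_intg_im w2 wc.
rewrite (FS_compact v2 vc) (FS_compact w2 wc) (FS_compact (L2B v2 w2) (compact_suppB vc wc)).
have -> : (fun x => complex.Re (v x - w x)) = fun x => complex.Re (v x) - complex.Re (w x).
  by apply/funext => x; rewrite Re_sub.
have -> : (fun x => complex.Im (v x - w x)) = fun x => complex.Im (v x) - complex.Im (w x).
  by apply/funext => x; rewrite Im_sub.
rewrite (cosT_sub _ iv iw) (cosT_sub _ iv' iw') (sinT_sub _ iv iw) (sinT_sub _ iv' iw').
by apply/eqP; rewrite eq_complex/=; apply/andP; split; apply/eqP; ring.
Qed.

Lemma cut_supp n u : compact_supp (cutoff n u).
Proof.
exists n%:R => x nx; rewrite /cutoff indicE memNset ?mul0r//=.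
by rewrite in_itv/= -ler_norml => /(lt_le_trans nx); rewrite ltxx.
Qed.

Lemma cut_L2 n u : L2 u -> L2 (cutoff n u).
Proof.
move=> u2; have mI : measurable_fun setT (\1_(`[- n%:R, n%:R]%classic) : R -> R) by exact: measurable_indic.
have I1 x : (\1_(`[- n%:R, n%:R]%classic) x : R) ^+ 2 <= 1.
  by rewrite indicE; case: (_ \in _); rewrite ?expr1n ?expr0n.
have E x : (complex.Re (cutoff n u x) = \1_(`[- n%:R, n%:R]%classic) x * complex.Re (u x)) *
   (complex.Im (cutoff n u x) = \1_(`[- n%:R, n%:R]%classic) x * complex.Im (u x)).
  by rewrite /cutoff Re_mul Im_mul/= !mul0r subr0 addr0.
have m1 := u2.1.1; have m2 := u2.1.2.
apply: L2_intro.
- by split; under eq_fun do rewrite E; exact: measurable_funM.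
- apply: (integrable_le _ _ (L2_re u2)).
    by under eq_fun do rewrite E; apply: measurable_funX; exact: measurable_funM.
  by move=> x; rewrite ger0_norm ?sqr_ge0// E exprMn ler_piMl ?sqr_ge0.
- apply: (integrable_le _ _ (L2_im u2)).
    by under eq_fun do rewrite E; apply: measurable_funX; exact: measurable_funM.
  by move=> x; rewrite ger0_norm ?sqr_ge0// E exprMn ler_piMl ?sqr_ge0.
Qed.

Lemma Rintegral_dominated (f_ : nat -> R -> R) (f g : R -> R) :
  (forall n, measurable_fun setT (f_ n)) -> (forall x, f_ n x @[n --> \oo] --> f x) ->
  intg g -> (forall n x, `|f_ n x| <= g x) ->
  \int[mu]_x f_ n x @[n --> \oo] --> \int[mu]_x f x.
Proof.
move=> mf cf ig fg.
have mF : measurable_fun setT f by apply: measurable_fun_cvg mf _ => x _; exact: cf.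
have [] := @dominated_convergence _ _ _ mu setT measurableT (fun n x => (f_ n x)%:E) (EFin \o f) (EFin \o g).
- by move=> n; apply/measurable_EFinP; exact: mf.
- exact/measurable_EFinP.
- apply: aeW => x _; apply: cvg_EFin; first exact: nearW. exact: cf.
- exact: ig.
- by apply: aeW => x n _; rewrite /= lee_fin.
move=> iF _ H.
have E n : (\int[mu]_x (f_ n x)%:E)%E = (\int[mu]_x f_ n x)%:E.
  by rewrite EFin_Rintegral//; exact: (integrable_le (mf n) (fg n) ig).
move: H; rewrite (EFin_Rintegral iF) (_ : [sequence _]_n = fun n => (\int[mu]_x f_ n x)%:E); last exact/funext.
by move=> /fine_cvgP[_].
Qed.

Lemma cvg_cut u : L2 u -> sqnorm (fun x => cutoff n u x - u x) @[n --> \oo] --> (0 : R).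
Proof.
move=> u2; rewrite -[X in _ --> X](_ : \int[mu]_x (0 : R) = 0); last by rewrite Rintegral_cst// mul0r.
apply: (Rintegral_dominated (g := fun x => cabs (u x) ^+ 2)).
- by move=> n; exact: (integrable_measurable (L2_intg (L2B (cut_L2 n u2) u2))).
- move=> x; apply: (@cvg_near_cst _ _ _ _ _).
  near=> n; rewrite /cutoff indicE mem_set/= ?mul1r ?subrr.
    by rewrite cabs_sqr/= expr0n addr0.
  rewrite in_itv/= -ler_norml; near: n; exact: nbhs_infty_ger.
- exact: L2_intg.
- move=> n x; rewrite ger0_norm ?sqr_ge0// /cutoff indicE; case: (_ \in _); rewrite ?mul1r ?mul0r.
    by rewrite subrr cabs_sqr/= expr0n addr0 sqr_ge0.
  by rewrite sub0r !cabs_sqr; case: (u x) => a b /=; rewrite !sqrrN.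
Unshelve. all: by end_near. Qed.

Lemma FS_cut n u : FS (cutoff n u) = fun xi => cint `[- n%:R, n%:R]%classic (fun x => u x * expi (- (x * xi))).
Proof.
apply/funext => xi; rewrite /FS /cint; congr Complex.
  rewrite [RHS]Rintegral_mkcond; apply: eq_Rintegral => x _; rewrite patchE /cutoff indicE.
  case: (x \in _); rewrite !(Re_mul, Im_mul)/=; first by ring.
  by transitivity (0 : R); [ring|].
rewrite [RHS]Rintegral_mkcond; apply: eq_Rintegral => x _; rewrite patchE /cutoff indicE.
case: (x \in _); rewrite !(Re_mul, Im_mul)/=; first by ring.
  by transitivity (0 : R); [ring|].
Qed.

(** The truncated integral in the definition of the L2 transform is the integral transform of a
    cutoff, to which the results for compact support apply. *)
Lemma FL2P (u g : R -> C) : FL2 u g <-> [/\ L2 u, L2 g &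
  sqnorm (fun x => FS (cutoff n u) x - g x) @[n --> \oo] --> (0 : R)].
Proof.
have E n : L2 u -> L2 g ->
    (\int[mu]_xi (cabs (g xi - cint `[- (n%:R), n%:R]%classic
      (fun x => u x * expi (- (x * xi)))) ^+ 2)%:E)%E = (sqnorm (fun x => FS (cutoff n u) x - g x))%:E.
  move=> u2 g2.
  have F2 := (plancherel_compact (cut_L2 n u2) (cut_supp n u)).1.
  rewrite -integral_sqnorm; last exact: L2B.
  apply: eq_integral => x _; rewrite FS_cut; congr (_%:E).
  by rewrite !cabs_sqr !Re_sub !Im_sub; ring.
split=> [[u2 [g2 H]]|[u2 g2 H]]; do ?split => //.
  by move: H; rewrite (funext (fun n => E n u2 g2)) => /fine_cvgP[_].
rewrite (funext (fun n => E n u2 g2)).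
by apply: cvg_EFin => //; exact: nearW.
Qed.

Lemma FL2_exists (u : R -> C) : L2 u -> exists g, FL2 u g.
Proof.
move=> u2.
have c2 n := cut_L2 n u2.
have pc n := plancherel_compact (c2 n) (cut_supp n u).
have [|g [g2 gH]] := @L2_complete _ (fun n => FS (cutoff n u)) (fun n => (pc n).1).
  move=> e e0.
  (* Plancherel's identity costs [2 pi], and each of the two squared distances to [u] enters with a
     factor 2. *)
  have e0' : 0 < e / (8 * pi) by rewrite divr_gt0// mulr_gt0// pi_gt0.
  have /cvgrPdist_lt/(_ _ e0')[K _ HK] := cvg_cut u2.
  exists K => n m Kn Km.
  rewrite -FS_sub//; try exact: cut_supp.
  rewrite (plancherel_compact (L2B (c2 n) (c2 m)) (compact_suppB (cut_supp n u) (cut_supp m u))).2.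
  have := HK n Kn; have := HK m Km; rewrite !sub0r !normrN !ger0_norm ?sqnorm_ge0// => Hm Hn.
  have : sqnorm (fun x => cutoff n u x - cutoff m u x) <=
     2 * sqnorm (fun x => cutoff n u x - u x) + 2 * sqnorm (fun x => cutoff m u x - u x).
    have dn := L2B (c2 n) u2; have dm := L2B (c2 m) u2.
    rewrite /sqnorm -!RintegralZl//; try exact: L2_intg.
    rewrite -RintegralD//; try (apply: intgZl; exact: L2_intg).
    apply: le_Rintegral => //.
    - exact: L2_intg (L2B (c2 n) (c2 m)).
    - by apply: intgD; apply: intgZl; exact: L2_intg.
    - move=> x _; rewrite !cabs_sqr !Re_sub !Im_sub.
      have := sqrD_le (complex.Re (cutoff n u x) - complex.Re (u x)) (- (complex.Re (cutoff m u x) - complex.Re (u x))).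
      have := sqrD_le (complex.Im (cutoff n u x) - complex.Im (u x)) (- (complex.Im (cutoff m u x) - complex.Im (u x))).
      rewrite !sqrrN !opprB !addrA !subrK; lra.
  have p0 := pi_gt0 R; move=> H.
  have : sqnorm (fun x => cutoff n u x - cutoff m u x) < 4 * (e / (8 * pi)) by lra.
  rewrite -(ltr_pM2l (_ : 0 < 2 * pi)) ?mulr_gt0// => /lt_le_trans; apply.
  have pn0 : pi != 0 :> R by rewrite gt_eqF.
  by rewrite (_ : 2 * pi * _ = e)//; have := pn0; move: (pi : R) => P Pn0; field.
by exists g; apply/FL2P; split.
Qed.

Lemma FL2_norm (u g : R -> C) : FL2 u g -> sqnorm g = 2 * pi * sqnorm u.
Proof.
move=> /FL2P[u2 g2 H].
have c2 n := cut_L2 n u2.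
have pc n := plancherel_compact (c2 n) (cut_supp n u).
have H1 := cvg_sqnorm (fun n => (pc n).1) g2 H.
have H2 := cvg_sqnorm c2 u2 (cvg_cut u2).
have H3 : 2 * pi * sqnorm (cutoff n u) @[n --> \oo] --> 2 * pi * sqnorm u.
  by apply: cvgM => //; exact: cvg_cst.
by rewrite -(funext (fun n => (pc n).2)) in H3; exact: (cvg_unique _ H1 H3).
Qed.

(** Up to the factor [2 pi], the reflected transform of [G] is its inverse transform. This is the
    adjoint relation between the two transforms, by Fubini; compact supports provide the product
    majorant. *)
Lemma rip_adjoint (v G : R -> C) : L2 v -> compact_supp v -> L2 G -> compact_supp G ->
  rip v (fun x => FS G (- x)) = rip (FS v) G.
Proof.
move=> v2 vc G2 Gc.
pose p x := complex.Re (v x); pose q x := complex.Im (v x).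
pose a x := complex.Re (G x); pose b x := complex.Im (G x).
have ip : intg p := compact_intg_re v2 vc; have iq : intg q := compact_intg_im v2 vc.
have ia : intg a := compact_intg_re G2 Gc; have ib : intg b := compact_intg_im G2 Gc.
have mp := integrable_measurable ip; have mq := integrable_measurable iq.
have ma := integrable_measurable ia; have mb := integrable_measurable ib.
pose h x xi := p x * (a xi * cos (xi * x) - b xi * sin (xi * x)) + q x * (b xi * cos (xi * x) + a xi * sin (xi * x)).
have cc := @continuous_cos R; have cs := @continuous_sin R.
have c1 := @cos_max R; have s1 := @sin_max R.
have icos (f : R -> R) xi : intg f -> intg (fun x => f x * cos (x * xi)) by move=> jf; exact: intg_trig.
have isin (f : R -> R) xi : intg f -> intg (fun x => f x * sin (x * xi)) by move=> jf; exact: intg_trig.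
have cosTN (f : R -> R) x : cosT f (- x) = cosT f x.
  by apply: eq_Rintegral => y _; rewrite mulrN cosN.
have sinTN (f : R -> R) x : intg f -> sinT f (- x) = - sinT f x.
  move=> jf; rewrite -[RHS]mulN1r -(RintegralZl (-1) measurableT (isin f x jf)).
  by apply: eq_Rintegral => y _; rewrite mulrN sinN mulN1r mulrN.
transitivity (\int[mu]_x \int[mu]_xi h x xi).
  apply: eq_Rintegral => x _; rewrite (FS_compact G2 Gc) /= !cosTN (sinTN _ _ ia) (sinTN _ _ ib).
  rewrite opprK -/p -/q -/a -/b -/(p x) -/(q x) /h.
  have I1 : intg (fun xi => a xi * cos (xi * x) - b xi * sin (xi * x)).
    by apply: intgB; [exact: icos|exact: isin].
  have I2 : intg (fun xi => b xi * cos (xi * x) + a xi * sin (xi * x)).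
    by apply: intgD; [exact: icos|exact: isin].
  rewrite (RintegralD measurableT (intgZl (p x) I1) (intgZl (q x) I2)).
  rewrite (RintegralZl (p x) measurableT I1) (RintegralZl (q x) measurableT I2).
  rewrite (RintegralB measurableT (icos a x ia) (isin b x ib)).
  by rewrite (RintegralD measurableT (icos b x ib) (isin a x ia)).
have mfst : measurable_fun setT (fun z : R * R => z.1) by exact: measurable_fst.
have msnd : measurable_fun setT (fun z : R * R => z.2) by exact: measurable_snd.
have mC : measurable_fun setT (fun z : R * R => cos (z.2 * z.1)).
  by apply: measurableT_comp; [exact: continuous_measurable_fun|exact: measurable_funM].
have mS : measurable_fun setT (fun z : R * R => sin (z.2 * z.1)).
  by apply: measurableT_comp; [exact: continuous_measurable_fun|exact: measurable_funM].
have m1 (f : R -> R) : measurable_fun setT f -> measurable_fun setT (fun z : R * R => f z.1).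
  by move=> mf; exact: measurableT_comp.
have m2 (f : R -> R) : measurable_fun setT f -> measurable_fun setT (fun z : R * R => f z.2).
  by move=> mf; exact: measurableT_comp.
have mh : measurable_fun setT (fun z : R * R => h z.1 z.2).
  rewrite /h; apply: measurable_funD; apply: measurable_funM; try exact: m1.
    by apply: measurable_funB; apply: measurable_funM => //; exact: m2.
  by apply: measurable_funD; apply: measurable_funM => //; exact: m2.
have bh x xi : `|h x xi| <= (`|p x| + `|q x|) * (`|a xi| + `|b xi|).
  rewrite mulrDl; apply: le_trans (ler_normD _ _) _; rewrite !normrM.
  apply: lerD; apply: ler_wpM2l => //.
    by apply: le_trans (ler_normB _ _) _; rewrite !normrM; apply: lerD; rewrite ler_piMr.
  rewrite [leRHS]addrC; apply: le_trans (ler_normD _ _) _.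
  by rewrite !normrM; apply: lerD; rewrite ler_piMr.
have ipq : intg (fun x => `|p x| + `|q x|) by apply: intgD; exact: integrable_norm.
have iab : intg (fun x => `|a x| + `|b x|) by apply: intgD; exact: integrable_norm.
rewrite (Rintegral_Fubini (f := h) mh bh ipq iab).
clear mh bh ipq iab.
apply: eq_Rintegral => xi _; rewrite (FS_compact v2 vc) /= -/p -/q -/(a xi) -/(b xi).
have E x : h x xi = a xi * (p x * cos (x * xi) + q x * sin (x * xi)) + b xi * (q x * cos (x * xi) - p x * sin (x * xi)).
  by rewrite /h (mulrC xi x); ring.
under eq_Rintegral do rewrite E.
have I1 : intg (fun x => p x * cos (x * xi) + q x * sin (x * xi)).
  by apply: intgD; [exact: icos|exact: isin].
have I2 : intg (fun x => q x * cos (x * xi) - p x * sin (x * xi)).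
  by apply: intgB; [exact: icos|exact: isin].
rewrite (RintegralD measurableT (intgZl (a xi) I1) (intgZl (b xi) I2)).
rewrite (RintegralZl (a xi) measurableT I1) (RintegralZl (b xi) measurableT I2).
rewrite (RintegralD measurableT (icos p xi ip) (isin q xi iq)).
rewrite (RintegralB measurableT (icos q xi iq) (isin p xi ip)).
by rewrite mulrC [in X in _ + X]mulrC.
Qed.

(** Inversion follows from isometry and adjointness. With [w n] the truncated inverse integral,
    adjointness computes the inner product of [u] and [w n], and the squared distance of [u] and
    [w n] becomes [sqnorm u - (2 pi)^-1 sqnorm (cutoff n g)]. It tends to zero because
    [sqnorm g = 2 pi * sqnorm u]. *)
Lemma FL2_inversion (u g : R -> C) : FL2 u g -> FL2inv g u.
Proof.
move=> Fug; have N := FL2_norm Fug; move/FL2P: Fug => [u2 g2 H].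
have c2 n := cut_L2 n u2; have d2 n := cut_L2 n g2.
pose w n x := rc (2 * pi)^-1 * FS (cutoff n g) (- x).
have pi0 := pi_gt0 R; have pn0 : pi != 0 :> R by rewrite gt_eqF.
have r2 n : L2 (fun x => FS (cutoff n g) (- x)) /\ sqnorm (fun x => FS (cutoff n g) (- x)) = 2 * pi * sqnorm (cutoff n g).
  have [h2 hE] := plancherel_compact (d2 n) (cut_supp n g).
  split; last by rewrite -hE /sqnorm (Rintegral_opp (f := fun x => cabs (FS (cutoff n g) x) ^+ 2))//;
     exact: integrable_measurable (L2_intg h2).
  split; first by apply: cmeas_comp h2.1 _.
  have := integrable_opp (L2_intg h2) => /= iN.
  by rewrite (EFin_Rintegral (f := fun x => cabs (FS (cutoff n g) (- x)) ^+ 2) iN) ltry.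
have w2 n : L2 (w n) by apply: L2Z; exact: (r2 n).1.
have ipw n : rip u (w n) = (2 * pi)^-1 * sqnorm (cutoff n g).
  rewrite ripC /w ripZl//; last exact: (r2 n).1.
  congr (_ * _); rewrite ripC.
  (* The adjoint relation is known for compact supports only. Both of its sides converge as the
     cutoff of [u] is removed, while [n] stays fixed. *)
  have L : rip (cutoff m u) (fun x => FS (cutoff n g) (- x)) @[m --> \oo] --> rip u (fun x => FS (cutoff n g) (- x)).
    by apply: cvg_rip => //; [exact: (r2 n).1|exact: cvg_cut].
  have pc m := plancherel_compact (c2 m) (cut_supp m u).
  have L2' : rip (FS (cutoff m u)) (cutoff n g) @[m --> \oo] --> rip g (cutoff n g).
    by apply: cvg_rip => //; move=> m; exact: (pc m).1.
  have EL m : rip (cutoff m u) (fun x => FS (cutoff n g) (- x)) = rip (FS (cutoff m u)) (cutoff n g).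
    by apply: rip_adjoint => //; exact: cut_supp.
  rewrite (funext EL) in L.
  transitivity (rip g (cutoff n g)); first exact: (cvg_unique _ L L2').
  rewrite sqnorm_rip; apply: eq_Rintegral => x _.
  by rewrite /cutoff !Re_mul !Im_mul/= indicE; case: (_ \in _); rewrite /= ?mul0r ?mul1r ?subr0 ?addr0//; ring.
have E n : sqnorm (fun x => u x - w n x) = sqnorm u - (2 * pi)^-1 * sqnorm (cutoff n g).
  rewrite sqnormB// ipw sqnormZ; last exact: (r2 n).1.
  by rewrite (r2 n).2; have := pn0; move: (pi : R) => P Pn0; field.
split=> //; split => //.
rewrite (_ : (fun N : nat => _) = fun n => (sqnorm (fun x => u x - w n x))%:E); last first.
  apply/funext => n; rewrite -integral_sqnorm; last exact: L2B.
  apply: eq_integral => x _; rewrite /w FS_cut; congr ((cabs (_ - _ * cint _ _) ^+ 2)%:E).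
  by apply/funext => xi; rewrite mulrN opprK [x * xi]mulrC.
apply: cvg_EFin; first exact: nearW.
rewrite /comp/= (funext E).
rewrite -[X in _ --> X](_ : sqnorm u - (2 * pi)^-1 * sqnorm g = 0); last first.
  by rewrite N; have := pn0; move: (pi : R) => P Pn0; field.
apply: cvgB; first exact: cvg_cst.
by apply: cvgM; [exact: cvg_cst|exact: cvg_sqnorm d2 g2 (cvg_cut g2)].
Qed.
End FourierCompact.

(** * Integrals of complex functions *)

Section ComplexIntegral.
Variable R : realType.
Local Notation mu := (@lebesgue_measure R).
Local Notation C := (R[i]).
Local Notation intg f := (mu.-integrable setT (EFin \o f)).

Definition cintegrable (f : R -> C) : Prop :=
  intg (fun x => complex.Re (f x)) /\ intg (fun x => complex.Im (f x)).

Lemma complexP (z w : C) : complex.Re z = complex.Re w -> complex.Im z = complex.Im w -> z = w.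
Proof. by case: z; case: w => /= a b c d -> ->. Qed.

Lemma cabs_Re (z : C) : `|complex.Re z| <= cabs z.
Proof.
rewrite -(@ler_pXn2r _ 2)// ?nnegrE ?cabs_ge0// cabs_sqr real_normK ?num_real//.
by rewrite lerDl sqr_ge0.
Qed.

Lemma cabs_Im (z : C) : `|complex.Im z| <= cabs z.
Proof.
rewrite -(@ler_pXn2r _ 2)// ?nnegrE ?cabs_ge0// cabs_sqr real_normK ?num_real//.
by rewrite lerDr sqr_ge0.
Qed.

Lemma cabs_le_ReIm (z : C) : cabs z <= `|complex.Re z| + `|complex.Im z|.
Proof.
rewrite -(@ler_pXn2r _ 2)// ?nnegrE ?cabs_ge0 ?addr_ge0// cabs_sqr.
rewrite -(real_normK (num_real (complex.Re z))) -(real_normK (num_real (complex.Im z))).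
by move: (`|_|) (normr_ge0 (complex.Re z)) (`|_|) (normr_ge0 (complex.Im z)) => a a0 b b0; nra.
Qed.

Lemma cabsM (z w : C) : cabs (z * w) = cabs z * cabs w.
Proof. exact: ComplexField.Normc.normcM. Qed.

Lemma cabsD (z w : C) : cabs (z + w) <= cabs z + cabs w.
Proof. exact: le_normcD. Qed.

Lemma cabs0 : cabs (0 : C) = 0.
Proof. by rewrite /cabs/= expr0n addr0 sqrtr0. Qed.

Lemma cabs_rc (t : R) : cabs (rc t) = `|t|.
Proof. by rewrite /cabs/= expr0n addr0 sqrtr_sqr. Qed.

Lemma cabsN (z : C) : cabs (- z) = cabs z.
Proof. by case: z => a b; rewrite /cabs/= !sqrrN. Qed.

Lemma cabs_expi (t : R) : cabs (expi t) = 1.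
Proof. by rewrite /cabs/= cos2Dsin2 sqrtr1. Qed.

Lemma expiD (s t : R) : expi (s + t) = expi s * expi t.
Proof. by apply: complexP; rewrite ?Re_mul ?Im_mul /= ?cosD ?sinD//; ring. Qed.

Lemma cmeas_expi (k : R) : cmeas (fun x => expi (k * x)).
Proof.
by split => /=; apply: measurableT_comp; try exact: measurable_funM;
  apply: continuous_measurable_fun; [exact: continuous_cos|exact: continuous_sin].
Qed.

Lemma cmeas_cst (z : C) : cmeas (fun _ : R => z).
Proof. by split; exact: measurable_cst. Qed.

Lemma cintegrable_cmeas f : cintegrable f -> cmeas f.
Proof. by move=> [i1 i2]; split; exact: integrable_measurable. Qed.

Lemma cintegrable_le (f : R -> C) (g : R -> R) : cmeas f -> (forall x, cabs (f x) <= g x) ->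
  intg g -> cintegrable f.
Proof.
move=> [m1 m2] fg ig; split.
  by apply: integrable_le ig => // x; exact: le_trans (cabs_Re _) (fg x).
by apply: integrable_le ig => // x; exact: le_trans (cabs_Im _) (fg x).
Qed.

Lemma cintegrable_cabs (f : R -> C) : cintegrable f -> intg (fun x => cabs (f x)).
Proof.
move=> fi; have [i1 i2] := fi.
apply: (integrable_le (g := fun x => `|complex.Re (f x)| + `|complex.Im (f x)|)).
- exact: cmeas_cabs (cintegrable_cmeas fi).
- by move=> x; rewrite ger0_norm ?cabs_ge0// cabs_le_ReIm.
- by apply: intgD; exact: integrable_norm.
Qed.

Lemma cintegrableM (f g : R -> C) (B : R) : cintegrable f -> cmeas g -> (forall x, cabs (g x) <= B) ->
  cintegrable (fun x => f x * g x).
Proof.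
move=> fi mg gB; apply: (cintegrable_le (g := fun x => cabs (f x) * B)).
- exact: cmeasM (cintegrable_cmeas fi) mg.
- by move=> x; rewrite cabsM ler_wpM2l ?cabs_ge0.
- by apply: intgZr; exact: cintegrable_cabs.
Qed.

Lemma cintegrableD (f g : R -> C) : cintegrable f -> cintegrable g -> cintegrable (fun x => f x + g x).
Proof.
move=> [f1 f2] [g1 g2]; split.
  by under [X in EFin \o X]eq_fun do rewrite Re_add; exact: intgD.
by under [X in EFin \o X]eq_fun do rewrite Im_add; exact: intgD.
Qed.

Lemma cintegrableZ (z : C) (f : R -> C) : cintegrable f -> cintegrable (fun x => z * f x).
Proof.
move=> [f1 f2]; split.
  by under [X in EFin \o X]eq_fun do rewrite Re_mul; apply: intgB; exact: intgZl.
by under [X in EFin \o X]eq_fun do rewrite Im_mul; apply: intgD; exact: intgZl.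
Qed.

Lemma cintegrable0 : cintegrable (fun _ => 0).
Proof. by split; exact: integrable0. Qed.

Lemma cintD (f g : R -> C) : cintegrable f -> cintegrable g ->
  cint setT (fun x => f x + g x) = cint setT f + cint setT g.
Proof.
move=> [f1 f2] [g1 g2]; apply: complexP; rewrite /cint /=.
  by under eq_Rintegral do rewrite Re_add; exact: RintegralD.
by under eq_Rintegral do rewrite Im_add; exact: RintegralD.
Qed.

Lemma cintZ (z : C) (f : R -> C) : cintegrable f ->
  cint setT (fun x => z * f x) = z * cint setT f.
Proof.
move=> [f1 f2]; apply: complexP; rewrite /cint ?Re_mul ?Im_mul /=.
  under eq_Rintegral do rewrite Re_mul.
  by rewrite (RintegralB measurableT (intgZl _ f1) (intgZl _ f2)) !RintegralZl.
under eq_Rintegral do rewrite Im_mul.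
by rewrite (RintegralD measurableT (intgZl _ f2) (intgZl _ f1)) !RintegralZl.
Qed.

Lemma cint0 : cint setT (fun _ : R => 0 : C) = 0.
Proof. by apply: complexP; rewrite /cint/= Rintegral_cst// mul0r. Qed.

Lemma eq_cint (D : set R) (f g : R -> C) : f =1 g -> cint D f = cint D g.
Proof. by move=> /funext ->. Qed.

Lemma cintegrable_sum (L : nat) (f : nat -> R -> C) : (forall k, cintegrable (f k)) ->
  cintegrable (fun x => \sum_(k < L) f k x).
Proof.
move=> fi; elim: L => [|L IH].
  by under eq_fun do rewrite big_ord0; exact: cintegrable0.
by under eq_fun do rewrite big_ord_recr; exact: cintegrableD.
Qed.

Lemma cint_sum (L : nat) (f : nat -> R -> C) : (forall k, cintegrable (f k)) ->
  cint setT (fun x => \sum_(k < L) f k x) = \sum_(k < L) cint setT (f k).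
Proof.
move=> fi; elim: L => [|L IH].
  by under eq_cint do rewrite big_ord0; rewrite cint0 big_ord0.
under eq_cint do rewrite big_ord_recr /=.
by rewrite cintD//; [rewrite IH big_ord_recr|exact: cintegrable_sum].
Qed.

(** Real and imaginary part are bounded separately, whence the factor 2; it reappears in the
    constants of the estimates below. *)
Lemma cabs_cint (f : R -> C) : cintegrable f ->
  cabs (cint setT f) <= 2 * \int[mu]_x cabs (f x).
Proof.
move=> fi; have [i1 i2] := fi; have ic := cintegrable_cabs fi.
apply: le_trans (cabs_le_ReIm _) _; rewrite /cint /= mulrDl !mul1r.
apply: lerD.
  apply: le_trans (le_normr_Rintegral measurableT i1) _; apply: le_Rintegral => //.
    exact: integrable_norm. by move=> x _; exact: cabs_Re.
apply: le_trans (le_normr_Rintegral measurableT i2) _; apply: le_Rintegral => //.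
  exact: integrable_norm. by move=> x _; exact: cabs_Im.
Qed.

Lemma cint_shift (a : R) (f : R -> C) : cmeas f ->
  cint setT (fun x => f (x + a)) = cint setT f.
Proof.
move=> [m1 m2]; apply: complexP => /=.
  exact: (Rintegral_shift a m1). exact: (Rintegral_shift a m2).
Qed.

Lemma compact_L2_cintegrable (v : R -> C) : L2 v -> compact_supp v -> cintegrable v.
Proof. by move=> v2 vc; split; [exact: compact_intg_re|exact: compact_intg_im]. Qed.

Lemma FS_ext (v : R -> C) xi : FS v xi = cint setT (fun x => v x * expi (- xi * x)).
Proof. by apply: eq_cint => x; rewrite mulNr [x * xi]mulrC. Qed.

Lemma FS_integrand (v : R -> C) xi : cintegrable v -> cintegrable (fun x => v x * expi (- xi * x)).
Proof.
by move=> iv; apply: (cintegrableM (B := 1)) => //; [exact: cmeas_expi|move=> x; rewrite cabs_expi].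
Qed.

Lemma FS_D (v u : R -> C) xi : cintegrable v -> cintegrable u ->
  FS (fun x => v x + u x) xi = FS v xi + FS u xi.
Proof.
move=> iv iu; rewrite !FS_ext -cintD; try exact: FS_integrand.
by apply: eq_cint => x; rewrite mulrDl.
Qed.

Lemma FS_Z (z : C) (v : R -> C) xi : cintegrable v -> FS (fun x => z * v x) xi = z * FS v xi.
Proof.
move=> iv; rewrite !FS_ext -cintZ; last exact: FS_integrand.
by apply: eq_cint => x; rewrite mulrA.
Qed.

End ComplexIntegral.

(** * Algebra of the inverse transform on L2 *)

Section L2InverseAlgebra.
Variable R : realType.
Local Notation mu := (@lebesgue_measure R).
Local Notation C := (R[i]).
Local Notation intg f := (mu.-integrable setT (EFin \o f)).

(** The truncated inverse integral, expressed through the forward transform so that Plancherel's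
    identity and linearity carry over; [inv_cutE] identifies it with the integral in [FL2inv]. *)
Definition inv_cut (n : nat) (g : R -> C) (x : R) : C := rc (2 * pi)^-1 * FS (cutoff n g) (- x).

Lemma L2_opp (f : R -> C) : L2 f -> L2 (fun x => f (- x)).
Proof.
move=> f2; split; first by apply: cmeas_comp f2.1 _.
have := integrable_opp (L2_intg f2) => /= iN.
by rewrite (EFin_Rintegral (f := fun x => cabs (f (- x)) ^+ 2) iN) ltry.
Qed.

Lemma inv_cut_L2 n g : L2 g -> L2 (inv_cut n g).
Proof.
move=> g2; apply: L2Z; apply: L2_opp.
exact: (plancherel_compact (cut_L2 n g2) (cut_supp n g)).1.
Qed.

Lemma inv_cutE n g x : inv_cut n g x =
  rc ((2 * pi)^-1) * cint `[- (n%:R), n%:R]%classic (fun xi => g xi * expi (x * xi)).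
Proof.
rewrite /inv_cut FS_cut; congr (_ * cint _ _).
by apply/funext => xi; rewrite mulrN opprK [x * xi]mulrC.
Qed.

Lemma FL2invP (g v : R -> C) : FL2inv g v <-> [/\ L2 g, L2 v &
  sqnorm (fun x => v x - inv_cut n g x) @[n --> \oo] --> (0 : R)].
Proof.
have E n : L2 v -> L2 g ->
    (\int[mu]_x (cabs (v x - rc ((2 * pi)^-1) * cint `[- (n%:R), n%:R]%classic
      (fun xi => g xi * expi (x * xi))) ^+ 2)%:E)%E = (sqnorm (fun x => v x - inv_cut n g x))%:E.
  move=> v2 g2; rewrite -integral_sqnorm; last by apply: L2B => //; exact: inv_cut_L2.
  by apply: eq_integral => x _; rewrite inv_cutE.
split=> [[g2 [v2 H]]|[g2 v2 H]]; do ?split => //.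
  by move: H; rewrite (funext (fun n => E n v2 g2)) => /fine_cvgP[_].
rewrite (funext (fun n => E n v2 g2)).
by apply: cvg_EFin => //; exact: nearW.
Qed.

Lemma cut_cintegrable n (g : R -> C) : L2 g -> cintegrable (cutoff n g).
Proof. by move=> g2; apply: compact_L2_cintegrable; [exact: cut_L2|exact: cut_supp]. Qed.

Lemma inv_cutD n (g h : R -> C) x : L2 g -> L2 h ->
  inv_cut n (fun x => g x + h x) x = inv_cut n g x + inv_cut n h x.
Proof.
move=> g2 h2; rewrite /inv_cut.
have -> : cutoff n (fun x => g x + h x) = fun y => cutoff n g y + cutoff n h y.
  by apply/funext => y; rewrite /cutoff mulrDr.
by rewrite (FS_D _ (cut_cintegrable n g2) (cut_cintegrable n h2)) mulrDr.
Qed.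

Lemma inv_cutZ n (t : R) (g : R -> C) x : L2 g ->
  inv_cut n (fun x => rc t * g x) x = rc t * inv_cut n g x.
Proof.
move=> g2; rewrite /inv_cut.
have -> : cutoff n (fun x => rc t * g x) = fun y => rc t * cutoff n g y.
  by apply/funext => y; rewrite /cutoff mulrCA.
by rewrite (FS_Z _ _ (cut_cintegrable n g2)) mulrCA.
Qed.

Lemma sqnormD_le (f g : R -> C) : L2 f -> L2 g ->
  sqnorm (fun x => f x + g x) <= 2 * sqnorm f + 2 * sqnorm g.
Proof.
move=> f2 g2; rewrite /sqnorm -!RintegralZl//; try exact: L2_intg.
rewrite -RintegralD//; try (apply: intgZl; exact: L2_intg).
apply: le_Rintegral => //.
- exact: L2_intg (L2D f2 g2).
- by apply: intgD; apply: intgZl; exact: L2_intg.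
- move=> x _; rewrite !cabs_sqr Re_add Im_add.
  have := sqrD_le (complex.Re (f x)) (complex.Re (g x)).
  have := sqrD_le (complex.Im (f x)) (complex.Im (g x)); lra.
Qed.

Lemma cvg0_2D (a b : nat -> R) : a n @[n --> \oo] --> (0 : R) -> b n @[n --> \oo] --> (0 : R) ->
  2 * a n + 2 * b n @[n --> \oo] --> (0 : R).
Proof.
move=> ha hb; rewrite -[X in _ --> X](_ : 2 * 0 + 2 * 0 = 0); last by ring.
by apply: cvgD; apply: cvgM => //; exact: cvg_cst.
Qed.

Lemma FL2invD (g h v u : R -> C) : FL2inv g v -> FL2inv h u ->
  FL2inv (fun x => g x + h x) (fun x => v x + u x).
Proof.
move=> /FL2invP[g2 v2 H1] /FL2invP[h2 u2 H2]; apply/FL2invP; split; [exact: L2D|exact: L2D|].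
apply: (@squeeze_cvgr _ _ _ _ (fun=> 0)
  (fun n => 2 * sqnorm (fun x => v x - inv_cut n g x) + 2 * sqnorm (fun x => u x - inv_cut n h x))).
- apply: nearW => n; rewrite sqnorm_ge0/=.
  have := sqnormD_le (L2B v2 (inv_cut_L2 n g2)) (L2B u2 (inv_cut_L2 n h2)); apply: le_trans.
  rewrite le_eqVlt; apply/orP; left; apply/eqP; congr sqnorm; apply/funext => x.
  by rewrite inv_cutD//; ring.
- exact: cvg_cst.
- exact: cvg0_2D H1 H2.
Qed.

Lemma FL2invZ (t : R) (g v : R -> C) : FL2inv g v -> FL2inv (fun x => rc t * g x) (fun x => rc t * v x).
Proof.
move=> /FL2invP[g2 v2 H1]; apply/FL2invP; split; [exact: L2Z|exact: L2Z|].
have E n : sqnorm (fun x => rc t * v x - inv_cut n (fun x => rc t * g x) x) =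
   t ^+ 2 * sqnorm (fun x => v x - inv_cut n g x).
  rewrite -sqnormZ; last by apply: L2B => //; exact: inv_cut_L2.
  by congr sqnorm; apply/funext => x; rewrite inv_cutZ// mulrBr.
rewrite (funext E) -[X in _ --> X](mulr0 (t ^+ 2)).
by apply: cvgM; [exact: cvg_cst|exact: H1].
Qed.

Lemma FL2invB (g h v u : R -> C) : FL2inv g v -> FL2inv h u ->
  FL2inv (fun x => g x - h x) (fun x => v x - u x).
Proof.
move=> H1 H2; have := FL2invD H1 (FL2invZ (-1) H2).
by under eq_fun do rewrite rcN1; under [X in FL2inv _ X]eq_fun do rewrite rcN1.
Qed.

Lemma L2_shift (a : R) (f : R -> C) : L2 f -> L2 (fun x => f (x + a)).
Proof.
move=> f2; split; first by apply: cmeas_comp f2.1 _; exact: measurable_funD.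
have := integrable_shift a (L2_intg f2) => /= iN.
by rewrite (EFin_Rintegral (f := fun x => cabs (f (x + a)) ^+ 2) iN) ltry.
Qed.

Lemma L2_expi (a : R) (f : R -> C) : L2 f -> L2 (fun x => expi (a * x) * f x).
Proof.
move=> f2; split; first by apply: cmeasM f2.1; exact: cmeas_expi.
by under eq_integral do rewrite cabsM cabs_expi mul1r; exact: f2.2.
Qed.

(** Truncation acts on the frequency side, where it commutes with the modulation. So the truncated
    integrals are exact translates of each other, and the distance to the limit is the same for each
    [n]. *)
Lemma FL2inv_shift (a : R) (g v : R -> C) : FL2inv g v ->
  FL2inv (fun xi => expi (a * xi) * g xi) (fun x => v (x + a)).
Proof.
move=> /FL2invP[g2 v2 H1]; apply/FL2invP; split; [exact: L2_expi|exact: L2_shift|].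
suff E n : sqnorm (fun x => v (x + a) - inv_cut n (fun xi => expi (a * xi) * g xi) x) =
    sqnorm (fun x => v x - inv_cut n g x) by rewrite (funext E).
clear H1; have d2 := L2B v2 (inv_cut_L2 n g2).
rewrite [RHS]/sqnorm -(Rintegral_shift a (integrable_measurable (L2_intg d2))).
apply: eq_Rintegral => x _; rewrite !inv_cutE.
have -> : (fun xi => expi (a * xi) * g xi * expi (x * xi)) = fun xi => g xi * expi ((x + a) * xi).
  by apply/funext => xi; rewrite mulrDl expiD; ring.
by [].
Qed.

Lemma sqnorm_eq0_ae (f : R -> C) : L2 f -> sqnorm f = 0 -> {ae mu, forall x, f x = 0}.
Proof.
move=> f2 f0.
have mf : measurable_fun setT (fun x => (cabs (f x) ^+ 2)%:E) by exact: (measurable_int _ (L2_intg f2)).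
have : (\int[mu]_x `|(cabs (f x) ^+ 2)%:E| = 0)%E.
  under eq_integral do rewrite gee0_abs ?lee_fin ?sqr_ge0//.
  by rewrite integral_sqnorm// f0.
move=> /(ae_eq_integral_abs mu measurableT mf).1; apply: filterS => x /(_ I) [] /eqP.
rewrite sqrf_eq0 => /eqP x0; apply: complexP => /=.
  by apply/eqP; rewrite -normr_le0 -x0 cabs_Re.
by apply/eqP; rewrite -normr_le0 -x0 cabs_Im.
Qed.

End L2InverseAlgebra.

(** * Shifts in weighted Banach function spaces *)

Section Weights.
Variable R : realType.
Local Notation mu := (@lebesgue_measure R).
Local Notation C := (R[i]).
Local Notation intg f := (mu.-integrable setT (EFin \o f)).
Variables (rho : (R -> \bar R) -> \bar R) (c : R) (w : R -> R).
Hypotheses (rhoN : banach_function_norm rho) (rhoT : translation_invariant rho) (c0 : 0 < c).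
Hypotheses (w0 : forall x, 0 < w x)
  (wexp : forall x t, 0 <= t -> w x <= expR (- (c * t)) * w (x + t)).

Lemma weight_nondecreasing x y : x <= y -> w x <= w y.
Proof.
move=> xy; have := @wexp x (y - x); rewrite subr_ge0 => /(_ xy); rewrite (addrC x) subrK => /le_trans; apply.
by rewrite ler_piMl ?(ltW (w0 _))// expR_le1 oppr_le0 mulr_ge0 ?subr_ge0 ?(ltW c0).
Qed.

Lemma measurable_weight : measurable_fun setT w.
Proof. by apply: nondecreasing_measurable => //; exact: weight_nondecreasing. Qed.

Lemma cmeas_rc (f : R -> R) : measurable_fun setT f -> cmeas (fun x => rc (f x)).
Proof. by move=> mf; split => //=; exact: measurable_cst. Qed.

Lemma cmeas_weight u : cmeas u -> cmeas (fun x => u x * rc (w x)).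
Proof. by move=> mu_; apply: cmeasM => //; apply: cmeas_rc; exact: measurable_weight. Qed.

Lemma Mplus_cabsE (f : R -> C) : cmeas f -> Mplus (cabsE f).
Proof.
move=> mf; split; first by apply/measurable_EFinP; exact: cmeas_cabs.
by move=> x; rewrite lee_fin cabs_ge0.
Qed.

Lemma rho_le f g : Mplus f -> Mplus g -> (forall x, (g x <= f x)%E) -> (rho g <= rho f)%E.
Proof. by move=> Mf Mg gf; case: rhoN => _ A2 _ _ _; apply: A2 => //; exact: aeW. Qed.

Lemma rho_zero : rho (fun _ => 0%E) = 0%E.
Proof.
by case: rhoN => [[A1 _] _ _ _ _]; apply/A1; [split => //; exact: measurable_cst|exact: aeW].
Qed.

Lemma rho_ge0 f : Mplus f -> (0 <= rho f)%E.
Proof.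
move=> Mf; rewrite -rho_zero; by apply: rho_le => //; exact: Mf.2.
Qed.

Lemma wnorm_ge0 u : cmeas u -> (0 <= wnorm rho w u)%E.
Proof. by move=> m; apply: rho_ge0; apply: Mplus_cabsE; exact: cmeas_weight. Qed.

Lemma wnorm0 : wnorm rho w (fun _ => 0) = 0%E.
Proof.
rewrite /wnorm (_ : cabsE _ = fun _ => 0%E) ?rho_zero//.
by apply/funext => x; rewrite /cabsE mul0r cabs0.
Qed.

Lemma wnormD f g : cmeas f -> cmeas g ->
  (wnorm rho w (fun x => f x + g x)%R <= wnorm rho w f + wnorm rho w g)%E.
Proof.
move=> mf mg; have Mf := Mplus_cabsE (cmeas_weight mf); have Mg := Mplus_cabsE (cmeas_weight mg).
case: (rhoN) => [[_ [_ A1]] _ _ _ _]; apply: le_trans (A1 _ _ Mf Mg); apply: rho_le.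
- split; first exact: emeasurable_funD Mf.1 Mg.1.
  by move=> x; apply: adde_ge0; [exact: Mf.2|exact: Mg.2].
- by apply: Mplus_cabsE; apply: cmeas_weight; exact: cmeasD.
- by move=> x; rewrite /cabsE -EFinD lee_fin mulrDl cabsD.
Qed.

Lemma wnormZ (t : R) f : cmeas f -> wnorm rho w (fun x => rc t * f x) = (`|t|%:E * wnorm rho w f)%E.
Proof.
move=> mf; have Mf := Mplus_cabsE (cmeas_weight mf).
case: (rhoN) => [[_ [A1 _]] _ _ _ _]; rewrite /wnorm -A1//; congr rho.
by apply/funext => x; rewrite /cabsE -EFinM -mulrA cabsM cabs_rc.
Qed.

(** Translation invariance concerns the unweighted norm, so it is applied to the product of [u] and
    [w]: by [wexp], [|u(x+t)| w(x)] is at most [exp(-ct)] times the value of [|u w|] at [x + t]. *)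
Lemma wnorm_shift (t : R) u : 0 <= t -> cmeas u -> (wnorm rho w u < +oo)%E ->
  (wnorm rho w (fun x => u (x + t)%R) <= (expR (- (c * t)))%:E * wnorm rho w u)%E.
Proof.
move=> t0 mu_ fu; have muw := cmeas_weight mu_; have Mu := Mplus_cabsE muw.
have mus := cmeas_comp (g := fun x => x + t) mu_ (measurable_funD (@measurable_id _ _ _) (measurable_cst _)).
have muws := cmeas_comp (g := fun x => x + t) muw (measurable_funD (@measurable_id _ _ _) (measurable_cst _)).
rewrite -[X in (_ * X)%E](rhoT (- t) muw fu).
case: (rhoN) => [[_ [A1 _]] _ _ _ _]; rewrite -A1 ?expR_ge0//; last first.
  by apply: Mplus_cabsE; under eq_fun do rewrite opprK.
apply: rho_le.
- under eq_fun do rewrite opprK; split; last first.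
    by move=> x; rewrite /cabsE -EFinM lee_fin mulr_ge0 ?expR_ge0 ?cabs_ge0.
  apply/measurable_EFinP; apply: measurable_funM => //; exact: cmeas_cabs.
- by apply: Mplus_cabsE; exact: cmeas_weight.
- move=> x; rewrite /cabsE -EFinM lee_fin opprK !cabsM !cabs_rc !gtr0_norm// mulrCA.
  by rewrite ler_wpM2l ?cabs_ge0// wexp.
Qed.

(** Arbitrary coefficients allow [a_n] and the differences [a_n - a_m] to be treated alike;
    [coef_norm] bounds the operator norm on the weighted space. *)
Definition shift_sum (d : nat -> R) (L : nat) (u : R -> C) (x : R) : C :=
  \sum_(k < L) rc (d k) * u (x + k%:R).
Definition trig_sum (d : nat -> R) (L : nat) (x : R) : C :=
  \sum_(k < L) rc (d k) * expi (k%:R * x).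
Definition coef_norm (d : nat -> R) (L : nat) : R :=
  \sum_(k < L) `|d k| * expR (- (c * k%:R)).

Lemma shift_sumS d L u : shift_sum d L.+1 u = fun x => shift_sum d L u x + rc (d L) * u (x + L%:R).
Proof. by apply/funext => x; rewrite /shift_sum big_ord_recr. Qed.

Lemma cmeas_shift (a : R) (u : R -> C) : cmeas u -> cmeas (fun x => u (x + a)).
Proof. by move=> m; apply: cmeas_comp => //; exact: measurable_funD. Qed.

Lemma cmeas_shift_sum d L u : cmeas u -> cmeas (shift_sum d L u).
Proof.
move=> m; elim: L => [|L IH].
  by rewrite (_ : shift_sum d 0 u = fun _ => 0); [exact: cmeas_cst|apply/funext => x; rewrite /shift_sum big_ord0].
by rewrite shift_sumS; apply: cmeasD => //; apply: cmeasM; [exact: cmeas_cst|exact: cmeas_shift].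
Qed.

Lemma wnorm_shift_sum d L u : cmeas u -> (wnorm rho w u < +oo)%E ->
  (wnorm rho w (shift_sum d L u) <= (coef_norm d L)%:E * wnorm rho w u)%E.
Proof.
move=> m fu; have u0 := wnorm_ge0 m.
elim: L => [|L IH].
  rewrite (_ : shift_sum d 0 u = fun _ => 0); last by apply/funext => x; rewrite /shift_sum big_ord0.
  by rewrite wnorm0 /coef_norm big_ord0 mul0e.
rewrite shift_sumS; apply: le_trans (wnormD _ _) _.
- exact: cmeas_shift_sum.
- by apply: cmeasM; [exact: cmeas_cst|exact: cmeas_shift].
rewrite wnormZ; last exact: cmeas_shift.
rewrite /coef_norm big_ord_recr/= EFinD ge0_muleDl ?lee_fin; last 2 first.
- by apply: sumr_ge0 => k _; rewrite mulr_ge0 ?expR_ge0.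
- by rewrite mulr_ge0 ?expR_ge0.
apply: leeD => //; rewrite EFinM -muleA; apply: lee_wpmul2l; first by rewrite lee_fin.
exact: wnorm_shift.
Qed.

Definition ecoef (k : nat) : R := expR (c * k%:R / 2).
(** Coefficients of [a_n - a_m] once both sums are padded with zeros to the length [maxn n m]. *)
Definition dcoef (n m k : nat) : R := ((k < n)%N%:R - (k < m)%N%:R) * ecoef k.

Lemma rcB (a b : R) : rc (a - b) = rc a - rc b.
Proof. by apply: complexP; rewrite ?Re_sub ?Im_sub//= subrr. Qed.

Lemma ecoef_diff (F : nat -> C) (n m : nat) :
  \sum_(k < n) rc (ecoef k) * F k - \sum_(k < m) rc (ecoef k) * F k =
  \sum_(k < maxn n m) rc (dcoef n m k) * F k.
Proof.
have W p : (p <= maxn n m)%N -> \sum_(k < p) rc (ecoef k) * F k = \sum_(k < maxn n m) rc ((k < p)%N%:R * ecoef k) * F k.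
  move=> pL; rewrite (big_ord_widen _ (fun k => rc (ecoef k) * F k) pL) big_mkcond/=.
  apply: eq_bigr => k _; case: (_ < _)%N; rewrite ?mul1r// mul0r.
  by rewrite (_ : rc 0 = 0) ?mul0r.
rewrite (W n (leq_maxl _ _)) (W m (leq_maxr _ _)) -sumrB; apply: eq_bigr => k _.
by rewrite -mulrBl -rcB -mulrBl.
Qed.

(** The ratio that remains when the coefficient [exp(ck/2)] meets the shift bound [exp(-ck)]. *)
Let q := expR (- (c / 2)).

(** The sum telescopes after multiplication by [1 - q]; [maxn K L] keeps the right side at zero
    while no index has reached [K]. *)
Lemma geometric_tail (K L : nat) : (1 - q) * \sum_(k < L) ((K <= k)%N%:R * q ^+ k) <= q ^+ K - q ^+ maxn K L.
Proof.
elim: L => [|L IH]; first by rewrite big_ord0 mulr0 maxn0 subrr.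
rewrite big_ord_recr mulrDr /=; have [KL|LK] := leqP K L.
  rewrite (maxn_idPr (leqW KL)) mul1r; rewrite (maxn_idPr KL) in IH.
  by rewrite exprS; lra.
rewrite mul0r mulr0 addr0; apply: le_trans IH _.
by rewrite (maxn_idPl LK) (maxn_idPl (ltnW LK)).
Qed.

Lemma dcoef_small (e : R) : 0 < e -> exists K, forall n m, (K <= n)%N -> (K <= m)%N ->
  coef_norm (dcoef n m) (maxn n m) < e.
Proof.
move=> e0; have q1 : q < 1 by rewrite expR_lt1 oppr_lt0 divr_gt0.
have q0 : 0 < q := expR_gt0 _.
have d0 : 0 < e * (1 - q) by rewrite mulr_gt0// subr_gt0.
have /cvgrPdist_lt/(_ _ d0)[K _ HK] : q ^+ n @[n --> \oo] --> (0 : R).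
  by apply: cvg_expr; rewrite gtr0_norm.
exists K => n m Kn Km; have := HK K (leqnn K).
rewrite sub0r normrN gtr0_norm ?exprn_gt0// => qK.
rewrite -(ltr_pM2l (_ : 0 < 1 - q)) ?subr_gt0// [X in _ < X]mulrC.
apply: le_lt_trans qK; apply: (@le_trans _ _ (q ^+ K - q ^+ maxn K (maxn n m))); last first.
  by rewrite gerBl exprn_ge0// ltW.
apply: le_trans (geometric_tail _ _); rewrite ler_wpM2l ?subr_ge0 ?(ltW q1)//.
apply: ler_sum => k _.
have -> : q ^+ k = ecoef k * expR (- (c * k%:R)).
  by rewrite /q /ecoef -expRM_natr -expRD; congr expR; lra.
rewrite mulrA ler_wpM2r ?expR_ge0// /dcoef normrM (gtr0_norm (expR_gt0 _)) ler_wpM2r ?expR_ge0//.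
have [Kk|kK] := leqP K k; first by case: (_ < _)%N; case: (_ < _)%N; rewrite /= ?subrr ?subr0 ?sub0r ?normrN ?normr1 ?normr0.
by rewrite (leq_trans kK Kn) (leq_trans kK Km) subrr normr0.
Qed.

(** (A5) bounds the integral of [|v| w] over [E]. The weight is nondecreasing, hence at least [w a]
    on [E], and can be divided out. The constant depends on [E], so in the applications [E] is
    chosen before the accuracy of the approximation. *)
Lemma local_bound (a : R) (E : set R) : measurable E -> (mu E < +oo)%E -> (forall x, E x -> a <= x) ->
  exists B : R, 0 <= B /\ forall v, cmeas v -> (wnorm rho w v < +oo)%E ->
    (\int[mu]_(x in E) (cabs (v x))%:E <= B%:E * wnorm rho w v)%E.
Proof.
move=> mE Ey Ea; case: (rhoN) => _ _ _ _ /(_ E mE Ey)[CE HE].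
(* The constant of (A5) comes without a sign; the absolute value makes [B] nonnegative. *)
exists ((w a)^-1 * `|CE|); split; first by rewrite mulr_ge0// invr_ge0 ltW.
move=> v mv fv; have Mv := Mplus_cabsE (cmeas_weight mv).
have v0 := wnorm_ge0 mv.
apply: (@le_trans _ _ (\int[mu]_(x in E) ((w a)^-1%:E * cabsE (fun x => (v x * rc (w x))%R) x))%E).
  apply: ge0_le_integral => //.
  - by move=> x _; rewrite lee_fin cabs_ge0.
  - by apply/measurable_EFinP; apply: measurable_funTS; exact: cmeas_cabs.
  - by apply: emeasurable_funM => //; apply: measurable_funTS; exact: Mv.1.
  - move=> x Ex; rewrite /cabsE -EFinM lee_fin cabsM cabs_rc gtr0_norm// mulrCA ler_peMr ?cabs_ge0//.
    by rewrite mulrC ler_pdivlMr// mul1r weight_nondecreasing// Ea.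
rewrite ge0_integralZl//; last 3 first.
- by apply: measurable_funTS; exact: Mv.1.
- by move=> x _; exact: Mv.2.
- by rewrite lee_fin invr_ge0 ltW.
rewrite EFinM -muleA; apply: lee_wpmul2l; first by rewrite lee_fin invr_ge0 ltW.
apply: le_trans (HE _ Mv) _; rewrite /wnorm; apply: lee_wpmul2r => //.
by rewrite lee_fin ler_norm.
Qed.
End Weights.

(** * Incompleteness of the multiplier algebra on L2 *)

Section NotCompleteM0.
Variable R : realType.
Local Notation mu := (@lebesgue_measure R).
Local Notation C := (R[i]).
Local Notation intg f := (mu.-integrable setT (EFin \o f)).

Lemma ae_imp (P Q : R -> Prop) : {ae mu, forall x, P x} -> (forall x, P x -> Q x) ->
  {ae mu, forall x, Q x}.
Proof. by move=> H PQ; apply: filterS H => [|x /PQ//]; exact: (ae_filter_ringOfSetsType mu). Qed.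

Lemma trig_sumS (d : nat -> R) L : trig_sum d L.+1 = fun x => trig_sum d L x + rc (d L) * expi (L%:R * x).
Proof. by apply/funext => x; rewrite /trig_sum big_ord_recr. Qed.

Lemma FL2inv_trig (d : nat -> R) L (g v : R -> C) : FL2inv g v ->
  FL2inv (fun x => trig_sum d L x * g x) (shift_sum d L v).
Proof.
move=> H; elim: L => [|L IH].
  have := FL2invZ 0 H.
  rewrite [X in FL2inv X](_ : _ = fun x => trig_sum d 0 x * g x); last first.
    by apply/funext => x; rewrite /trig_sum big_ord0; apply: complexP; rewrite !(Re_mul, Im_mul)/=; ring.
  rewrite [X in FL2inv _ X](_ : _ = shift_sum d 0 v)//.
  by apply/funext => x; rewrite /shift_sum big_ord0; apply: complexP; rewrite !(Re_mul, Im_mul)/=; ring.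
have := FL2invD IH (FL2invZ (d L) (FL2inv_shift L%:R H)).
rewrite shift_sumS (_ : (fun x => trig_sum d L.+1 x * g x) =
  fun x => trig_sum d L x * g x + rc (d L) * (expi (L%:R * x) * g x))//.
by apply/funext => x; rewrite trig_sumS mulrDl mulrA.
Qed.

Lemma cmeas_trig (d : nat -> R) L : cmeas (trig_sum d L).
Proof.
elim: L => [|L IH].
  by rewrite (_ : trig_sum d 0 = fun _ => 0); [exact: cmeas_cst|apply/funext => x; rewrite /trig_sum big_ord0].
rewrite trig_sumS; apply: cmeasD => //; apply: cmeasM; [exact: cmeas_cst|exact: cmeas_expi].
Qed.

Lemma Linf_trig (d : nat -> R) L : Linf (trig_sum d L).
Proof.
split; first exact: cmeas_trig.
exists (\sum_(k < L) `|d k|); apply: aeW => x; elim: L => [|L IH].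
  by rewrite /trig_sum !big_ord0 cabs0.
rewrite trig_sumS big_ord_recr /=; apply: le_trans (cabsD _ _) _; apply: lerD => //.
by rewrite cabsM cabs_rc cabs_expi mulr1.
Qed.

Lemma cutoff_sqnorm n (g : R -> C) : L2 g -> sqnorm (inv_cut n g) = (2 * pi)^-1 * sqnorm (cutoff n g).
Proof.
move=> g2; have [F2 FE] := plancherel_compact (cut_L2 n g2) (cut_supp n g).
rewrite /inv_cut sqnormZ; last exact: L2_opp.
rewrite {1}/sqnorm (Rintegral_opp (f := fun x => cabs (FS (cutoff n g) x) ^+ 2)); last exact: integrable_measurable (L2_intg F2).
rewrite -/(sqnorm _) FE; have : pi != 0 :> R by rewrite gt_eqF// pi_gt0.
by move: (pi : R) => P P0; field.
Qed.

Lemma FL2inv_norm (g v : R -> C) : FL2inv g v -> sqnorm v = (2 * pi)^-1 * sqnorm g.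
Proof.
move=> /FL2invP[g2 v2 H].
have H1 : sqnorm (inv_cut n g) @[n --> \oo] --> sqnorm v.
  apply: cvg_sqnorm => //; first by move=> n; exact: inv_cut_L2.
  suff E n : sqnorm (fun x => inv_cut n g x - v x) = sqnorm (fun x => v x - inv_cut n g x) by rewrite (funext E).
  by apply: eq_Rintegral => x _; rewrite -cabsN opprB.
have H2 : (2 * pi)^-1 * sqnorm (cutoff n g) @[n --> \oo] --> (2 * pi)^-1 * sqnorm g.
  by apply: cvgM; [exact: cvg_cst|exact: cvg_sqnorm (fun n => cut_L2 n g2) g2 (cvg_cut g2)].
rewrite (funext (fun n => cutoff_sqnorm n g2)) in H1.
exact: (cvg_unique _ H1 H2).
Qed.

Lemma sqnorm_mul_le (b g : R -> C) (M : R) : {ae mu, forall x, cabs (b x) <= M} ->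
  L2 g -> L2 (fun x => b x * g x) -> sqnorm (fun x => b x * g x) <= M ^+ 2 * sqnorm g.
Proof.
move=> bM g2 bg2; rewrite -lee_fin EFinM -!integral_sqnorm// -ge0_integralZl//; last 3 first.
- exact: (measurable_int _ (L2_intg g2)).
- by move=> x _; rewrite lee_fin sqr_ge0.
- by rewrite lee_fin sqr_ge0.
apply: ae_ge0_le_integral => //.
- by move=> x _; rewrite lee_fin sqr_ge0.
- exact: (measurable_int _ (L2_intg bg2)).
- by move=> x _; rewrite -EFinM lee_fin mulr_ge0 ?sqr_ge0.
- apply/measurable_EFinP; apply: measurable_funM => //; exact: (integrable_measurable (L2_intg g2)).
- apply: (ae_imp bM) => x bx _; rewrite -EFinM lee_fin cabsM exprMn ler_wpM2r ?sqr_ge0//.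
  by rewrite lerXn2r ?nnegrE ?cabs_ge0// (le_trans (cabs_ge0 _) bx).
Qed.

(** The pointwise inequality [a <= 1 + a^2] on a set of measure at most 1. *)
Lemma integral_cabs_le (E : set R) (v : R -> C) : measurable E -> (mu E <= 1)%E -> L2 v ->
  (\int[mu]_(x in E) (cabs (v x))%:E <= (1 + sqnorm v)%:E)%E.
Proof.
move=> mE E1 v2; have mv := cmeas_cabs v2.1.
apply: (@le_trans _ _ (\int[mu]_(x in E) (1%:E + (cabs (v x) ^+ 2)%:E))%E).
  apply: ge0_le_integral => //.
  - by move=> x _; rewrite lee_fin cabs_ge0.
  - by apply/measurable_EFinP; exact: measurable_funTS.
  - by apply: emeasurable_funD => //; apply/measurable_EFinP; apply: measurable_funTS; exact: measurable_funX.
  - by move=> x _; rewrite -EFinD lee_fin; have := sqr_ge0 (cabs (v x) - 1); nra.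
have m2 : measurable_fun setT (fun x => (cabs (v x) ^+ 2)%:E) by apply/measurable_EFinP; exact: measurable_funX.
rewrite ge0_integralD//; last 2 first.
- by move=> x _; rewrite lee_fin sqr_ge0.
- exact: measurable_funTS.
rewrite integral_cst// mul1e EFinD; apply: leeD => //.
rewrite -integral_sqnorm//; apply: ge0_subset_integral => //.
by move=> x _; rewrite lee_fin sqr_ge0.
Qed.

Section Weighted.
Variables (rho : (R -> \bar R) -> \bar R) (c : R) (w : R -> R).
Hypotheses (rhoN : banach_function_norm rho) (rhoT : translation_invariant rho) (c0 : 0 < c).
Hypotheses (w0 : forall x, 0 < w x)
  (wexp : forall x t : R, 0 <= t -> w x <= expR (- (c * t)) * w (x + t)).

Lemma eratio_le (x y : \bar R) (s : R) : (0 <= y)%E -> (y < +oo)%E -> y <> 0%E ->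
  (x <= s%:E * y)%E -> (eratio x y <= s%:E)%E.
Proof.
case: y => [y| |]//; rewrite lee_fin => y0 _ yn0 xs.
have yp : 0 < y by rewrite lt_def y0 andbT; apply/eqP => ye; apply: yn0; rewrite ye.
rewrite /eratio /=; apply: le_trans (lee_wpmul2r _ xs) _; first by rewrite lee_fin invr_ge0.
by rewrite -!EFinM lee_fin mulfK ?gt_eqF.
Qed.

(** The numerator is an infimum over all functions that represent the image of [u]; the shift sum is
    one of them, by Fourier inversion. *)
Lemma M0Z_trig_le (d : nat -> R) L : (M0Z_norm rho w (trig_sum d L) <= (coef_norm c d L)%:E)%E.
Proof.
apply: ge_ereal_sup => _ [u [u2 [[mu_ fu] un0]] <-].
have u0 := wnorm_ge0 rhoN c0 w0 wexp u2.1.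
apply: eratio_le => //.
have [g Hg] := FL2_exists u2.
apply: le_trans (wnorm_shift_sum rhoN rhoT c0 w0 wexp d L u2.1 fu).
apply: ereal_inf_lbound; exists (shift_sum d L u) => //=.
by exists g; split => //; apply: FL2inv_trig; exact: FL2_inversion.
Qed.

Lemma trig_cauchy (e : R) : 0 < e -> exists N, forall n m, (N <= n)%N -> (N <= m)%N ->
  (M0Z_norm rho w (fun x => (trig_sum (ecoef c) n x - trig_sum (ecoef c) m x)%R) < e%:E)%E.
Proof.
move=> e0; have [K HK] := dcoef_small c0 e0; exists K => n m Kn Km.
rewrite (_ : (fun x => _) = trig_sum (dcoef c n m) (maxn n m)); last first.
  by apply/funext => x; exact: (ecoef_diff c (fun k => expi (k%:R * x))).
by apply: le_lt_trans (M0Z_trig_le _ _) _; rewrite lte_fin HK.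
Qed.

Lemma cvg0_eventually_lt (v : nat -> \bar R) (e : R) (k : nat) : 0 < e -> v n @[n --> \oo] --> 0%E ->
  exists n, (k < n)%N /\ (v n < e%:E)%E.
Proof.
move=> e0 /fine_cvgP[vf /cvgr_lt/(_ _ e0) ve].
have [n [kn [nf ne]]] : exists n, (k < n)%N /\ (v n \is a fin_num /\ fine (v n) < e).
  by near \oo => n; exists n; split; [near: n; exact: nbhs_infty_gt|split; near: n].
by exists n; split => //; rewrite -(fineK nf) lte_fin.
Unshelve. all: by end_near.
Qed.

(** Extracts from a strict bound on the multiplier quotient an actual function of small norm.
    Dividing by [fine y] in the hypothesis leaves the plain bound [e] on its norm. *)
Lemma eratio_lt_inf (S : set \bar R) (y : \bar R) (e : R) : (0 < y)%E -> (y < +oo)%E ->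
  (eratio (ereal_inf S) y < (e / fine y)%:E)%E -> exists2 z, S z & (z < e%:E)%E.
Proof.
case: y => [y| |]//; rewrite lte_fin => y0 _ /=; rewrite /eratio /= => H.
apply: ereal_inf_lt; move: H; rewrite EFinM lte_pmul2r// lte_fin.
by rewrite invr_gt0.
Qed.

Definition indic01 (x : R) : C := rc (\1_(`[0, 1[%classic) x).

Lemma cmeas_indic01 : cmeas indic01.
Proof. by apply: cmeas_rc; exact: measurable_indic. Qed.

Lemma cabs_ind x : cabs (indic01 x) = \1_(`[0, 1[%classic) x.
Proof. by rewrite cabs_rc ger0_norm. Qed.

Lemma L2_indic01 : L2 indic01.
Proof.
split; first exact: cmeas_indic01.
under eq_integral do rewrite cabs_ind.
have E x : (\1_(`[0, 1[%classic) x : R) ^+ 2 = \1_(`[0, 1[%classic) x.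
  by rewrite indicE; case: (_ \in _); rewrite ?expr1n ?expr0n.
under eq_integral do rewrite E.
rewrite integral_indic// setIT; apply: (@le_lt_trans _ _ (mu `[0, 1]%classic)).
  by apply: le_measure; rewrite ?inE//; apply: subset_itv_co_cc.
by rewrite lebesgue_measure_itv/= lte_fin ltr01 sube0 ltry.
Qed.

Lemma memZ_indic01 : memZ rho w indic01.
Proof.
have mw := cmeas_weight c0 w0 wexp cmeas_indic01; split => //.
have wnd := weight_nondecreasing c0 w0 wexp.
case: (rhoN) => [[_ [A1 _]] _ _ A4 _].
have E01 : (mu `[0%R, 1%R[%classic < +oo)%E.
  by rewrite lebesgue_measure_itv/= lte_fin ltr01 sube0 ltry.
have M1 : Mplus (fun x => (\1_(`[0, 1[%classic) x : R)%:E).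
  by split; [apply/measurable_EFinP; exact: measurable_indic|move=> x; rewrite lee_fin].
apply: (@le_lt_trans _ _ (rho (fun x => (w 1)%:E * (\1_(`[0, 1[%classic) x : R)%:E)%E)).
  apply: rho_le => //; last first.
  - move=> x; rewrite /cabsE cabsM cabs_ind cabs_rc gtr0_norm// -EFinM lee_fin mulrC.
    rewrite indicE; have [x01|] := boolP (x \in _); last by rewrite !mulr0.
    by rewrite !mulr1 wnd//; move: x01; rewrite inE/= in_itv/= => /andP[_ /ltW].
  - exact: Mplus_cabsE.
  - split; first by apply/measurable_EFinP; apply: measurable_funM => //; exact: measurable_indic.
    by move=> x; rewrite -EFinM lee_fin mulr_ge0// ltW.
rewrite A1 ?(ltW (w0 _))//.
have := A4 _ (measurable_itv _) E01; have := rho_ge0 rhoN M1.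
by case: (rho _) => // r _ _; rewrite -EFinM ltry.
Qed.

Lemma wnorm_indic01_neq0 : wnorm rho w indic01 <> 0%E.
Proof.
case: (rhoN) => [[A1 _] _ _ _ _] /A1 -/(_ (Mplus_cabsE (cmeas_weight c0 w0 wexp cmeas_indic01))).
move=> [Z [mZ Z0 HZ]].
have : (mu `[0%R, 1%R[%classic <= mu Z)%E.
  apply: le_measure; rewrite ?inE// => x x01; apply: HZ => /= /eqP.
  rewrite /cabsE cabsM cabs_ind cabs_rc indicE mem_set//= mul1r gtr0_norm// eqe.
  by rewrite gt_eqF.
by rewrite Z0 lebesgue_measure_itv/= lte_fin ltr01 sube0 lee_fin ler10.
Qed.

Lemma itv01_disjoint (x : R) (i k : nat) : 0 <= x + k%:R < 1 -> 0 <= x + i%:R < 1 -> i = k.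
Proof.
move=> /andP[a b] /andP[d e]; case: (ltngtP i k) => // h; exfalso.
  have : (i.+1%:R <= k%:R :> R) by rewrite ler_nat.
  by rewrite -natr1; lra.
have : (k.+1%:R <= i%:R :> R) by rewrite ler_nat.
by rewrite -natr1; lra.
Qed.

Lemma shift_sum_ind n k x : (k < n)%N -> 0 <= x + k%:R < 1 ->
  cabs (shift_sum (ecoef c) n indic01 x) = ecoef c k.
Proof.
move=> kn xk; rewrite /shift_sum (bigD1 (Ordinal kn))//= big1 => [|i ik].
  by rewrite addr0 cabsM cabs_rc cabs_ind indicE mem_set ?mulr1 ?gtr0_norm ?expR_gt0.
rewrite /indic01 indicE memNset ?mulr0//= in_itv/= => /(itv01_disjoint xk) E.
by case/negP: ik; apply/eqP/val_inj.
Qed.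

Lemma not_M0Z_complete : ~ M0Z_complete rho w.
Proof.
move=> /(_ (trig_sum (ecoef c))) [].
- move=> n; split; first exact: Linf_trig.
  by apply: le_lt_trans (M0Z_trig_le _ _) _; exact: ltry.
- exact: trig_cauchy.
move=> b [[[mb [M bM]] _] Hb].
have i2 := L2_indic01; have [_ fi] := memZ_indic01; have ni := wnorm_indic01_neq0.
have yp : (0 < wnorm rho w indic01)%E.
  by rewrite lt_def (wnorm_ge0 rhoN c0 w0 wexp cmeas_indic01) andbT; apply/eqP.
pose S := sqnorm indic01.
(* The threshold is what the window can hold: 1 for the small part [v'], and [1 + M^2 S] for
   [v - v'] through [integral_cabs_le]. The witness relies on [exp y >= 1 + y]. *)
have [k Hk] : exists k, 2 + M ^+ 2 * S < ecoef c k.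
  pose T := 2 + M ^+ 2 * S.
  have T0 : 0 <= T * 2 / c.
    by rewrite divr_ge0 ?(ltW c0)// mulr_ge0// addr_ge0// mulr_ge0 ?sqr_ge0 ?sqnorm_ge0.
  exists (Num.bound (T * 2 / c)); apply: lt_le_trans (expR_ge1Dx _).
  have := archi_boundP T0; rewrite ltr_pdivrMr// mulrC -/T; lra.
pose E : set R := `[- k%:R, - k%:R + 1[%classic.
have mE : measurable E := measurable_itv _.
have E1 : mu E = 1%E.
  by rewrite lebesgue_measure_itv/= lte_fin ltrDl ltr01 -EFinB; congr (_%:E); ring.
have Ey : (mu E < +oo)%E by rewrite E1 ltry.
have Ea x : E x -> - k%:R <= x by rewrite /E /= in_itv/= => /andP[].
have [B [B0 HB]] := local_bound rhoN c0 w0 wexp mE Ey Ea.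
(* This makes [B * e] at most 1, so [v'] has integral at most 1 over the window. The index [n] is
   taken above [k] so that the shift by [k] occurs in the sum. *)
pose e := (B + 1)^-1.
have B1 : 0 < B + 1 by rewrite ltr_pwDr.
have yf : 0 < fine (wnorm rho w indic01) by rewrite fine_gt0// yp.
have ey : 0 < e / fine (wnorm rho w indic01) by rewrite divr_gt0// invr_gt0.
have [n [kn Hn]] := cvg0_eventually_lt k ey Hb.
have H : (eratio (ereal_inf [set wnorm rho w v |
     v in [set v | exists g, FL2 indic01 g /\ FL2inv (fun x => (trig_sum (ecoef c) n x - b x) * g x)%R v]])
      (wnorm rho w indic01) < (e / fine (wnorm rho w indic01))%:E)%E.
  apply: le_lt_trans Hn; apply: ereal_sup_ubound; exists indic01 => //=.
  by split => //; split => //; exact: memZ_indic01.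
have [_ [v' [g [ug gv']] <-] wv'] := eratio_lt_inf yp fi H.
have gv := FL2inv_trig (ecoef c) n (FL2_inversion ug).
(* Since [a_n - (a_n - b) = b], the function [v - v'] is the image of the indicator under [b], and
   its L2 norm is bounded independently of [k] and [n]. *)
have := FL2invB gv gv'.
rewrite (_ : (fun x => _ - _) = fun x => b x * g x); last first.
  by apply/funext => x; ring.
set v := shift_sum _ _ _ => Hd.
have [g2 _] := ug.2; have [bg2 [d2 _]] := Hd.
have sd : sqnorm (fun x => v x - v' x) <= M ^+ 2 * S.
  rewrite (FL2inv_norm Hd) ler_pdivrMl ?mulr_gt0 ?pi_gt0//.
  by apply: le_trans (sqnorm_mul_le bM g2 bg2) _; rewrite (FL2_norm ug) mulrCA.
have v'2 : L2 v' := gv'.2.1.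
have md := cmeas_cabs d2.1; have mv' := cmeas_cabs v'2.1.
have L1 : ((ecoef c k)%:E <= \int[mu]_(x in E) (cabs (v x))%:E)%E.
  rewrite (eq_integral (cst (ecoef c k)%:E)); first
    by rewrite (etrans (integral_cst mu mE _) (etrans (congr1 (mule _) E1) (mule1 _))).
  by move=> x; rewrite inE /E/= in_itv/= => xE; rewrite /v (shift_sum_ind kn)//; lra.
have L3 : (\int[mu]_(x in E) (cabs (v' x))%:E <= 1%:E)%E.
  apply: le_trans (HB _ v'2.1 (lt_trans wv' (ltry _))) _.
  apply: (@le_trans _ _ (B%:E * e%:E)%E); first by apply: lee_wpmul2l; rewrite ?lee_fin// ltW.
  by rewrite -EFinM lee_fin ler_pdivrMr// mul1r lerDl.
have L2' : (\int[mu]_(x in E) (cabs (v x))%:E <=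
   \int[mu]_(x in E) (cabs (v x - v' x)%R)%:E + \int[mu]_(x in E) (cabs (v' x))%:E)%E.
  rewrite -ge0_integralD//; last 4 first.
  - by move=> x _; rewrite lee_fin cabs_ge0.
  - by apply/measurable_EFinP; exact: measurable_funTS.
  - by move=> x _; rewrite lee_fin cabs_ge0.
  - by apply/measurable_EFinP; exact: measurable_funTS.
  apply: ge0_le_integral => //.
  - by move=> x _; rewrite lee_fin cabs_ge0.
  - by apply/measurable_EFinP; apply: measurable_funTS; exact: (cmeas_cabs gv.2.1.1).
  - by apply: emeasurable_funD; apply/measurable_EFinP; exact: measurable_funTS.
  - move=> x _; rewrite -EFinD lee_fin; apply: le_trans (cabsD _ _).
    by rewrite subrK.
have := le_trans L1 (le_trans L2' (leeD (integral_cabs_le mE _ d2) L3)).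
rewrite E1 lexx => /(_ isT); rewrite -EFinD lee_fin; move: Hk sd; lra.
Qed.

End Weighted.
End NotCompleteM0.

(** * Parseval's identity for functions in L1 and L2 *)

Section Parseval.
Variable R : realType.
Local Notation mu := (@lebesgue_measure R).
Local Notation C := (R[i]).
Local Notation intg f := (mu.-integrable setT (EFin \o f)).

Definition L12 (f : R -> C) := cintegrable f /\ L2 f.

Lemma cabs_cut n (u : R -> C) x : cabs (cutoff n u x - u x) <= cabs (u x).
Proof.
rewrite /cutoff indicE; case: (_ \in _); first by rewrite mul1r subrr cabs0 cabs_ge0.
by rewrite (_ : rc _ = 0)// mul0r sub0r cabsN.
Qed.

Lemma cmeas_cut n (u : R -> C) : cmeas u -> cmeas (cutoff n u).
Proof.
by move=> m; apply: cmeasM => //; split; [exact: measurable_indic|exact: measurable_cst].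
Qed.

Lemma cintegrableB (f g : R -> C) : cintegrable f -> cintegrable g -> cintegrable (fun x => f x - g x).
Proof.
move=> fi gi; under eq_fun do rewrite -mulN1r.
by apply: cintegrableD => //; exact: cintegrableZ.
Qed.

Lemma FS_B (v u : R -> C) xi : cintegrable v -> cintegrable u ->
  FS (fun x => v x - u x) xi = FS v xi - FS u xi.
Proof.
move=> vi ui; rewrite (_ : (fun x => v x - u x) = fun x => v x + -1 * u x).
  by rewrite FS_D ?FS_Z ?mulN1r//; exact: cintegrableZ.
by apply/funext => x; rewrite mulN1r.
Qed.

Lemma cintegrable_cut n (u : R -> C) : cintegrable u -> cintegrable (cutoff n u).
Proof.
move=> ui; have mu_ := cintegrable_cmeas ui.
apply: (cintegrable_le (g := fun x => cabs (u x))); first exact: cmeas_cut.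
  move=> x; rewrite /cutoff cabsM cabs_rc ler_piMl ?cabs_ge0// indicE.
  by case: (_ \in _); rewrite ?normr1 ?normr0.
exact: cintegrable_cabs.
Qed.

Lemma cvg_cut_L1 (u : R -> C) : cintegrable u ->
  \int[mu]_x cabs (cutoff n u x - u x) @[n --> \oo] --> (0 : R).
Proof.
move=> ui; rewrite -[X in _ --> X](_ : \int[mu]_x (0 : R) = 0); last by rewrite Rintegral_cst// mul0r.
have mu_ := cintegrable_cmeas ui.
apply: (Rintegral_dominated (g := fun x => cabs (u x))).
- by move=> n; apply: cmeas_cabs; apply: cmeasB => //; exact: cmeas_cut.
- move=> x; apply: (@cvg_near_cst _ _ _ _ _).
  near=> n; rewrite /cutoff indicE mem_set/= ?mul1r ?subrr ?cabs0//.
  rewrite in_itv/= -ler_norml; near: n; exact: nbhs_infty_ger.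
- exact: cintegrable_cabs.
- by move=> n x; rewrite ger0_norm ?cabs_ge0// cabs_cut.
Unshelve. all: by end_near. Qed.

Lemma cvg_FS_cut (u : R -> C) xi : cintegrable u ->
  cabs (FS (cutoff n u) xi - FS u xi) @[n --> \oo] --> (0 : R).
Proof.
move=> ui.
have H : 2 * \int[mu]_x cabs (cutoff n u x - u x) @[n --> \oo] --> (0 : R).
  by rewrite -[X in _ --> X](mulr0 2); apply: cvgM; [exact: cvg_cst|exact: cvg_cut_L1].
apply: (squeeze_cvgr _ (cvg_cst (0 : R)) H); apply: nearW => n; apply/andP; split; first exact: cabs_ge0.
have ci := cintegrable_cut n ui.
rewrite -FS_B// FS_ext; apply: le_trans (cabs_cint (FS_integrand xi (cintegrableB ci ui))) _.
rewrite le_eqVlt; apply/orP; left; apply/eqP; congr (2 * _); apply: eq_Rintegral => x _.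
by rewrite cabsM cabs_expi mulr1.
Qed.

Lemma cmeas_FS (u : R -> C) : cintegrable u -> cmeas (FS u).
Proof.
move=> ui; have := cintegrable_cmeas ui => -[m1 m2].
have E xi := FS_cosT xi ui.1 ui.2.
split; under eq_fun do rewrite E /=.
  by apply: measurable_funD; [exact: measurable_cosT|exact: measurable_sinT].
by apply: measurable_funB; [exact: measurable_cosT|exact: measurable_sinT].
Qed.

(** The transforms of the cutoffs converge to the integral transform at every point because [u] is
    in L1, and to the L2 transform [g] in norm because [u] is in L2. Fatou's lemma bounds the
    distance of the two limits by every positive number. *)
Lemma FS_plancherel (u : R -> C) : L12 u -> L2 (FS u) /\ sqnorm (FS u) = 2 * pi * sqnorm u.
Proof.
move=> [ui u2]; have [g ug] := FL2_exists u2; have [_ g2 H] := (FL2P _ _).1 ug.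
pose F n := FS (cutoff n u).
have F2 n : L2 (F n) := (plancherel_compact (cut_L2 n u2) (cut_supp n u)).1.
have mD : cmeas (fun x => FS u x - g x) by apply: cmeasB; [exact: cmeas_FS|exact: g2.1].
have small (e : R) : 0 < e -> (\int[mu]_x (cabs (FS u x - g x) ^+ 2)%:E <= e%:E)%E.
  move=> e0; apply: (@fatou_ae _ (fun n x => cabs (F n x - g x) ^+ 2)).
  - by move=> n; exact: (integrable_measurable (L2_intg (L2B (F2 n) g2))).
  - by apply: measurable_funX; exact: cmeas_cabs.
  - by move=> n x; exact: sqr_ge0.
  - by move=> x; exact: sqr_ge0.
  - apply: aeW => x; have E (h : nat -> R) (l : R) : h n @[n --> \oo] --> l -> h n ^+ 2 @[n --> \oo] --> l ^+ 2.
      by move=> hl; rewrite expr2; under eq_fun do rewrite expr2; exact: cvgM.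
    apply: E; apply/subr_cvg0; apply: norm_cvg0.
    apply: (squeeze_cvgr _ (cvg_cst (0 : R)) (cvg_FS_cut x ui)); apply: nearW => n; apply/andP; split; first exact: normr_ge0.
    rewrite ler_norml; apply/andP; split.
      rewrite lerNl opprB lerBlDr -(cabsN (F n x - FS u x)) opprB.
      apply: le_trans (cabsD _ _); rewrite le_eqVlt; apply/orP; left; apply/eqP; congr cabs; ring.
    rewrite lerBlDr.
    apply: le_trans (cabsD _ _); rewrite le_eqVlt; apply/orP; left; apply/eqP; congr cabs; rewrite /F; ring.
  - have /cvgrPdist_lt/(_ _ e0) := H; apply: filterS => n.
    rewrite sub0r normrN ger0_norm ?sqnorm_ge0// => /ltW.
    by rewrite -lee_fin -(integral_sqnorm (L2B (F2 n) g2)).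
have D2 : L2 (fun x => FS u x - g x) by split => //; exact: le_lt_trans (small 1 ltr01) (ltry _).
have D0 : sqnorm (fun x => FS u x - g x) = 0.
  apply/eqP; rewrite eq_le sqnorm_ge0 andbT; apply/ler_addgt0Pl => e e0.
  by rewrite addr0 -lee_fin -integral_sqnorm// small.
have G2 : L2 (FS u).
  rewrite (_ : FS u = fun x => (FS u x - g x) + g x); first exact: L2D.
  by apply/funext => x; rewrite subrK.
split => //; rewrite -(FL2_norm ug).
have K : sqnorm (fun x => FS u x - g x) @[n --> \oo] --> (0 : R) by rewrite D0; exact: cvg_cst.
have := @cvg_sqnorm _ (fun=> FS u) g (fun=> G2) g2 K => K1.
exact: (cvg_unique _ (cvg_cst _) K1).
Qed.

(** Polarisation: Plancherel's identity for [u], [v] and [u - v]. *)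
Lemma parseval (u v : R -> C) : L12 u -> L12 v -> rip (FS u) (FS v) = 2 * pi * rip u v.
Proof.
move=> [ui u2] [vi v2].
have [U2 UE] := FS_plancherel (conj ui u2); have [V2 VE] := FS_plancherel (conj vi v2).
have [_] := FS_plancherel (conj (cintegrableB ui vi) (L2B u2 v2)).
rewrite (_ : FS (fun x => u x - v x) = fun xi => FS u xi - FS v xi); last first.
  by apply/funext => xi; exact: FS_B.
rewrite (sqnormB U2 V2) (sqnormB u2 v2) UE VE; clear.
move: (sqnorm u) (sqnorm v) (rip u v) (rip _ _) (2 * pi) => a b r s P; lra.
Qed.

Lemma L2_cintegrableM (f g : R -> C) : L2 f -> L2 g -> cintegrable (fun x => f x * g x).
Proof.
move=> f2 g2; have [fr fi] := f2.1; have [gr gi] := g2.1.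
have rr := intgM_sqr fr gr (L2_re f2) (L2_re g2); have ii := intgM_sqr fi gi (L2_im f2) (L2_im g2).
have ri := intgM_sqr fr gi (L2_re f2) (L2_im g2); have ir := intgM_sqr fi gr (L2_im f2) (L2_re g2).
split.
  by under eq_fun do rewrite Re_mul; exact: intgB.
by under eq_fun do rewrite Im_mul; exact: intgD.
Qed.

Let conjc (z : C) : C := Complex (complex.Re z) (- complex.Im z).

Lemma conjcM z w : conjc (z * w) = conjc z * conjc w.
Proof.
rewrite /conjc; apply: complexP => /=; rewrite !(Re_mul, Im_mul)/=; ring.
Qed.

Lemma conjc_expi t : conjc (expi t) = expi (- t).
Proof. by rewrite /expi cosN sinN. Qed.

Lemma cabs_conjc z : cabs (conjc z) = cabs z.
Proof. by rewrite /cabs; case: z => a b; rewrite /conjc/= /ComplexField.Normc.normc sqrrN. Qed.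

Lemma cmeas_conjc f : cmeas f -> cmeas (fun x => conjc (f x)).
Proof. by move=> [m1 m2]; split => //=; exact: measurable_funN. Qed.

Lemma cint_conjc (f : R -> C) : cintegrable f -> cint setT (fun x => conjc (f x)) = conjc (cint setT f).
Proof.
move=> [i1 i2]; rewrite /cint /conjc/=; congr Complex.
by rewrite -[RHS]mulN1r -(RintegralZl _ measurableT i2); apply: eq_Rintegral => x _; rewrite mulN1r.
Qed.

Lemma L12_conjc_shift (k : R) (f : R -> C) : L12 f -> L12 (fun x => conjc (f (x - k))).
Proof.
move=> [fi f2]; have [m0 f0] := L2_shift (- k) f2.
have m1 := cmeas_conjc m0; split.
  apply: (cintegrable_le (g := fun x => cabs (f (x - k)))) => //.
    by move=> x; rewrite cabs_conjc.
  by have := integrable_shift (- k) (cintegrable_cabs fi).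
by split => //; under eq_integral do rewrite cabs_conjc.
Qed.

Lemma FS_conjc_shift (k : R) (f : R -> C) xi : cintegrable f ->
  FS (fun x => conjc (f (x - k))) xi = rc (2 * pi) * conjc (FSinv f xi * expi (k * xi)).
Proof.
move=> fi; have fe : cintegrable (fun x => f x * expi (xi * x)).
  by apply: (cintegrableM (B := 1)) => //; [exact: cmeas_expi|move=> x; rewrite cabs_expi].
rewrite FS_ext -(cint_shift k); last first.
  apply: cmeasM; last exact: cmeas_expi.
  by apply: cmeas_conjc; apply: (cmeas_shift (- k)); exact: cintegrable_cmeas.
rewrite /FSinv conjcM conjc_expi conjcM -cint_conjc; last exact: fe.
rewrite -[conjc _ * _ * _]mulrA mulrA (_ : rc (2 * pi) * conjc (rc (2 * pi)^-1) = 1); last first.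
  have p0 : 2 * pi != 0 :> R by rewrite mulf_neq0// gt_eqF// pi_gt0.
  by apply: complexP; rewrite !(Re_mul, Im_mul)/= oppr0 ?mul0r ?mulr0 ?subr0 ?addr0// divff.
rewrite mul1r [RHS]mulrC -cintZ; last first.
  apply: cintegrable_le (cintegrable_cabs fi).
    apply: cmeas_conjc; apply: cmeasM; first exact: cintegrable_cmeas.
    exact: cmeas_expi.
  by move=> x; rewrite cabs_conjc cabsM cabs_expi mulr1.
apply: eq_cint => x; rewrite addrK conjcM conjc_expi [RHS]mulrCA -expiD.
by congr (_ * expi _); ring.
Qed.

(** The left side is bilinear in the transforms, whereas Parseval's identity conjugates one factor;
    so it is applied to [h], the conjugate of [f] shifted by [k], whose transform is [2 pi] times
    the conjugate of [FSinv f xi * expi (k * xi)]. As [rip] sees only real parts, the imaginary part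
    is obtained from [i h]. *)
Lemma cint_FS_mul (u f : R -> C) (k : R) : L12 u -> L12 f ->
  cint setT (fun xi => FS u xi * FSinv f xi * expi (k * xi)) = cint setT (fun x => u (x + k) * f x).
Proof.
move=> u12 f12; have h12 := L12_conjc_shift k f12.
set h := (fun x => conjc (f (x - k))) in h12.
have ih12 : L12 (fun x => Complex 0 1 * h x).
  split; first by apply: cintegrableZ; exact: h12.1.
  split; first by apply: cmeasM; [exact: cmeas_cst|exact: h12.2.1].
  have E x : cabs (Complex 0 1 * h x) = cabs (h x).
    rewrite cabsM (_ : cabs _ = 1) ?mul1r//.
    by rewrite /cabs/= /ComplexField.Normc.normc expr0n/= add0r expr1n sqrtr1.
  by under eq_integral do rewrite E; exact: h12.2.2.
have p0 : 2 * pi != 0 :> R by rewrite mulf_neq0// gt_eqF// pi_gt0.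
have S1 := parseval u12 h12; have S2 := parseval u12 ih12.
have E xi : FS h xi = rc (2 * pi) * conjc (FSinv f xi * expi (k * xi)).
  exact: FS_conjc_shift f12.1.
have mf : cmeas (fun x => u (x + k) * f x).
  by apply: cmeasM; [exact: (cmeas_shift k u12.2.1)|exact: f12.2.1].
rewrite -(cint_shift (- k) mf).
have Re_cint g : complex.Re (cint setT g) = \int[mu]_x complex.Re (g x) by [].
have Im_cint g : complex.Im (cint setT g) = \int[mu]_x complex.Im (g x) by [].
apply: complexP; rewrite ?Re_cint ?Im_cint.
  transitivity ((2 * pi)^-1 * rip (FS u) (FS h)).
    rewrite /rip -(RintegralZl _ measurableT (rip_intg (FS_plancherel u12).1 (FS_plancherel h12).1)).
    apply: eq_Rintegral => x _; rewrite E -[FS u x * _ * _]mulrA.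
    move: (2 * pi) p0 (FSinv f x * _) (FS u x) => P p0 [a b] [d e].
    by rewrite !(Re_mul, Im_mul)/=; field.
  rewrite S1 mulrA mulVf// mul1r; apply: eq_Rintegral => x _.
  by rewrite /h subrK Re_mul/=; ring.
transitivity ((2 * pi)^-1 * rip (FS u) (FS (fun x => Complex 0 1 * h x))).
  rewrite /rip -(RintegralZl _ measurableT (rip_intg (FS_plancherel u12).1 (FS_plancherel ih12).1)).
  apply: eq_Rintegral => x _; rewrite FS_Z; last exact: h12.1.
  rewrite E -[FS u x * _ * _]mulrA.
  move: (2 * pi) p0 (FSinv f x * _) (FS u x) => P p0 [a b] [d e].
  by rewrite !(Re_mul, Im_mul)/=; field.
rewrite S2 mulrA mulVf// mul1r; apply: eq_Rintegral => x _.
by rewrite /h subrK !(Re_mul, Im_mul)/=; ring.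
Qed.

End Parseval.

(** * Smooth functions and a bump function *)

Section SmoothFunctions.
Variable R : realType.
Implicit Types f g : R -> R.

(** Recursion passes to the derivative of [f] instead of iterating derivatives, so that sum and
    product rules are proved by an induction quantified over all functions. *)
Fixpoint smooth_upto (k : nat) f : Prop :=
  if k is k'.+1 then (forall x, derivable f x 1) /\ smooth_upto k' (derive1 f) else True.
Definition smooth f := forall k, smooth_upto k f.

Lemma is_derive_fun f f' : (forall x, is_derive x (1 : R) f (f' x)) ->
  (forall x, derivable f x 1) /\ (derive1 f) = f'.
Proof.
move=> H; split => [x|]; first exact: ex_derive.
by apply/funext => x; rewrite derive1E derive_val.
Qed.

Lemma derivable_is_derive f x : derivable f x 1 -> is_derive x (1 : R) f ((derive1 f) x).
Proof. by move=> /derivableP; rewrite derive1E. Qed.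

Lemma smooth_upto_leS k f : smooth_upto k.+1 f -> smooth_upto k f.
Proof. by elim: k f => [//|k IH] f [d s]; split => //; exact: IH. Qed.

Lemma smooth_uptoS k f f' : (forall x, is_derive x (1 : R) f (f' x)) -> smooth_upto k f' -> smooth_upto k.+1 f.
Proof. by move=> /is_derive_fun[d e] s; split => //; rewrite e. Qed.

Lemma smooth_derivable f x : smooth f -> derivable f x 1.
Proof. by move=> /(_ 1)[]. Qed.

Lemma smooth_derive1 f : smooth f -> smooth (derive1 f).
Proof. by move=> s k; have [] := s k.+1. Qed.

Lemma smooth_derive1n n f : smooth f -> smooth (derive1n n f).
Proof. by move=> s; elim: n => [|n IH] //; rewrite derive1nS; exact: smooth_derive1. Qed.

Lemma smooth_uptoD k f g : smooth_upto k f -> smooth_upto k g -> smooth_upto k (fun x => f x + g x).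
Proof.
elim: k f g => [//|k IH] f g [fd fs] [gd gs].
apply: (@smooth_uptoS _ _ (fun x => (derive1 f) x + (derive1 g) x)); last exact: IH.
by move=> x; apply: is_deriveD; exact: derivable_is_derive.
Qed.

Lemma smooth_uptoM k f g : smooth_upto k f -> smooth_upto k g -> smooth_upto k (fun x => f x * g x).
Proof.
elim: k f g => [//|k IH] f g; move=> sf sg; have sf' := smooth_upto_leS sf; have sg' := smooth_upto_leS sg.
case: sf sg => fd fs [gd gs].
apply: (@smooth_uptoS _ _ (fun x => f x * (derive1 g) x + g x * (derive1 f) x)).
  by move=> x; apply: is_deriveM; exact: derivable_is_derive.
by apply: smooth_uptoD; apply: IH.
Qed.

Lemma smooth_upto_cst k (a : R) : smooth_upto k (fun=> a).
Proof.
by elim: k a => [//|k IH] a; apply: (@smooth_uptoS _ _ (fun=> 0)).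
Qed.

Lemma smooth_id : smooth id.
Proof.
by case=> [//|k]; apply: (@smooth_uptoS _ _ (fun=> 1)); exact: smooth_upto_cst.
Qed.

Lemma smooth_upto_affine k f (a b : R) : smooth_upto k f -> smooth_upto k (fun x => f (a * x + b)).
Proof.
elim: k f => [//|k IH] f [fd fs].
apply: (@smooth_uptoS _ _ (fun x => a * (derive1 f) (a * x + b))).
  move=> x; rewrite mulrC; apply: (@is_derive1_comp _ f (fun x => a * x + b)).
    exact: derivable_is_derive.
  have H : is_derive x 1 (fun y : R => a * y + b) (a * 1 + 0).
    exact: is_deriveD (is_deriveZ a (is_derive_id x 1)) (is_derive_cst b x 1).
  by rewrite mulr1 addr0 in H.
by apply: smooth_uptoM; [exact: smooth_upto_cst|exact: IH].
Qed.

(** The inequality [y <= exp y] at [y = t / (m + 1)] is raised to the power [m]; the denominator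
    [m + 1] avoids a division by zero for [m = 0]. *)
Lemma exp_monomial_le (m : nat) (t : R) : 0 <= t -> t ^+ m <= m.+1%:R ^+ m * expR t.
Proof.
move=> t0; have m0 : 0 < m.+1%:R :> R by rewrite ltr0Sn.
have H : t / m.+1%:R <= expR (t / m.+1%:R).
  by apply: le_trans (expR_ge1Dx _); rewrite lerDr.
have t1 : 0 <= t / m.+1%:R by rewrite divr_ge0// ltW.
rewrite mulrC -ler_pdivrMr ?exprn_gt0// -expr_div_n.
apply: (@le_trans _ _ (expR (t / m.+1%:R) ^+ m)); first by rewrite lerXn2r ?nnegrE ?expR_ge0.
by rewrite -expRM_natl ler_expR mulrA ler_pdivrMr// mulrC ler_wpM2l// ler_nat.
Qed.

(** The function [exp(-1/x)], extended by zero, with the powers of [1/x] that its derivatives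
    produce: the linear span of this family is closed under differentiation. *)
Definition expinv (m : nat) (x : R) : R := if 0 < x then x^-1 ^+ m * expR (- x^-1) else 0.

Lemma expinv_ge0 m x : 0 <= expinv m x.
Proof. by rewrite /expinv; case: ifP => // x0; rewrite mulr_ge0 ?expR_ge0// exprn_ge0// invr_ge0 ltW. Qed.

Lemma expinv_gt0 m x : 0 < x -> 0 < expinv m x.
Proof. by move=> x0; rewrite /expinv x0 mulr_gt0 ?expR_gt0// exprn_gt0// invr_gt0. Qed.

Lemma expinv_le m x : expinv m x <= m.+1%:R ^+ m.
Proof.
rewrite /expinv; case: ifP => [x0|_]; last by rewrite exprn_ge0.
by rewrite expRN ler_pdivrMr ?expR_gt0// exp_monomial_le// invr_ge0 ltW.
Qed.

Lemma expinv_sqr m x : expinv m x = x ^+ 2 * expinv m.+2 x.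
Proof.
rewrite /expinv; case: ifP => [x0|]; last by rewrite mulr0.
rewrite -[m.+2]addn2 exprD; have := lt0r_neq0 x0.
by move: (x^-1 ^+ m) (expR _) => a e xn; field.
Qed.

Lemma is_derive_sqr_bound f (K : R) : (forall x, `|f x| <= K * x ^+ 2) -> is_derive 0 (1 : R) f 0.
Proof.
move=> fK; have f0 : f 0 = 0 by apply/eqP; rewrite -normr_le0; have := fK 0; rewrite expr0n/= mulr0.
have H : h^-1 *: ((f \o shift 0) (h *: 1) - f 0) @[h --> 0^'] --> (0 : R).
  apply: norm_cvg0; apply: (@squeeze_cvgr _ _ _ _ (fun=> 0) (fun h : R => K * `|h|)).
  - near=> h; rewrite normr_ge0/= f0 subr0 /shift/= addr0 /GRing.scale/= mulr1.
    have h0 : h != 0 by near: h; exact: nbhs_dnbhs_neq.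
    rewrite normrM normfV mulrC ler_pdivrMr ?normr_gt0//; apply: le_trans (fK h) _.
    by rewrite -mulrA -expr2 real_normK ?num_real.
  - exact: cvg_cst.
  - rewrite -[X in _ --> X](mulr0 K); apply: cvgM; first exact: cvg_cst.
    have : `|h| @[h --> (0 : R)] --> `|0 : R| by apply: cvg_norm; exact: cvg_id.
    by rewrite normr0; exact: cvg_within_filter.
by apply: DeriveDef; [apply/cvg_ex; exists 0|apply/cvg_lim].
Unshelve. all: by end_near. Qed.

Lemma is_derive_expinv m x : is_derive x (1 : R) (expinv m) (expinv m.+2 x - m%:R * expinv m.+1 x).
Proof.
have [x0|x0|->] := ltgtP x 0.
- rewrite {2 3}/expinv ltNge (ltW x0)/= mulr0 subr0.
  apply: (@near_eq_is_derive _ _ _ (fun=> 0)) => //.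
  near=> y; rewrite /expinv ifF//; apply/negbTE; rewrite -leNgt ltW//; near: y; exact: lt_nbhsl.
- apply: (@near_eq_is_derive _ R^o R^o (fun y : R => y^-1 ^+ m * expR (- y^-1))).
    near=> y; rewrite /expinv ifT//; near: y; exact: lt_nbhsr.
  have dV : is_derive x (1 : R) (fun y => y^-1) (- (x ^- 2)).
    have := @is_deriveV R id x 1 1 (lt0r_neq0 x0) (is_derive_id _ _).
    by rewrite /GRing.scale/= mulr1.
  have dE : is_derive x (1 : R) (fun y => expR (- y^-1)) (expR (- x^-1) * x ^- 2).
    apply: (@is_derive1_comp _ expR (fun y => - y^-1)).
    by have := is_deriveN dV; rewrite opprK.
  have := is_deriveX m dV; rewrite exprfctE => dX.
  apply: (is_derive_eq (is_deriveM dX dE)).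
  rewrite /expinv x0 /GRing.scale/= -!exprVn; move: (x^-1) (expR _) => y e.
  case: m {dX} => [|m] /=; first by rewrite !mul0r !mulr0 expr0; ring.
  by rewrite !exprS; ring.
(* At the origin [expinv m] equals [x^2] times the bounded function [expinv m.+2], so it is
   quadratically small and its derivative is zero. *)
- rewrite {2 3}/expinv ltxx mulr0 subr0.
  apply: (@is_derive_sqr_bound _ (m.+3%:R ^+ m.+2)) => y.
  by rewrite ger0_norm ?expinv_ge0// expinv_sqr mulrC ler_wpM2r ?sqr_ge0// expinv_le.
Unshelve. all: by end_near. Qed.

Lemma smooth_expinv m : smooth (expinv m).
Proof.
move=> k; elim: k m => [//|k IH] m; apply: smooth_uptoS (is_derive_expinv m) _.
apply: smooth_uptoD => //.
have := smooth_uptoM (smooth_upto_cst k (- m%:R)) (IH m.+1).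
by congr smooth_upto; apply/funext => x; rewrite mulNr.
Qed.

Definition bumpf (x : R) : R := expinv 0 x * expinv 0 (1 - x).

Lemma smooth_bump : smooth bumpf.
Proof.
move=> k; apply: smooth_uptoM; first exact: smooth_expinv.
have := smooth_upto_affine (-1) 1 (smooth_expinv 0 k).
by congr smooth_upto; apply/funext => x; rewrite mulN1r addrC.
Qed.

Lemma bump_ge0 x : 0 <= bumpf x.
Proof. by rewrite mulr_ge0 ?expinv_ge0. Qed.

Lemma bump_gt0 x : 0 < x < 1 -> 0 < bumpf x.
Proof. by move=> /andP[x0 x1]; rewrite mulr_gt0 ?expinv_gt0// subr_gt0. Qed.

Lemma bump_out x : ~~ (0 < x < 1) -> bumpf x = 0.
Proof.
rewrite /bumpf /expinv subr_gt0 => /nandP[/negbTE ->|/negbTE ->]; first by rewrite mul0r.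
by rewrite mulr0.
Qed.

Lemma bump_le1 x : bumpf x <= 1.
Proof.
have H y : expinv 0 y <= 1 := le_trans (expinv_le 0 y) _.
by rewrite /bumpf mulr_ile1 ?expinv_ge0 ?H ?expr0.
Qed.

End SmoothFunctions.

(** * Decay and derivatives of the transform of a test function *)

Section FourierDecay.
Variable R : realType.
Local Notation mu := (@lebesgue_measure R).
Local Notation intg f := (mu.-integrable setT (EFin \o f)).
Implicit Types f g : R -> R.

Definition test_real g := smooth g /\ exists r : R, forall x, r < `|x| -> g x = 0.

Lemma test_supp g : test_real g -> exists2 r : R, 0 < r & forall x, r < `|x| -> g x = 0.
Proof.
move=> [_ [r gr]]; exists (`|r| + 1); first by rewrite ltr_wpDl.
by move=> x rx; apply: gr; have := ler_norm r; lra.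
Qed.

Lemma smooth_continuous g : smooth g -> continuous g.
Proof. by move=> sg; apply: derivable_continuous => x; exact: smooth_derivable. Qed.

Lemma measurable_smooth g : smooth g -> measurable_fun setT g.
Proof. by move=> /smooth_continuous; exact: continuous_measurable_fun. Qed.

Lemma test_bounded g : test_real g -> exists2 B : R, 0 <= B & forall x, `|g x| <= B.
Proof.
move=> tg; have [r r0 gr] := test_supp tg.
have c : {within `[- r, r], continuous (fun x => `|g x|)}.
  apply: continuous_subspaceT => x; apply: cvg_norm; exact: (smooth_continuous tg.1).
have [|b _ Hb] := EVT_max _ c; first lra.
exists `|g b|; first exact: normr_ge0.
move=> x; have [rx|xr] := ltP r `|x|; first by rewrite gr// normr0.
by apply: Hb; rewrite in_itv/= -ler_norml.
Qed.

Lemma test_intg g : test_real g -> intg g.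
Proof.
move=> tg; have [r r0 gr] := test_supp tg; have [B B0 gB] := test_bounded tg.
apply: (integrable_le (g := fun x => B * \1_(`[- r, r]%classic) x)).
- exact: measurable_smooth tg.1.
- move=> x; have [rx|xr] := ltP r `|x|; first by rewrite gr// normr0 mulr_ge0.
  by rewrite indicE mem_set ?mulr1//= in_itv/= -ler_norml.
- by apply: intgZl; exact: (integrable_indic_itv (- r) r true false).
Qed.

Lemma derive1_out g (r : R) : (forall x, r < `|x| -> g x = 0) -> forall x, r < `|x| -> derive1 g x = 0.
Proof.
move=> gr x rx; rewrite derive1E.
rewrite (@near_eq_derive _ R^o R^o g (cst 0)) ?derive_cst//.
have c : `|y| @[y --> x] --> `|x| by exact: norm_continuous.
by near=> y; rewrite gr//; near: y; exact: (cvgr_gt _ c).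
Unshelve. all: by end_near. Qed.

Lemma test_derive1 g : test_real g -> test_real (derive1 g).
Proof.
move=> [sg [r gr]]; split; first exact: smooth_derive1.
by exists r; exact: derive1_out.
Qed.

Lemma test_derive1n n g : test_real g -> test_real (derive1n n g).
Proof. by move=> tg; elim: n => [|n IH]//; rewrite derive1nS; exact: test_derive1. Qed.

Lemma test_mulid g : test_real g -> test_real (fun x => x * g x).
Proof.
move=> [sg [r gr]]; split; last by exists r => x /gr ->; rewrite mulr0.
by move=> k; apply: smooth_uptoM => //; exact: smooth_id.
Qed.

Lemma integral_derive0 f f' (r : R) : (forall x, is_derive x (1 : R) f (f' x)) -> continuous f' ->
  (forall x, r < `|x| -> f x = 0) -> \int[mu]_x f' x = 0.
Proof.
move=> df cf fr; have [fd fE] := is_derive_fun df.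
have cF := derivable_continuous fd.
pose s : R := `|r| + 1; have s0 : 0 < s by rewrite ltr_wpDl.
have rs : r < s by have := ler_norm r; rewrite /s; lra.
have F' : (\int[mu]_(x in `[(- s)%R, s]) (f' x)%:E = (f s)%:E - (f (- s)%R)%:E)%E.
  apply: continuous_FTC2; first lra.
  - exact: continuous_subspaceT.
  - by split => [x _| |]; [exact: fd|apply: cvg_at_right_filter; exact: cF|apply: cvg_at_left_filter; exact: cF].
  - by move=> x _; rewrite fE.
rewrite (fr s) ?(fr (- s)) in F'; rewrite ?normrN ?gtr0_norm//.
transitivity (\int[mu]_(x in `[- s, s]) f' x); last by rewrite /Rintegral F' subee.
rewrite [RHS]Rintegral_mkcond; apply: eq_Rintegral => x _; rewrite patchE.
case: ifPn => // xs; rewrite -fE (derive1_out fr)//; apply: lt_trans rs _.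
by rewrite ltNge ler_norml; apply: contra xs => H; rewrite inE/= in_itv.
Qed.

Lemma trig_is_derive (a x : R) : is_derive x (1 : R) (fun y => cos (y * a)) (- sin (x * a) * a) /\
  is_derive x (1 : R) (fun y => sin (y * a)) (cos (x * a) * a).
Proof.
have d : is_derive x (1 : R) (fun y : R => y * a) a.
  have H : is_derive x 1 (fun y : R => y * a) (x * 0 + a * 1).
    exact: is_deriveM (is_derive_id x 1) (is_derive_cst a x 1).
  by rewrite mulr0 add0r mulr1 in H.
by split; apply: is_derive1_comp.
Qed.

(** Integration by parts, for cosine and sine at once; the boundary terms vanish with [g]. *)
Lemma integral_derive1_mul (g t t' : R -> R) xi : test_real g -> (forall x, is_derive x (1 : R) t (t' x)) ->
  continuous t' -> (forall x, `|t x| <= 1) -> (forall x, `|t' x| <= 1) ->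
  \int[mu]_y (derive1 g y * t (y * xi)) = - (xi * \int[mu]_y (g y * t' (y * xi))).
Proof.
move=> tg dt ct' t1 t'1; have [r _ gr] := test_supp tg; have tg' := test_derive1 tg.
have ct : continuous t by apply: derivable_continuous => x; have H := dt x; exact: ex_derive.
have i1 : intg (fun y => derive1 g y * t (y * xi)) := intg_trig xi (test_intg tg') ct t1.
have i2 : intg (fun y => g y * t' (y * xi)) := intg_trig xi (test_intg tg) ct' t'1.
have cM : continuous (fun y : R => y * xi) by move=> y; apply: cvgM; [exact: cvg_id|exact: cvg_cst].
have := @integral_derive0 (fun y => g y * t (y * xi))
   (fun y => derive1 g y * t (y * xi) + xi * (g y * t' (y * xi))) r.
rewrite (RintegralD measurableT i1 (intgZl xi i2)) (RintegralZl _ measurableT i2) => H.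
apply/eqP; rewrite -addr_eq0; apply/eqP; apply: H.
- move=> x; have dg := derivable_is_derive (@smooth_derivable _ _ x tg.1).
  have dM : is_derive x (1 : R) (fun y : R => y * xi) (x * 0 + xi * 1).
    exact: is_deriveM (is_derive_id x 1) (is_derive_cst xi x 1).
  have dT : is_derive x (1 : R) (fun y : R => t (y * xi)) _ :=
    @is_derive1_comp _ t (fun y : R => y * xi) x _ _ (dt (x * xi)) dM.
  apply: (is_derive_eq (is_deriveM dg dT)).
  by rewrite /GRing.scale/=; ring.
- have cg := smooth_continuous tg.1; have cg' := smooth_continuous tg'.1.
  move=> x; apply: cvgD.
    by apply: cvgM; [exact: cg'|exact: (continuous_comp (cM x) (ct _))].
  by apply: cvgM; [exact: cvg_cst|apply: cvgM; [exact: cg|exact: (continuous_comp (cM x) (ct' _))]].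
- by move=> x /gr ->; rewrite mul0r.
Qed.

Lemma sinT_derive1 g xi : test_real g -> sinT (derive1 g) xi = - (xi * cosT g xi).
Proof.
by move=> tg; apply: integral_derive1_mul => //; [exact: continuous_cos|exact: sin_max|exact: cos_max].
Qed.

Lemma cosT_derive1 g xi : test_real g -> cosT (derive1 g) xi = xi * sinT g xi.
Proof.
move=> tg; have i := intg_trig xi (test_intg tg) (@continuous_sin R) (@sin_max R).
rewrite /cosT (@integral_derive1_mul g cos (fun x => - sin x) xi tg (@is_derive_cos R)).
- rewrite (_ : (fun y => g y * - sin (y * xi)) = fun y => -1 * (g y * sin (y * xi))); last first.
    by apply/funext => y; ring.
  by rewrite (RintegralZl _ measurableT i) mulN1r mulrN opprK.
- by move=> x; apply: cvgN; exact: continuous_sin.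
- exact: cos_max.
- by move=> x; rewrite normrN sin_max.
Qed.

Lemma trigT_le g xi : test_real g -> `|cosT g xi| <= \int[mu]_x `|g x| /\ `|sinT g xi| <= \int[mu]_x `|g x|.
Proof.
move=> tg; have ig := test_intg tg; have nig := integrable_norm ig.
have H (t : R -> R) : continuous t -> (forall x, `|t x| <= 1) -> `|\int[mu]_y (g y * t (y * xi))| <= \int[mu]_x `|g x|.
  move=> ct t1; have it := intg_trig xi ig ct t1.
  apply: le_trans (le_normr_Rintegral measurableT it) _.
  apply: le_Rintegral => //; first exact: (integrable_norm it).
  by move=> x _; rewrite normrM ler_piMr.
by split; apply: H; [exact: continuous_cos|exact: cos_max|exact: continuous_sin|exact: sin_max].
Qed.

(** Passing from [g] to its derivative gains a factor [xi] and exchanges the two transforms, so the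
    induction on [m] must carry both. *)
Lemma trigT_decay (m : nat) g : test_real g ->
  exists B : R, forall xi, `|xi| ^+ m * `|cosT g xi| <= B /\ `|xi| ^+ m * `|sinT g xi| <= B.
Proof.
elim: m g => [|m IH] g tg.
  exists (\int[mu]_x `|g x|) => xi; rewrite !expr0 !mul1r; exact: trigT_le.
have [B HB] := IH _ (test_derive1 tg); exists B => xi; have [h1 h2] := HB xi.
rewrite sinT_derive1// normrN normrM mulrA -exprSr in h2.
by rewrite cosT_derive1// normrM mulrA -exprSr in h1.
Qed.

(** Differentiation under the integral sign; the derivative in [z] is dominated by [|y * g y|],
    integrable because [y * g y] is again a test function. *)
Lemma is_derive_under (g t t' : R -> R) (xi : R) : test_real g ->
  (forall x, is_derive x (1 : R) t (t' x)) -> (forall x, `|t x| <= 1) -> (forall x, `|t' x| <= 1) ->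
  is_derive xi (1 : R) (fun z => \int[mu]_y (g y * t (y * z))) (\int[mu]_y (y * g y * t' (y * xi))).
Proof.
move=> tg dt t1 t'1; have ty := test_mulid tg.
have [td _] := is_derive_fun dt.
have ct : continuous t := derivable_continuous td.
pose F z y := g y * t (y * z).
have dF z y : is_derive z (1 : R) (F^~ y) (y * g y * t' (y * z)).
  have d : is_derive z (1 : R) (fun z : R => y * z) y.
    have := is_deriveZ y (is_derive_id z (1 : R)).
    by rewrite /GRing.scale/= mulr1.
  have := is_deriveZ (g y) (is_derive1_comp (dt (y * z)) d); rewrite /GRing.scale/=.
  by rewrite (_ : g y * (t' (y * z) * y) = y * g y * t' (y * z)); last by ring.
have Ia : `]xi - 1, xi + 1[%classic xi by rewrite /= in_itv/=; apply/andP; split; lra.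
have intF z : `]xi - 1, xi + 1[%classic z -> intg (F z) by move=> _; exact: intg_trig (test_intg tg) ct t1.
have dvF z y : `]xi - 1, xi + 1[%classic z -> setT y -> derivable (F^~ y) z 1.
  by move=> _ _; have := dF z y => H; exact: ex_derive.
have pE z y : partial1of2 F z y = y * g y * t' (y * z) by rewrite partial1of2E derive_val.
have G0 (y : R) : 0 <= `|y * g y| by exact: normr_ge0.
have iG : intg (fun y => `|y * g y|) := integrable_norm (test_intg ty).
have GF z y : `]xi - 1, xi + 1[%classic z -> setT y -> `|partial1of2 F z y| <= `|y * g y|.
  by move=> _ _; rewrite pE normrM ler_piMr.
apply: DeriveDef; first exact: (derivable_under_integral measurableT Ia intF dvF G0 iG GF).
rewrite -derive1E (differentiation_under_integral measurableT Ia intF dvF G0 iG GF).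
by apply: eq_Rintegral => y _; rewrite pE.
Qed.

Lemma is_derive_cosT g xi : test_real g -> is_derive xi (1 : R) (cosT g) (- sinT (fun x => x * g x) xi).
Proof.
move=> tg; have i : intg (fun y => y * g y * sin (y * xi)).
  exact: intg_trig xi (test_intg (test_mulid tg)) (@continuous_sin R) (@sin_max R).
have := @is_derive_under g cos (fun x => - sin x) xi tg (@is_derive_cos R) (@cos_max R).
move=> H; apply: (is_derive_eq (H _)); first by move=> x; rewrite normrN sin_max.
rewrite /sinT -[RHS]mulN1r -(RintegralZl _ measurableT i).
by apply: eq_Rintegral => y _; rewrite mulN1r mulrN.
Qed.

Lemma is_derive_sinT g xi : test_real g -> is_derive xi (1 : R) (sinT g) (cosT (fun x => x * g x) xi).
Proof. by move=> tg; apply: is_derive_under => //; [exact: sin_max|exact: cos_max]. Qed.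

End FourierDecay.

(** * Families of Schwartz functions with polynomially growing seminorms *)

Section Families.
Variable R : realType.
Implicit Types F G : nat -> R -> R.

(** For [b = false] only the weight [m = 0] remains, which admits factors such as [cos(jx)] that do
    not decay. The base [j.+1] is at least 1, so exponents may be enlarged when two bounds are
    merged. *)
Definition growth (b : bool) F : Prop := forall m, b || (m == 0)%N ->
  exists (B : R) (p : nat), forall j x, `|x| ^+ m * `|F j x| <= B * j.+1%:R ^+ p.

(* Derivatives up to order [n] grow at most polynomially in the index; for [b = true] they also decay rapidly in [x]. *)
Fixpoint tame (b : bool) (n : nat) F : Prop :=
  growth b F /\
  if n is n'.+1 then (forall j x, derivable (F j) x 1) /\ tame b n' (fun j => derive1 (F j)) else True.

Lemma growthW F : growth true F -> growth false F.
Proof. by move=> H m _; exact: H. Qed.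

Lemma growth_bound (B B' : R) (p p' j : nat) : B <= B' -> 0 <= B' -> (p <= p')%N ->
  B * j.+1%:R ^+ p <= B' * j.+1%:R ^+ p'.
Proof.
move=> BB B0 pp; apply: (@le_trans _ _ (B' * j.+1%:R ^+ p)); first by rewrite ler_wpM2r// exprn_ge0.
by rewrite ler_wpM2l// ler_weXn2l// ler1n.
Qed.

Lemma growthD b F G : growth b F -> growth b G -> growth b (fun j x => F j x + G j x).
Proof.
move=> HF HG m bm; have [B [p HB]] := HF m bm; have [B' [p' HB']] := HG m bm.
exists (`|B| + `|B'|), (p + p')%N => j x; rewrite mulrDl.
apply: (@le_trans _ _ (`|x| ^+ m * `|F j x| + `|x| ^+ m * `|G j x|)).
  by rewrite -mulrDr ler_wpM2l ?exprn_ge0// ler_normD.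
apply: lerD.
  by apply: le_trans (HB j x) _; apply: growth_bound => //; [exact: ler_norm|exact: leq_addr].
by apply: le_trans (HB' j x) _; apply: growth_bound => //; [exact: ler_norm|exact: leq_addl].
Qed.

Lemma growthM b F G : growth b F -> growth false G -> growth b (fun j x => F j x * G j x).
Proof.
move=> HF HG m bm; have [B [p HB]] := HF m bm; have [//|B' [p' HB']] := HG 0%N.
exists (B * B'), (p + p')%N => j x; rewrite normrM mulrA exprD mulrACA.
apply: ler_pM => //.
by have := HB' j x; rewrite mul1r.
Qed.

Lemma tame_growth b n F : tame b n F -> growth b F.
Proof. by case: n => [|n] []. Qed.

Lemma tame_leS b n F : tame b n.+1 F -> tame b n F.
Proof. by elim: n F => [|n IH] F [g [d t]]; split => //; split => //; exact: IH. Qed.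

Lemma tameW n F : tame true n F -> tame false n F.
Proof.
elim: n F => [|n IH] F [g H]; split => //; try exact: growthW.
by case: H => d t; split => //; exact: IH.
Qed.

Lemma tameS b n F F' : growth b F -> (forall j x, is_derive x (1 : R) (F j) (F' j x)) ->
  tame b n F' -> tame b n.+1 F.
Proof.
move=> g d t; split => //; split => [j x|]; first by have := d j x => H; exact: ex_derive.
rewrite (_ : (fun j => _) = F')//; apply/funext => j.
by have [_ ->] := is_derive_fun (d j).
Qed.

Lemma tameD b n F G : tame b n F -> tame b n G -> tame b n (fun j x => F j x + G j x).
Proof.
elim: n F G => [|n IH] F G tF tG; have gF := tame_growth tF; have gG := tame_growth tG.
  by split => //; exact: growthD.
case: tF tG => _ [dF tF] [_ [dG tG]].
apply: (@tameS _ _ _ (fun j x => derive1 (F j) x + derive1 (G j) x)); first exact: growthD.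
  by move=> j x; apply: is_deriveD; exact: derivable_is_derive.
exact: IH.
Qed.

(** Decay is required of one factor only: this is what lets a fixed rapidly decreasing transform be
    multiplied by oscillations depending on [j]. *)
Lemma tameM b n F G : tame b n F -> tame false n G -> tame b n (fun j x => F j x * G j x).
Proof.
elim: n F G => [|n IH] F G tF tG; have gF := tame_growth tF; have gG := tame_growth tG.
  by split => //; exact: growthM.
have tF' := tame_leS tF; have tG' := tame_leS tG.
case: tF tG => _ [dF tF] [_ [dG tG]].
apply: (@tameS _ _ _ (fun j x => F j x * derive1 (G j) x + derive1 (F j) x * G j x)); first exact: growthM.
  move=> j x; rewrite [derive1 (F j) x * _]mulrC.
  by apply: is_deriveM; exact: derivable_is_derive.
by apply: tameD; apply: IH.
Qed.

Lemma tame_cst n (a : R) : tame false n (fun _ _ => a).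
Proof.
elim: n a => [|n IH] a.
  split=> // m /eqP ->; exists `|a|, 0%N => j x; by rewrite !expr0 mul1r mulr1.
apply: (@tameS _ _ _ (fun _ _ => 0)) => //.
by move=> m /eqP ->; exists `|a|, 0%N => j x; rewrite !expr0 mul1r mulr1.
Qed.

(** Each derivative brings out a factor [j] and exchanges cosine and sine; the general prefactor
    [s * j^p] makes the induction close. *)
Lemma tame_trig n : (forall (s : R) p, tame false n (fun j x => s * j%:R ^+ p * cos (x * j%:R))) /\
  (forall (s : R) p, tame false n (fun j x => s * j%:R ^+ p * sin (x * j%:R))).
Proof.
have g (t : R -> R) (s : R) p : (forall x, `|t x| <= 1) -> growth false (fun j x => s * j%:R ^+ p * t (x * j%:R)).
  move=> t1 m /eqP ->; exists `|s|, p => j x; rewrite expr0 mul1r !normrM.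
  rewrite -[leRHS]mulr1; apply: ler_pM => //.
  by rewrite ler_wpM2l// normrX lerXn2r ?nnegrE// ger0_norm// ler_nat.
elim: n => [|n [IHc IHs]].
  by split=> s p; split => //; apply: g; [exact: cos_max|exact: sin_max].
split=> s p.
  apply: (@tameS _ _ _ (fun j x => - s * j%:R ^+ p.+1 * sin (x * j%:R))) => //; first by apply: g; exact: cos_max.
  move=> j x; apply: (is_derive_eq (is_deriveZ (s * j%:R ^+ p) (trig_is_derive j%:R x).1)).
  by rewrite /GRing.scale/= exprS; ring.
apply: (@tameS _ _ _ (fun j x => s * j%:R ^+ p.+1 * cos (x * j%:R))) => //; first by apply: g; exact: sin_max.
move=> j x; apply: (is_derive_eq (is_deriveZ (s * j%:R ^+ p) (trig_is_derive j%:R x).2)).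
by rewrite /GRing.scale/= exprS; ring.
Qed.

(** Derivatives of [cosT g] and [sinT g] are, up to sign, [sinT] and [cosT] of [x * g x], which is
    again a test function. *)
Lemma tame_trigT n (g : R -> R) : test_real g ->
  tame true n (fun _ => cosT g) /\ tame true n (fun _ => sinT g).
Proof.
have gr g' : test_real g' -> growth true (fun _ => cosT g') /\ growth true (fun _ => sinT g').
  move=> tg'; split=> m _; have [B HB] := trigT_decay m tg'; exists B, 0%N => j x;
    by rewrite expr0 mulr1; have [] := HB x.
elim: n g => [|n IH] g tg; have [gc gs] := gr g tg; first by split.
have [IHc IHs] := IH _ (test_mulid tg); split.
  apply: (@tameS _ _ _ (fun _ x => -1 * sinT (fun x => x * g x) x)) => //.
    by move=> _ x; rewrite mulN1r; exact: is_derive_cosT.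
  have := tameM IHs (tame_cst n (-1)); congr tame; apply/funext => j; apply/funext => x; exact: mulrC.
by apply: (@tameS _ _ _ (fun _ => cosT (fun x => x * g x))) => // _ x; exact: is_derive_sinT.
Qed.

Lemma tame_derive1n b n F : (forall k, tame b k F) -> growth b (fun j => derive1n n (F j)).
Proof.
elim: n F => [|n IH] F tF; first exact: tame_growth (tF 0%N).
under eq_fun do rewrite derive1Sn; apply: IH => k.
by have [_ []] := tF k.+1.
Qed.

Lemma tame_derivable b n j x F : (forall k, tame b k F) -> derivable (derive1n n (F j)) x 1.
Proof.
elim: n F => [|n IH] F tF; first by have [_ [d _]] := tF 1%N; exact: d.
by rewrite derive1Sn; apply: (IH (fun j => derive1 (F j))) => k; have [_ []] := tF k.+1.
Qed.

(** Finitely many pairs of constant and exponent are merged into one. It is used for the weight [m]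
    and again for the order [n] of the derivative. *)
Lemma uniform_growth (P : nat -> R -> nat -> Prop) :
  (forall n B B' p p', P n B p -> B <= B' -> 0 <= B' -> (p <= p')%N -> P n B' p') ->
  (forall n, exists B p, P n B p) ->
  forall N, exists B p, forall n, (n <= N)%N -> P n B p.
Proof.
move=> mono HP; elim=> [|N [B [p H]]].
  by have [B [p H]] := HP 0%N; exists B, p => n; rewrite leqn0 => /eqP ->.
have [B' [p' H']] := HP N.+1.
exists (`|B| + `|B'|), (p + p')%N => n; rewrite leq_eqVlt => /predU1P[->|nN].
  apply: mono H' _ _ _; rewrite ?addr_ge0 ?leq_addl//.
  by apply: le_trans (ler_norm _) _; rewrite lerDr.
apply: mono (H n nN) _ _ _; rewrite ?addr_ge0 ?leq_addr//.
by apply: le_trans (ler_norm _) _; rewrite lerDl.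
Qed.

Lemma cderivE n (f g : R -> R) x : cderiv n (fun x => Complex (f x) (g x)) x = Complex (derive1n n f x) (derive1n n g x).
Proof. by []. Qed.

Lemma tame_schwartz F G : (forall k, tame true k F) -> (forall k, tame true k G) ->
  (forall j, schwartz (fun x => Complex (F j x) (G j x))) /\
  forall N, exists B p, forall n m j x, (n <= N)%N -> (m <= N)%N ->
    `|x| ^+ m * cabs (cderiv n (fun x => Complex (F j x) (G j x)) x) <= B * j.+1%:R ^+ p.
Proof.
move=> tF tG.
have S n m : exists (B : R) p, forall j x,
    `|x| ^+ m * cabs (cderiv n (fun x => Complex (F j x) (G j x)) x) <= B * j.+1%:R ^+ p.
  have [B [p H]] := tame_derive1n n tF (isT : true || (m == 0)%N); have [B' [p' H']] := tame_derive1n n tG (isT : true || (m == 0)%N).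
  exists (`|B| + `|B'|), (p + p')%N => j x; rewrite cderivE mulrDl.
  apply: (@le_trans _ _ (`|x| ^+ m * `|derive1n n (F j) x| + `|x| ^+ m * `|derive1n n (G j) x|)).
    by rewrite -mulrDr ler_wpM2l ?exprn_ge0// cabs_le_ReIm.
  apply: lerD.
    by apply: le_trans (H j x) _; apply: growth_bound => //; [exact: ler_norm|exact: leq_addr].
  by apply: le_trans (H' j x) _; apply: growth_bound => //; [exact: ler_norm|exact: leq_addl].
split=> [j|N].
  split=> [k x|n m]; first by split; [exact: (tame_derivable tF)|exact: (tame_derivable tG)].
  by have [B [p H]] := S n m; exists (B * j.+1%:R ^+ p) => x; exact: H.
pose P n m B p := forall j x,
  `|x| ^+ m * cabs (cderiv n (fun x => Complex (F j x) (G j x)) x) <= B * j.+1%:R ^+ p.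
have U n : exists B p, forall m, (m <= N)%N -> P n m B p.
  apply: uniform_growth; last exact: S.
  by move=> m B B' p p' H BB B0 pp j x; apply: le_trans (H j x) _; exact: growth_bound.
have [|B [p H]] := @uniform_growth (fun n B p => forall m, (m <= N)%N -> P n m B p) _ U N.
  by move=> n B B' p p' H BB B0 pp m mN j x; apply: le_trans (H m mN j x) _; exact: growth_bound.
by exists B, p => n m j x nN mN; exact: H.
Qed.

End Families.

(** * Schwartz functions and trigonometric sums as tempered distributions *)

Section SchwartzDistributions.
Variable R : realType.
Local Notation mu := (@lebesgue_measure R).
Local Notation C := (R[i]).
Local Notation intg f := (mu.-integrable setT (EFin \o f)).

Lemma smoothP (f : R -> R) : (forall k x, derivable (derive1n k f) x 1) -> smooth f.
Proof.
move=> H k; suff G i : smooth_upto k (derive1n i f) by exact: (G 0%N).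
elim: k i => [//|k IH] i; split; first exact: H.
by rewrite -derive1nS; exact: IH.
Qed.

Lemma smoothC_ReIm (f : R -> C) : smoothC f ->
  smooth (fun x => complex.Re (f x)) /\ smooth (fun x => complex.Im (f x)).
Proof. by move=> H; split; apply: smoothP => k x; [exact: (H k x).1|exact: (H k x).2]. Qed.

Lemma smoothC_rc (g : R -> R) : smooth g -> smoothC (fun x => rc (g x)).
Proof.
move=> sg k x; split => /=; apply: smooth_derivable; apply: smooth_derive1n => //.
by move=> i; exact: smooth_upto_cst.
Qed.

Lemma cmeas_smoothC (f : R -> C) : smoothC f -> cmeas f.
Proof. by move=> /smoothC_ReIm[s1 s2]; split; exact: measurable_smooth. Qed.

Lemma cderiv0 (f : R -> C) x : cderiv 0 f x = f x.
Proof. by apply: complexP. Qed.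

Lemma intg_inv1Dsqr : intg (fun x : R => (1 + x ^+ 2)^-1).
Proof.
have E (x : R) : (1 + x ^+ 2)^-1 = (oneDsqr x)^-1 by [].
have p0 (x : R) : 0 <= (1 + x ^+ 2)^-1 by rewrite invr_ge0 addr_ge0 ?sqr_ge0.
have c : continuous (fun x : R => (1 + x ^+ 2)^-1) := @continuous_oneDsqrV R.
apply/integrableP; split; first by apply/measurable_EFinP; exact: continuous_measurable_fun.
under eq_integral do rewrite /= ger0_norm//.
rewrite ge0_symfun_integralT//; last by move=> x /=; rewrite sqrrN.
rewrite (_ : [set x : R | _] = `[0, +oo[%classic); last first.
  by apply/seteqP; split => x/=; rewrite in_itv/= andbT.
by rewrite integral0y_oneDsqr -EFinM ltry.
Qed.

Lemma seminorm_bound (f : R -> C) (B : R) :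
  (forall m n x, (m <= 2)%N -> (n <= 2)%N -> `|x| ^+ m * cabs (cderiv n f x) <= B) ->
  forall x, cabs (f x) <= 2 * B * (1 + x ^+ 2)^-1.
Proof.
move=> H x; have := H 0%N 0%N x isT isT; have := H 2%N 0%N x isT isT.
rewrite cderiv0 expr0 real_normK ?num_real// => h2 h0.
by rewrite -[leRHS]/(_ / _) ler_pdivlMr; have := sqr_ge0 x; nra.
Qed.

Lemma schwartz_decay (f : R -> C) : schwartz f -> exists B, forall x, cabs (f x) <= B * (1 + x ^+ 2)^-1.
Proof.
move=> [_ H]; have [B0 H0] := H 0%N 0%N; have [B2 H2] := H 0%N 2%N.
exists (B0 + B2) => x; have := H0 x; have := H2 x.
rewrite cderiv0 expr0 real_normK ?num_real// => h2 h0.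
by rewrite -[leRHS]/(_ / _) ler_pdivlMr; have := sqr_ge0 x; nra.
Qed.

Lemma schwartz_cintegrable (f : R -> C) : schwartz f -> cintegrable f.
Proof.
move=> sf; have [B H] := schwartz_decay sf.
apply: (cintegrable_le (cmeas_smoothC sf.1) H).
exact: intgZl intg_inv1Dsqr.
Qed.

Lemma bounded_L2 (f : R -> C) (B : R) : cintegrable f -> (forall x, cabs (f x) <= B) -> L2 f.
Proof.
move=> fi fB; have mf := cintegrable_cmeas fi; split => //.
have i : intg (fun x => cabs (f x) ^+ 2).
  apply: (integrable_le (g := fun x => B * cabs (f x))).
  - by apply: measurable_funX; exact: cmeas_cabs.
  - by move=> x; rewrite ger0_norm ?sqr_ge0// expr2 ler_wpM2r ?cabs_ge0.
  - by apply: intgZl; exact: cintegrable_cabs.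
move/integrableP : i => [_]; under eq_integral do rewrite /= ger0_norm ?sqr_ge0//.
by [].
Qed.

Lemma schwartz_L12 (f : R -> C) : schwartz f -> L12 f.
Proof.
move=> sf; have fi := schwartz_cintegrable sf; split => //.
have [B HB] := sf.2 0%N 0%N; apply: (bounded_L2 fi (B := B)) => x.
by have := HB x; rewrite cderiv0 expr0 mul1r.
Qed.

Lemma test_fun_ReIm (f : R -> C) : test_fun f ->
  test_real (fun x => complex.Re (f x)) /\ test_real (fun x => complex.Im (f x)).
Proof. by move=> [/smoothC_ReIm[s1 s2] [K H]]; split; split => //; exists K => x /H ->. Qed.

Lemma test_fun_L12 (f : R -> C) : test_fun f -> L12 f.
Proof.
move=> tf; have [t1 t2] := test_fun_ReIm tf.
have fi : cintegrable f by split; exact: test_intg.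
split => //; have [B _ HB] := test_bounded t1; have [B' _ HB'] := test_bounded t2.
apply: (bounded_L2 fi (B := B + B')) => x.
by apply: le_trans (cabs_le_ReIm _) _; apply: lerD.
Qed.

Lemma test_fun_rc (g : R -> R) : test_real g -> test_fun (fun x => rc (g x)).
Proof.
move=> [sg [r gr]]; split; first exact: smoothC_rc.
by exists r => x /gr ->.
Qed.

Lemma test_real_shift (g : R -> R) (a : R) : test_real g -> test_real (fun x => g (x + a)).
Proof.
move=> [sg [r gr]]; split.
  move=> k; have := smooth_upto_affine 1 a (sg k).
  by congr smooth_upto; apply/funext => x; rewrite mul1r.
exists (r + `|a|) => x rx; apply: gr.
by have := ler_normB (x + a) a; rewrite addrK; lra.
Qed.

Lemma schwartz_rc (g : R -> R) : test_real g -> schwartz (fun x => rc (g x)).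
Proof.
move=> tg; split; first exact: smoothC_rc tg.1.
move=> n m.
have D0 x : derive1n n (fun=> 0 : R) x = 0.
  elim: n x => [//|n IH] x; rewrite derive1nS (_ : derive1n n _ = fun=> 0); last exact/funext.
  by rewrite derive1E derive_cst.
pose h x := derive1n n g x.
have th : test_real (fun x => x ^+ m * h x).
  elim: m => [|m IH].
    have := test_derive1n n tg; congr test_real; apply/funext => x; by rewrite mul1r.
  have := test_mulid IH; congr test_real; apply/funext => x; by rewrite exprS mulrA.
have [B _ HB] := test_bounded th; exists B => x.
rewrite cderivE D0 (cabs_rc (derive1n n g x)) -normrX -normrM; exact: HB.
Qed.

(** Integration against [trig_sum d L], taken term by term so that each summand is directly a shift
    in [cint_FS_mul]. *)
Definition trigdist (d : nat -> R) (L : nat) : distr R :=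
  fun f => \sum_(k < L) rc (d k) * cint setT (fun xi => f xi * expi (k%:R * xi)).

Let cintegrable_expi (f : R -> C) (a : R) : cintegrable f -> cintegrable (fun xi => f xi * expi (a * xi)).
Proof.
by move=> fi; apply: (cintegrableM (B := 1)) => //; [exact: cmeas_expi|move=> x; rewrite cabs_expi].
Qed.

Lemma tempered_trigdist d L : tempered (trigdist d L).
Proof.
split.
  move=> f g /schwartz_cintegrable fi /schwartz_cintegrable gi.
  rewrite /trigdist -big_split; apply: eq_bigr => k _ /=; rewrite -mulrDr -cintD; try exact: cintegrable_expi.
  by congr (_ * _); apply: eq_cint => x; rewrite mulrDl.
split.
  move=> l f /schwartz_cintegrable fi; rewrite /trigdist big_distrr; apply: eq_bigr => k _ /=.
  rewrite [RHS]mulrCA -(cintZ l (cintegrable_expi k%:R fi)).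
  by congr (_ * _); apply: eq_cint => x; rewrite mulrA.
pose I0 := \int[mu]_x (1 + x ^+ 2)^-1.
(* Order 2 is enough to dominate [f] by [2 B / (1 + x^2)]; the other factor 2 in [4 * I0] comes from
   [cabs_cint]. *)
exists 2%N, (\sum_(k < L) (`|d k| * (4 * I0))) => f B sf H.
have fi := schwartz_cintegrable sf; have fB := seminorm_bound H.
rewrite /trigdist mulr_suml; elim: L => [|L IH]; first by rewrite !big_ord0 cabs0.
rewrite !big_ord_recr/=; apply: le_trans (cabsD _ _) _; apply: lerD => //.
rewrite cabsM cabs_rc -mulrA ler_wpM2l//.
apply: le_trans (cabs_cint (cintegrable_expi L%:R fi)) _.
have -> : 4 * I0 * B = 2 * (2 * B * I0) by ring.
rewrite ler_wpM2l// /I0 -(RintegralZl _ measurableT intg_inv1Dsqr).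
apply: le_Rintegral => //.
- by apply: cintegrable_cabs; exact: cintegrable_expi.
- exact: intgZl intg_inv1Dsqr.
- by move=> x _; rewrite cabsM cabs_expi mulr1.
Qed.

Lemma cintegrable_shift (f : R -> C) (a : R) : cintegrable f -> cintegrable (fun x => f (x + a)).
Proof. by move=> [i1 i2]; split; [exact: (integrable_shift a i1)|exact: (integrable_shift a i2)]. Qed.

Lemma cintegrable_shift_sum d L (u : R -> C) : cintegrable u -> cintegrable (shift_sum d L u).
Proof.
move=> ui; apply: (@cintegrable_sum _ L (fun k x => rc (d k) * u (x + k%:R))) => k.
by apply: cintegrableZ; exact: cintegrable_shift.
Qed.

Lemma mult_op_trigdist d L (u psi : R -> C) : L12 u -> L12 psi ->
  mult_op (trigdist d L) u psi = cint setT (fun x => shift_sum d L u x * psi x).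
Proof.
move=> u12 p12; rewrite /mult_op /trigdist.
have i k : cintegrable (fun x => u (x + k%:R) * psi x).
  by apply: L2_cintegrableM; [exact: L2_shift u12.2|exact: p12.2].
under eq_bigr do rewrite (cint_FS_mul _ u12 p12) -cintZ//.
rewrite -(@cint_sum _ L (fun k x => rc (d k) * (u (x + k%:R) * psi x))); last by move=> k; exact: cintegrableZ.
apply: eq_cint => x; rewrite /shift_sum mulr_suml; apply: eq_bigr => k _; exact: mulrA.
Qed.

Lemma represents_trigdist d L (u : R -> C) : schwartz u ->
  represents (mult_op (trigdist d L) u) (shift_sum d L u).
Proof.
move=> su; have u12 := schwartz_L12 su.
have si := cintegrable_shift_sum d L u12.1; split; first exact: cintegrable_cmeas.
split=> [r|psi tpsi]; last by apply: mult_op_trigdist => //; exact: test_fun_L12.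
apply: (integrableS measurableT); [exact: measurable_itv|by []|exact: (cintegrable_cabs si)].
Qed.

Lemma FS_rc (g : R -> R) xi : intg g -> FS (fun x => rc (g x)) xi = Complex (cosT g xi) (- sinT g xi).
Proof.
move=> ig; have i0 : intg (fun=> 0 : R) by exact: integrable0.
rewrite (FS_cosT xi (v := fun x => rc (g x)) ig i0) /=.
have -> : cosT (fun=> 0 : R) xi = 0 by rewrite /cosT; under eq_Rintegral do rewrite mul0r; rewrite Rintegral_cst ?mul0r.
have -> : sinT (fun=> 0 : R) xi = 0 by rewrite /sinT; under eq_Rintegral do rewrite mul0r; rewrite Rintegral_cst ?mul0r.
by rewrite addr0 sub0r.
Qed.

Lemma FSinv_rc_shift (g : R -> R) a xi : intg g ->
  FSinv (fun x => rc (g (x + a))) xi =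
  rc (2 * pi)^-1 * (Complex (cosT g xi) (sinT g xi) * expi (- (xi * a))).
Proof.
move=> ig; rewrite /FSinv; congr (_ * _).
have ci : cintegrable (fun x => rc (g x)) by split => //; exact: integrable0.
have cie := cintegrable_expi xi ci.
have -> : cint setT (fun x => rc (g (x + a)) * expi (xi * x)) =
    cint setT (fun x => expi (- (xi * a)) * (rc (g x) * expi (xi * x))).
  rewrite -[RHS](cint_shift a); last by apply: cintegrable_cmeas; exact: cintegrableZ.
  by apply: eq_cint => x; rewrite mulrCA -expiD; congr (_ * expi _); ring.
rewrite cintZ// mulrC; congr (_ * _); rewrite /cint /cosT /sinT; congr Complex.
  by apply: eq_Rintegral => x _; rewrite Re_mul/= mul0r subr0 mulrC [xi * x]mulrC mulrC.
by apply: eq_Rintegral => x _; rewrite Im_mul/= mul0r addr0 [xi * x]mulrC.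
Qed.

(** For real [g] the inverse transform is the conjugate of the transform divided by [2 pi], so the
    shift by [j] is visible only in an oscillating factor, and differentiation costs powers of
    [j]. *)
Lemma FS_FSinv_tame (g : R -> R) : test_real g ->
  exists F G : nat -> R -> R, [/\ forall k, tame true k F, forall k, tame true k G &
   forall j xi, FS (fun x => rc (g x)) xi * FSinv (fun x => rc (g (x + j%:R))) xi = Complex (F j xi) (G j xi)].
Proof.
move=> tg; pose P := (2 * pi : R)^-1.
pose H (j : nat) xi := (cosT g xi * cosT g xi + sinT g xi * sinT g xi) * P.
have tH k : tame true k H.
  have [tc ts] := tame_trigT k tg.
  by apply: tameM; [apply: tameD; apply: tameM => //; exact: tameW|exact: tame_cst].
(* The factors [1 * j%:R ^+ 0] and [-1 * j%:R ^+ 0] give the oscillation the shape treated by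
   [tame_trig]. *)
exists (fun j xi => H j xi * (1 * j%:R ^+ 0 * cos (xi * j%:R))).
exists (fun j xi => H j xi * (-1 * j%:R ^+ 0 * sin (xi * j%:R))).
split=> [k|k|j xi].
- exact: tameM (tH k) ((tame_trig R k).1 1 0%N).
- exact: tameM (tH k) ((tame_trig R k).2 (-1) 0%N).
rewrite FS_rc ?FSinv_rc_shift; try exact: test_intg.
by apply: complexP; rewrite !(Re_mul, Im_mul)/= cosN sinN expr0 /H /P; ring.
Qed.

End SchwartzDistributions.

(** * Incompleteness of the space of distributional multipliers *)

Section NotCompleteM.
Variable R : realType.
Local Notation mu := (@lebesgue_measure R).
Local Notation C := (R[i]).
Local Notation intg f := (mu.-integrable setT (EFin \o f)).

(** The exponent is split as [cj/2 = qj + qj]. One half absorbs the power, with the constant [D],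
    where [exp q] accounts for [j + 1] in place of [j]; the other half exceeds [qj] and hence
    [D / kappa]. *)
Lemma exp_beats_power (c kappa A : R) (p : nat) : 0 < c -> 0 < kappa ->
  exists j : nat, A * j.+1%:R ^+ p + 1 < kappa * expR (c * j%:R / 2).
Proof.
move=> c0 k0; pose q := c / 4; have q0 : 0 < q by rewrite divr_gt0.
pose D := `|A| * (q^-1 ^+ p * (p.+1%:R ^+ p * expR q)) + 1.
have D0 : 0 < D by rewrite ltr_wpDl// !mulr_ge0// ?exprn_ge0 ?expR_ge0// invr_ge0 ltW.
pose j := Num.bound (D / (kappa * q)); exists j.
have H1 : A * j.+1%:R ^+ p + 1 <= D * expR (q * j%:R).
  have t0 : 0 <= q * j.+1%:R by rewrite mulr_ge0// ltW.
  have := exp_monomial_le p t0; rewrite exprMn => H.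
  have E : expR (q * j.+1%:R) = expR q * expR (q * j%:R) by rewrite -expRD -natr1; congr expR; ring.
  have H2 : j.+1%:R ^+ p <= q^-1 ^+ p * (p.+1%:R ^+ p * expR q) * expR (q * j%:R).
    by rewrite exprVn -mulrA ler_pdivlMl ?exprn_gt0// -mulrA -E.
  rewrite /D mulrDl mul1r; apply: lerD.
    apply: (@le_trans _ _ (`|A| * j.+1%:R ^+ p)).
      by rewrite ler_wpM2r ?exprn_ge0// ler_norm.
    by rewrite -mulrA ler_wpM2l.
  by apply: le_trans (expR_ge1Dx _); rewrite lerDl mulr_ge0// ltW.
apply: le_lt_trans H1 _.
have -> : c * j%:R / 2 = q * j%:R + q * j%:R by rewrite /q; field.
rewrite expRD mulrA ltr_pM2r ?expR_gt0//.
have kq : 0 < kappa * q by rewrite mulr_gt0.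
have := archi_boundP (ltW (divr_gt0 D0 kq)); rewrite -/j ltr_pdivrMr// => Hj.
apply: lt_le_trans Hj _; rewrite mulrC -mulrA ler_pM2l//.
by apply: le_trans (expR_ge1Dx _); rewrite lerDr.
Qed.

Lemma test_bump : test_real (@bumpf R).
Proof.
split; first exact: smooth_bump.
exists 1 => x x1; apply: bump_out; apply/negP => /andP[x0 xl].
by move: x1; rewrite gtr0_norm// ltNge (ltW xl).
Qed.

Lemma bump_shift_disjoint (x : R) (k j : nat) : k != j -> bumpf (x + k%:R) * bumpf (x + j%:R) = 0.
Proof.
move=> kj; have [/andP[a b]|/bump_out ->] := boolP (0 < x + k%:R < 1); last by rewrite mul0r.
have [/andP[a' b']|/bump_out ->] := boolP (0 < x + j%:R < 1); last by rewrite mulr0.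
case/eqP: kj; apply: (@itv01_disjoint _ x); first by rewrite ltW.
by rewrite ltW.
Qed.

Let u (x : R) : C := rc (bumpf x).
Let psi (j : nat) (x : R) : C := rc (bumpf (x + j%:R)).

Let schwartz_u : schwartz u. Proof. exact: schwartz_rc test_bump. Qed.

Let test_psi j : test_fun (psi j).
Proof. by apply: test_fun_rc; apply: test_real_shift; exact: test_bump. Qed.

Let cabs_psi j x : cabs (psi j x) = bumpf (x + j%:R).
Proof. by rewrite /psi cabs_rc ger0_norm ?bump_ge0. Qed.

Lemma sqnorm_bump_gt0 : 0 < sqnorm u.
Proof.
rewrite lt_def sqnorm_ge0 andbT; apply/eqP => /(sqnorm_eq0_ae (schwartz_L12 schwartz_u).2) [Z [mZ Z0 HZ]].
have : (mu `]0%R, 1%R[%classic <= mu Z)%E.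
  apply: le_measure; rewrite ?inE// => x; rewrite /= in_itv/= => x01; apply: HZ => /= /(congr1 (@complex.Re R)) /=.
  by apply/eqP; rewrite gt_eqF// bump_gt0.
by rewrite Z0 lebesgue_measure_itv/= lte_fin ltr01 sube0 lee_fin ler10.
Qed.

Lemma cint_shift_sum_bump (c : R) n j : (j < n)%N ->
  cint setT (fun x => shift_sum (ecoef c) n u x * psi j x) = rc (ecoef c j * sqnorm u).
Proof.
move=> jn.
have E x : shift_sum (ecoef c) n u x * psi j x = rc (ecoef c j * bumpf (x + j%:R) ^+ 2).
  rewrite /shift_sum mulr_suml (bigD1 (Ordinal jn))//= big1 => [|i ij].
    by apply: complexP; rewrite !(Re_add, Im_add, Re_mul, Im_mul)/=; ring.
  have := @bump_shift_disjoint x i j; rewrite /u /psi => H.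
  have {}H : bumpf (x + i%:R) * bumpf (x + j%:R) = 0 by apply: H; apply: contra ij => /eqP e; apply/eqP/val_inj.
  rewrite -mulrA (_ : rc (bumpf (x + i%:R)) * rc (bumpf (x + j%:R)) = 0) ?mulr0//.
  by apply: complexP; rewrite !(Re_mul, Im_mul)/= ?H; ring.
rewrite (eq_cint _ E); have u2 := (schwartz_L12 schwartz_u).2.
have iu : intg (fun x => cabs (u x) ^+ 2) := L2_intg u2.
have E2 x : cabs (u x) ^+ 2 = bumpf x ^+ 2 by rewrite cabs_rc real_normK ?num_real.
rewrite (funext E2) in iu.
apply: complexP => /=; last by rewrite Rintegral_cst// mul0r.
rewrite (RintegralZl _ measurableT (integrable_shift j%:R iu)) (Rintegral_shift j%:R (integrable_measurable iu)).
by rewrite /sqnorm; congr (_ * _); apply: eq_Rintegral => x _; rewrite -E2.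
Qed.

Section Weighted.
Variables (rho : (R -> \bar R) -> \bar R) (c : R) (w : R -> R).
Hypotheses (rhoN : banach_function_norm rho) (rhoT : translation_invariant rho) (c0 : 0 < c).
Hypotheses (w0 : forall x, 0 < w x)
  (wexp : forall x t : R, 0 <= t -> w x <= expR (- (c * t)) * w (x + t)).

Lemma MZ_trig_le (d : nat -> R) L : (MZ_norm rho w (trigdist d L) <= (coef_norm c d L)%:E)%E.
Proof.
apply: ge_ereal_sup => _ [f [sf [[mf ff] fn0]] <-].
have m := cmeas_smoothC sf.1.
have f0 := wnorm_ge0 rhoN c0 w0 wexp m.
apply: eratio_le => //.
apply: le_trans (wnorm_shift_sum rhoN rhoT c0 w0 wexp d L m ff).
apply: ereal_inf_lbound; exists (shift_sum d L f) => //=.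
exact: represents_trigdist.
Qed.

Lemma trigdist_cauchy (e : R) : 0 < e -> exists N, forall n m, (N <= n)%N -> (N <= m)%N ->
  (MZ_norm rho w (distr_sub (trigdist (ecoef c) n) (trigdist (ecoef c) m)) < e%:E)%E.
Proof.
move=> e0; have [K HK] := dcoef_small c0 e0; exists K => n m Kn Km.
rewrite (_ : distr_sub _ _ = trigdist (dcoef c n m) (maxn n m)); last first.
  by apply/funext => f; exact: (ecoef_diff c (fun k => cint setT (fun xi => f xi * expi (k%:R * xi)))).
by apply: le_lt_trans (MZ_trig_le _ _) _; rewrite lte_fin HK.
Qed.

Lemma memZ_bump : memZ rho w u.
Proof.
have mw := cmeas_weight c0 w0 wexp (cmeas_smoothC schwartz_u.1); split => //.
have [mi fi] := memZ_indic01 rhoN c0 w0 wexp.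
apply: le_lt_trans fi; apply: (rho_le rhoN) => [| |x]; try exact: Mplus_cabsE.
rewrite /cabsE !cabsM lee_fin ler_wpM2r ?cabs_ge0// cabs_ind cabs_rc ger0_norm ?bump_ge0//.
have [/andP[a b]|/bump_out ->//] := boolP (0 < x < 1).
by rewrite indicE mem_set ?bump_le1//= in_itv/= ltW.
Qed.

Lemma wnorm_bump_neq0 : wnorm rho w u <> 0%E.
Proof.
case: (rhoN) => [[A1 _] _ _ _ _] /A1 -/(_ (Mplus_cabsE memZ_bump.1)) H.
have : {ae mu, forall x, u x = 0}.
  apply: (ae_imp H) => x; rewrite /cabsE cabsM /u !cabs_rc (gtr0_norm (w0 x)) => -[] /eqP.
  by rewrite mulf_eq0 (gt_eqF (w0 x)) orbF normr_eq0 => /eqP ->.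
move=> H0; have := sqnorm_bump_gt0; rewrite -lte_fin -(integral_sqnorm (schwartz_L12 schwartz_u).2).
rewrite (ae_eq_integral (cst 0%E)) ?integral0 ?ltxx//.
  apply/measurable_EFinP; apply: measurable_funX; apply: cmeas_cabs; exact: cmeas_smoothC schwartz_u.1.
by apply: (ae_imp H0) => x -> _; rewrite cabs0 expr0n.
Qed.

Lemma not_MZ_complete : ~ MZ_complete rho w.
Proof.
move=> /(_ (trigdist (ecoef c))) [].
- move=> n; split; first exact: tempered_trigdist.
  by apply: le_lt_trans (MZ_trig_le _ _) _; exact: ltry.
- exact: trigdist_cauchy.
move=> b [[[_ [_ [N [K Hb]]]] _] Hcv].
have mu_ := cmeas_smoothC schwartz_u.1.
have [_ fu] := memZ_bump; have nu := wnorm_bump_neq0.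
have yp : (0 < wnorm rho w u)%E.
  by rewrite lt_def (wnorm_ge0 rhoN c0 w0 wexp mu_) andbT; apply/eqP.
pose f j xi := FS u xi * FSinv (psi j) xi.
have [F [G [tF tG FG]]] := FS_FSinv_tame test_bump.
(* [N] is the order in the temperedness bound of [b]; up to that order all seminorms of [f j] are at
   most [B (j+1)^p]. *)
have [sFG /(_ N)[B [p HB]]] := tame_schwartz tF tG.
have bf j : cabs (b (f j)) <= K * (B * j.+1%:R ^+ p).
  rewrite (_ : f j = fun xi => Complex (F j xi) (G j xi)); last by apply/funext => xi; exact: FG.
  by apply: Hb => // m n x mN nN; exact: HB.
(* The value of [b] at [f j] is at most [K B (j+1)^p]; the extra 1 leaves room for the contribution
   of [v']. *)
have [j Hj] := exp_beats_power (K * B) p c0 sqnorm_bump_gt0.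
pose E : set R := `[- j%:R, - j%:R + 1[%classic.
have mE : measurable E := measurable_itv _.
have E1 : mu E = 1%E.
  by rewrite lebesgue_measure_itv/= lte_fin ltrDl ltr01 -EFinB; congr (_%:E); ring.
have Ey : (mu E < +oo)%E by rewrite E1 ltry.
have Ea x : E x -> - j%:R <= x by rewrite /E /= in_itv/= => /andP[].
have [D [D0 HD]] := local_bound rhoN c0 w0 wexp mE Ey Ea.
(* The factor 2 anticipates the one in [cabs_cint]: an integral of [|v'|] of at most 1/2 over the
   window yields a pairing of modulus at most 1. *)
pose e := (2 * (D + 1))^-1.
have D1 : 0 < D + 1 by rewrite ltr_pwDr.
have e0 : 0 < e by rewrite invr_gt0 mulr_gt0.
have ey : 0 < e / fine (wnorm rho w u) by rewrite divr_gt0// fine_gt0// yp.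
have [n [jn Hn]] := cvg0_eventually_lt j ey Hcv.
have H : (eratio (distr_Znorm rho w (mult_op (distr_sub (trigdist (ecoef c) n) b) u))
      (wnorm rho w u) < (e / fine (wnorm rho w u))%:E)%E.
  by apply: le_lt_trans Hn; apply: ereal_sup_ubound; exists u => //=; split => //; split => //; exact: memZ_bump.
have [_ [v' [mv' [_ Hv']] <-] wv'] := eratio_lt_inf yp fu H.
have psiE x : ~ E x -> psi j x = 0.
  move=> nE; rewrite /psi bump_out//; apply/negP => /andP[a d]; apply: nE.
  by rewrite /E/= in_itv/=; apply/andP; split; lra.
have L3 : (\int[mu]_(x in E) (cabs (v' x))%:E <= 2^-1%:E)%E.
  apply: le_trans (HD _ mv' (lt_trans wv' (ltry _))) _.
  apply: (@le_trans _ _ (D%:E * e%:E)%E); first by apply: lee_wpmul2l; rewrite ?lee_fin// ltW.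
  by rewrite -EFinM lee_fin /e invfM mulrCA ler_piMr// ler_pdivrMr// mul1r lerDl.
have mp : cmeas (fun x => v' x * psi j x) by apply: cmeasM => //; exact: (cmeas_smoothC (test_psi j).1).
(* [psi j] vanishes outside the window [E] and is at most 1, so the bound over [E] controls the
   integral over the whole line. *)
have Lp : (\int[mu]_x (cabs (v' x * psi j x)%R)%:E <= 2^-1%:E)%E.
  apply: le_trans L3; rewrite [leRHS]integral_mkcond.
  apply: ge0_le_integral => //.
  - by move=> x _; rewrite lee_fin cabs_ge0.
  - by apply/measurable_EFinP; exact: cmeas_cabs.
  - apply/(measurable_restrictT _ mE); apply/measurable_EFinP; apply: measurable_funTS; exact: cmeas_cabs.
  - move=> x _; rewrite patchE; case: ifPn => [xE|xE].
      by rewrite lee_fin cabsM cabs_psi ler_piMr ?cabs_ge0// bump_le1.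
    by rewrite psiE ?mulr0 ?cabs0//; move: xE; rewrite notin_setE.
have ip : intg (fun x => cabs (v' x * psi j x)).
  apply/integrableP; split; first by apply/measurable_EFinP; exact: cmeas_cabs.
  under eq_integral do rewrite /= ger0_norm ?cabs_ge0//.
  by apply: le_lt_trans Lp _; exact: ltry.
have ci : cintegrable (fun x => v' x * psi j x) by apply: (cintegrable_le mp _ ip) => x.
have cv : cabs (cint setT (fun x => v' x * psi j x)) <= 1.
  apply: le_trans (cabs_cint ci) _.
  by rewrite -ler_pdivlMl// mulr1 -lee_fin -(EFin_Rintegral ip).
have key : trigdist (ecoef c) n (f j) = rc (ecoef c j * sqnorm u).
  rewrite -(cint_shift_sum_bump c jn); apply: mult_op_trigdist; first exact: schwartz_L12.
  exact: test_fun_L12.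
(* Testing the representation of [a_n - b] applied to [u] against [psi j]: the pairing with [v'] is
   the difference of the values of [a_n] and [b] at [f j]. *)
have := Hv' _ (test_psi j); rewrite /mult_op /distr_sub -/(f j) key => Hk.
have : rc (ecoef c j * sqnorm u) = cint setT (fun x => v' x * psi j x) + b (f j) by rewrite -Hk subrK.
move=> /(congr1 (@cabs R)); rewrite cabs_rc ger0_norm; last first.
  by rewrite mulr_ge0 ?expR_ge0 ?sqnorm_ge0.
have := cabsD (cint setT (fun x => v' x * psi j x)) (b (f j)); have := bf j; move: Hj.
rewrite /ecoef; move: (cabs _) (cabs (b _)) (cabs (_ + _)) (expR _) (sqnorm u) cv.
move=> X Y Z W S; rewrite mulrA; lra.
Qed.

End Weighted.
End NotCompleteM.

(** * The two weights and the conclusion *)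

(** The slope is 1 on the left half line and at least 1 on the right one; an interval crossing the
    origin is split there, where [phi 0 = 0]. *)
Lemma phi_increment (R : realType) (phi : R -> R) :
  (forall x, x <= 0 -> phi x = x) ->
  (forall x z, 0 <= x -> x < z -> 1 <= (phi z - phi x) / (z - x)) ->
  forall x t, 0 <= t -> phi x + t <= phi (x + t).
Proof.
move=> phi_neg phi_pos x t; rewrite le_eqVlt => /predU1P[<-|t0]; first by rewrite !addr0.
have incr a b : 0 <= a -> a < b -> b - a <= phi b - phi a.
  by move=> a0 ab; have := phi_pos a b a0 ab; rewrite ler_pdivlMr ?subr_gt0// mul1r.
have [x0|x0] := leP 0 x; first by have := incr x (x + t) x0 _; rewrite ltrDl => /(_ t0); lra.
rewrite (phi_neg x (ltW x0)); have [xt|xt] := leP (x + t) 0; first by rewrite phi_neg.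
by have := incr 0 (x + t) (lexx 0) xt; rewrite (phi_neg 0)//; lra.
Qed.

Theorem theorem6p5 (R : realType) (rho : (R -> \bar R) -> \bar R)
  (c : R) (phi : R -> R) (w : R -> R) :
  banach_function_norm rho -> translation_invariant rho ->
  0 < c ->
  (forall x, x <= 0 -> phi x = x) ->
  (forall x z, 0 <= x -> x < z -> 1 <= (phi z - phi x) / (z - x)) ->
  (w = (fun x => expR (c * x)) \/ w = (fun x => expR (c * phi x))) ->
  ~ MZ_complete rho w /\ ~ M0Z_complete rho w.
Proof.
move=> rhoN rhoT c0 phi_neg phi_pos hw.
have w0 x : 0 < w x by case: hw => ->; exact: expR_gt0.
have wexp x t : 0 <= t -> w x <= expR (- (c * t)) * w (x + t).
  move=> t0; case: hw => ->; rewrite -expRD ler_expR; first by rewrite mulrDr addrCA addNr addr0.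
  by have := ler_wpM2l (ltW c0) (phi_increment phi_neg phi_pos x t0); rewrite mulrDr; lra.
by split; [exact: (not_MZ_complete rhoN rhoT c0 w0 wexp)|exact: (not_M0Z_complete rhoN rhoT c0 w0 wexp)].
Qed.
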